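(* Let $G$ be a plane triangulation with $f$ faces in which every vertex has degree $5$ or $6$, and let $T$ be the set of vertices of degree $5$. Then $\tau(G,T) \leq \sqrt{\tfrac{12}{5} f}$, with equality if and only if $f = 60k^2$ for some positive integer $k$ and $\mathrm{Aut}(G) \cong I_h$.
   Context: A $T$-join of $G$ is a set $J \subseteq E(G)$ such that the set of odd-degree vertices of the graph $(V(G),J)$ is exactly $T$; $\tau(G,T)$ is the minimum size of a $T$-join (here $|T|=12$ by Euler's formula, so $|T|$ is even). $\mathrm{Aut}(G)$ is the automorphism group of $G$, and $I_h \cong A_5 \times C_2$ is the full icosahedral group (all symmetries, including reflections, of the regular icosahedron). *)

(* Defs.v *)
From HB Require Import structures.
From mathcomp Require Import all_boot all_order all_algebra all_fingroup all_solvable all_field.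
Set Implicit Arguments. Unset Strict Implicit. Unset Printing Implicit Defensive.
Import Order.TTheory GRing.Theory Num.Theory.

(* A (simplicial) triangulation given by its vertex type V and its set of
   triangular faces F (each face a 3-element vertex set). *)
Section Triangulation.
Variables (V : finType) (F : {set {set V}}).

Definition tri_edges : {set {set V}} :=
  [set e : {set V} | (#|e| == 2) && [exists t in F, e \subset t]].

Definition tri_adj : rel V := fun x y => [set x; y] \in tri_edges.

Definition tri_deg (v : V) : nat := #|[set w | tri_adj v w]|.

Definition link_rel (v : V) : rel V := fun a b => [set v; a; b] \in F.

(* F is a triangulation of the 2-sphere, i.e. the underlying graph is a
   plane triangulation with face set F:
   - every face is a triangle,
   - every edge lies in exactly two faces,
   - every vertex lies in a face and its link is connected (hence a cycle),
   - the graph is connected,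
   - Euler characteristic V - E + F = 2. *)
Definition plane_triangulation : Prop :=
  [/\ forall t, t \in F -> #|t| = 3,
      forall e, e \in tri_edges -> #|[set t in F | e \subset t]| = 2,
      forall v, exists2 t, t \in F & v \in t,
      (forall v a b, tri_adj v a -> tri_adj v b -> connect (link_rel v) a b) /\
      (forall x y : V, connect tri_adj x y) &
      #|V| + #|F| = #|tri_edges| + 2].

Definition jdeg (J : {set {set V}}) (v : V) : nat := #|[set e in J | v \in e]|.

Definition is_Tjoin (T : {set V}) (J : {set {set V}}) : bool :=
  (J \subset tri_edges) && ([set v | odd (jdeg J v)] == T).

(* minimum size of a T-join (default #|E|.+1 if there is none) *)
Definition tau (T : {set V}) : nat :=
  \big[minn/#|tri_edges|.+1]_(J : {set {set V}} | is_Tjoin T J) #|J|.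

Definition graph_aut : {set {perm V}} :=
  [set s : {perm V} | [forall x, forall y, tri_adj (s x) (s y) == tri_adj x y]].

End Triangulation.

(* The full icosahedral group I_h = A_5 x C_2. *)
Definition Ih : {set ({perm 'I_5} * {perm bool})} :=
  setX ('Alt_('I_5))%g [set: {perm bool}].

(* Main.v *)
Require Import Defs.
From HB Require Import structures.
From mathcomp Require Import all_boot all_order all_algebra all_fingroup all_solvable all_field.
From mathcomp Require Import zify.
Set Implicit Arguments. Unset Strict Implicit. Unset Printing Implicit Defensive.

(** Let mu x be the least size of a (T + x0 + x)-join. The level sets of mu form
    a laminar family of 2 tau sets, each containing an odd number of vertices of
    T, whose boundary moats in the midpoint subdivision are disjoint. By
    Gauss-Bonnet, a disc with p <= 5 vertices of degree 5, n inner faces and l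
    faces with exactly two vertices inside satisfies (6 - p) n <= l^2, and this
    bounds the area of the moats from below: 5 (2 tau)^2 <= 12 (4 f).

    In the case of equality every set of the family separates a single vertex of
    T, so f = 60 k^2, tau = 12 k and the vertices of T are at distance at least
    2 k from each other. The balls of radius k - 1 about T are then flat cones
    that tile the surface, and the gluing of the cones satisfies the relations of
    the Coxeter group H3. This group has order 120 and acts transitively, hence
    regularly, on the 120 flags at T; the automorphisms of the triangulation are
    the permutations commuting with it.

    Conversely, if Aut has order 120, the flags modulo Aut are the quotient of the
    triangular lattice by a sublattice of index 3 k^2 invariant under all
    symmetries fixing a vertex. Such a sublattice has no vector of length less
    than 2 k, so the vertices of T are at distance at least 2 k, and the balls
    about them are 12 k disjoint T-cuts. *)

(** * Faces, edges and links *)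

(** Two elementary facts drive the estimate: [p * (6 - p) >= 5] for [1 <= p <= 5], which settles
    nested sets, and the subadditivity of [N ^ 2 / p], which settles disjoint ones, with [p = 12] in
    total. Since [p = 5] also attains the first bound, the isoperimetric inequality carries an extra
    unit for [p >= 2]; this is what forces single vertices in the case of equality. Three obstacles
    shape the rest. Level sets of joins are well behaved in bipartite graphs, so lengths are doubled
    and every vertex set carries a flag that says on which half of a cut edge its boundary runs. A
    level set is connected but its complement need not be, so it is replaced by one side of an odd
    component of the complement; a disc is then a connected set with connected complement, and its
    Euler characteristic comes from collapsing faces. Finally [graph_aut] only preserves adjacency,
    so separating triangles must be excluded before automorphisms can act on flags. The group is
    recognised by computation: a rewriting system lists 120 normal forms, and these identify any two
    groups that satisfy the relations and have at least 120 elements. *)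

Section Basics.
Variables (V : finType) (F : {set {set V}}).
Hypothesis PT : plane_triangulation F.

Definition face x y z := [set x; y; z] \in F.

Let card_face t : t \in F -> #|t| = 3.
Proof. by case: PT => H _ _ _ _; apply: H. Qed.
Let edge_faces e : e \in tri_edges F -> #|[set t in F | e \subset t]| = 2.
Proof. by case: PT => _ H _ _ _; apply: H. Qed.

Lemma set3_swap12 (x y z : V) : [set x; y; z] = [set y; x; z].
Proof. by rewrite [[set x; y]]setUC. Qed.

Lemma set3_swap23 (x y z : V) : [set x; y; z] = [set x; z; y].
Proof. by rewrite -!setUA [[set y] :|: _]setUC. Qed.

Lemma set3_rot (x y z : V) : [set x; y; z] = [set y; z; x].
Proof. by rewrite set3_swap12 set3_swap23. Qed.

Lemma card_set3 (x y z : V) :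
  (#|[set x; y; z]| == 3) = [&& x != y, x != z & y != z].
Proof.
rewrite setUC cardsU1 cards2 !inE !negb_or [z == x]eq_sym [z == y]eq_sym.
by case: (x =P y) => [->|_] /=; case: (_ == z); case: (_ == z).
Qed.

Lemma face_swap12 x y z : face x y z = face y x z.
Proof. by rewrite /face set3_swap12. Qed.
Lemma face_swap23 x y z : face x y z = face x z y.
Proof. by rewrite /face set3_swap23. Qed.
Lemma face_rot x y z : face x y z = face y z x.
Proof. by rewrite /face set3_rot. Qed.

Lemma face_neq x y z : face x y z -> [&& x != y, x != z & y != z].
Proof. by move/card_face/eqP; rewrite card_set3. Qed.

Lemma faceP t : t \in F -> exists x y z, t = [set x; y; z].
Proof.
move=> tF; have /card_face t3 := tF.
have /card_gt0P[x xt] : 0 < #|t| by rewrite t3.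
have t2 : #|t :\ x| = 2 by move: t3; rewrite (cardsD1 x) xt => -[].
have /cards2P[y [z [_ E]]] : #|t :\ x| == 2 by rewrite t2.
by exists x, y, z; rewrite -setUA -E setD1K.
Qed.

Lemma face_third t x y : t \in F -> x \in t -> y \in t -> x != y ->
  exists2 z, t = [set x; y; z] & face x y z.
Proof.
move=> tF xt yt nxy; have t3 := card_face tF.
have : #|t :\: [set x; y]| = 1.
  rewrite cardsD (setIidPr _) ?cards2 ?nxy ?t3 //.
  by apply/subsetP=> u; rewrite !inE => /orP[]/eqP->.
move/eqP/cards1P=> [z E]; have Et : t = [set x; y; z].
  rewrite -E; apply/setP=> u; rewrite !inE.
  by case: eqP => [->|_] //=; case: eqP => [->|].
by exists z => //; rewrite /face -Et.
Qed.

Lemma adjP x y : reflect (exists z, face x y z) (tri_adj F x y).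
Proof.
rewrite /tri_adj !inE; apply: (iffP andP) => [[c2 /existsP[t /andP[tF st]]]|[z f]].
  have nxy : x != y by move: c2; rewrite cards2; case: (x != y).
  have [z _ f] := face_third tF (subsetP st _ (set21 _ _)) (subsetP st _ (set22 _ _)) nxy.
  by exists z.
have /and3P[nxy _ _] := face_neq f.
by rewrite cards2 nxy; split=> //; apply/existsP; exists [set x; y; z]; rewrite [_ \in F]f subsetUl.
Qed.

Lemma adj_sym x y : tri_adj F x y = tri_adj F y x.
Proof. by rewrite /tri_adj setUC. Qed.

Lemma adj_neq x y : tri_adj F x y -> x != y.
Proof. by case/adjP=> z /face_neq/and3P[]. Qed.

Lemma face_adj12 x y z : face x y z -> tri_adj F x y.
Proof. by move=> f; apply/adjP; exists z. Qed.
Lemma face_adj13 x y z : face x y z -> tri_adj F x z.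
Proof. by rewrite face_swap23 => /face_adj12. Qed.
Lemma face_adj23 x y z : face x y z -> tri_adj F y z.
Proof. by rewrite face_rot => /face_adj12. Qed.

Lemma face_in_adj t x y : t \in F -> x \in t -> y \in t -> x != y -> tri_adj F x y.
Proof. by move=> tF xt yt n; have [z _ /face_adj12] := face_third tF xt yt n. Qed.

Lemma edgeP e : e \in tri_edges F -> exists x y, e = [set x; y] /\ tri_adj F x y.
Proof.
move=> eE; have : #|e| == 2 by move: eE; rewrite inE => /andP[].
by case/cards2P=> x [y [nxy E]]; exists x, y; rewrite /tri_adj -E.
Qed.

(** The apex of the second face at the edge [x y]. The default is never reached when [x y z] is a
    face. *)
Definition opp x y z : V := odflt z [pick w | (w != z) && face x y w].

Lemma opp_spec x y z : face x y z ->
  [/\ face x y (opp x y z), opp x y z != z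
    & forall w, face x y w -> w = z \/ w = opp x y z].
Proof.
move=> f; have /edge_faces : [set x; y] \in tri_edges F by apply: face_adj12 f.
have /and3P[nxy _ _] := face_neq f.
set S := [set t in F | _] => c2.
have inS w : face x y w -> [set x; y; w] \in S.
  by move=> fw; rewrite inE [_ \in F]fw subsetUl.
have inj w w' : face x y w -> face x y w' -> [set x; y; w] = [set x; y; w'] -> w = w'.
  move=> /face_neq/and3P[_ n1 n2] _ /setP/(_ w); rewrite !inE eqxx orbT.
  by rewrite eq_sym (negPf n1) eq_sym (negPf n2) /= => /esym/eqP.
have [t tS nt] : exists2 t, t \in S & t != [set x; y; z].
  have : 0 < #|S :\ [set x; y; z]| by move: c2; rewrite (cardsD1 [set x;y;z] S) inS // add1n => -[->].
  by case/card_gt0P=> t; rewrite in_setD1 => /andP[]; exists t.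
have := tS; rewrite inE => /andP[tF st].
have [w Et fw] := face_third tF (subsetP st _ (set21 _ _)) (subsetP st _ (set22 _ _)) nxy.
have nw : w != z by apply: contraNneq nt => E; rewrite Et E.
rewrite /opp; case: pickP => [w' /andP[nw' fw']|/(_ w)]; last by rewrite nw fw.
split=> //= u fu.
have [->|nu] := eqVneq u z; [by left|right].
apply/eqP; case: (eqVneq u w') => // nuw.
have sub : [set [set x; y; z]; [set x; y; w']; [set x; y; u]] \subset S.
  by apply/subsetP=> s; rewrite !inE -!orbA => /or3P[]/eqP->; rewrite subsetUl [_ \in F](f, fw', fu).
have := subset_leq_card sub; rewrite c2.
have -> : #|[set [set x; y; z]; [set x; y; w']; [set x; y; u]]| = 3.
  apply/eqP; rewrite setUC cardsU1 cards2 !inE.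
  have -> : [set x; y; z] != [set x; y; w'] by apply: contraNneq nw' => /inj->.
  have /negPf-> : [set x; y; u] != [set x; y; z] by apply: contraNneq nu => /inj->.
  by have /negPf-> : [set x; y; u] != [set x; y; w'] by apply: contraNneq nuw => /inj->.
by [].
Qed.

Lemma opp_face x y z : face x y z -> face x y (opp x y z).
Proof. by case/opp_spec. Qed.
Lemma opp_neq x y z : face x y z -> opp x y z != z.
Proof. by case/opp_spec. Qed.
Lemma opp_only x y z w : face x y z -> face x y w -> w != z -> w = opp x y z.
Proof. by case/opp_spec=> _ _ H /H[->|//]; rewrite eqxx. Qed.
Lemma oppK x y z : face x y z -> opp x y (opp x y z) = z.
Proof.
by move=> f; apply/esym/opp_only; rewrite ?opp_face // eq_sym opp_neq.
Qed.
Lemma opp_sym x y z : face x y z -> opp y x z = opp x y z.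
Proof.
move=> f; apply/esym/opp_only; rewrite ?opp_neq // 1?face_swap12 //; exact: opp_face.
Qed.

Lemma card_link v a : tri_adj F v a -> #|[set b | face v a b]| = 2.
Proof.
case/adjP=> b f; have -> : [set b | face v a b] = [set b; opp v a b].
  apply/setP=> c; rewrite !inE; apply/idP/orP => [fc|[]/eqP-> //]; last exact: opp_face.
  by have [_ _ H] := opp_spec f; case: (H c fc) => ->; rewrite eqxx; [left|right].
by rewrite cards2 eq_sym opp_neq.
Qed.

Lemma link_connect v a b : tri_adj F v a -> tri_adj F v b -> connect (link_rel F v) a b.
Proof. by case: PT => _ _ _ [H _] _; apply: H. Qed.

Lemma graph_connect x y : connect (tri_adj F) x y.
Proof. by case: PT => _ _ _ [_ H] _; apply: H. Qed.

Lemma vertex_face v : exists a b, face v a b.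
Proof.
case: PT => _ _ /(_ v)[t tF vt] _ _.
have t3 := card_face tF.
have /card_gt0P[a] : 0 < #|t :\ v| by move: t3; rewrite (cardsD1 v t) vt add1n => -[->].
rewrite !inE => /andP[nav at_].
have nva : v != a by rewrite eq_sym.
have [b _ f] := face_third tF vt at_ nva.
by exists a, b.
Qed.

Lemma closed_link v (A : {set V}) a : tri_adj F v a -> a \in A ->
  (forall b c, b \in A -> face v b c -> c \in A) -> forall b, tri_adj F v b -> b \in A.
Proof.
move=> va aA cl b vb; have /connectP[p] := link_connect va vb.
elim: p a aA {va} => [|c p IH] a aA /=; first by move=> _ ->.
by case/andP=> f pp E; apply: IH pp E; apply: cl f.
Qed.

Lemma closed_graph (A : {set V}) a : a \in A ->
  (forall b c, b \in A -> tri_adj F b c -> c \in A) -> forall b, b \in A.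
Proof.
move=> aA cl b; have /connectP[p] := graph_connect a b.
elim: p a aA => [|c p IH] a aA /=; first by move=> _ ->.
by case/andP=> f pp E; apply: IH pp E; apply: cl f.
Qed.

End Basics.

(** * Gauss-Bonnet *)

Section Counting.
Variables (V : finType) (F : {set {set V}}).
Hypothesis PT : plane_triangulation F.
Hypothesis D56 : forall v : V, tri_deg F v = 5 \/ tri_deg F v = 6.

Definition pent : {set V} := [set v | tri_deg F v == 5].
Definition pcnt (X : {set V}) := #|X :&: pent|.
(** For a disc [X], [nfc X 2] plays the role of the length of its boundary seen from inside and
    [nfc X 1] of the length seen from outside. *)
Definition nfc (X : {set V}) (j : nat) := #|[set t in F | #|t :&: X| == j]|.
Definition nei (X : {set V}) := #|[set e in tri_edges F | e \subset X]|.

Lemma card_face t : t \in F -> #|t| = 3.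
Proof. by case: PT => H _ _ _ _; apply: H. Qed.

Lemma card_faceI t X : t \in F -> #|t :&: X| < 4.
Proof. by move=> tF; rewrite ltnS -(card_face tF) subset_leq_card // subsetIl. Qed.

Lemma sum_faces (X : {set V}) (g : nat -> nat) :
  \sum_(t in F) g #|t :&: X| = nfc X 0 * g 0 + nfc X 1 * g 1 + nfc X 2 * g 2 + nfc X 3 * g 3.
Proof.
have -> : \sum_(t in F) g #|t :&: X| = \sum_(j < 4) nfc X j * g j.
  have E (j : 'I_4) : nfc X j * g j = \sum_(t in F) (#|t :&: X| == j) * g j.
    rewrite -big_distrl /= /nfc -sum1_card; congr (_ * _).
    rewrite (eq_bigl (fun t => (t \in F) && (#|t :&: X| == j))) => [|t]; last by rewrite !inE.
    by rewrite big_mkcondr; apply: eq_bigr => t _; case: (_ == _).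
  rewrite (eq_bigr _ (fun j _ => E j)) exchange_big /=.
  apply: eq_bigr => t tF; rewrite (bigD1 (Ordinal (card_faceI X tF))) //= eqxx mul1n big1 ?addn0 //.
  by move=> j nj; rewrite eq_sym; case: eqP => [E'|]; rewrite ?mul0n //; case/eqP: nj; apply: val_inj.
by rewrite !big_ord_recr big_ord0 /= add0n.
Qed.

Lemma card_faces (X : {set V}) : #|F| = nfc X 0 + nfc X 1 + nfc X 2 + nfc X 3.
Proof. by rewrite -sum1_card (sum_faces X (fun=> 1)) !muln1. Qed.

(** Pairs of an edge inside [X] and a face containing it: a face with [j] vertices in [X]
    contributes ['C(j, 2)]. *)
Lemma nei_double (X : {set V}) : 2 * nei X = nfc X 2 + 3 * nfc X 3.
Proof.
have -> : nfc X 2 + 3 * nfc X 3 = \sum_(t in F) 'C(#|t :&: X|, 2).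
  by rewrite (sum_faces X (fun m => 'C(m, 2))) 
    (_ : 'C(0, 2) = 0) // (_ : 'C(1, 2) = 0) // (_ : 'C(2, 2) = 1) // (_ : 'C(3, 2) = 3) //; lia.
have -> : 2 * nei X = \sum_(e in tri_edges F | e \subset X) \sum_(t in F | e \subset t) 1.
  rewrite /nei -sum1_card big_distrr /=.
  rewrite (eq_bigl (fun e => (e \in tri_edges F) && (e \subset X))) => [|e]; last by rewrite !inE.
  apply: eq_bigr => e /andP[eE _]; rewrite muln1.
  case: PT => _ /(_ e eE) E _ _ _; rewrite -{1}E -sum1_card.
  by apply: eq_bigl => t; rewrite !inE.
rewrite (exchange_big_dep (mem F)) /=; last by move=> ? ? _ /andP[].
apply: eq_bigr => t tF; rewrite -cards_draws -sum1_card; apply: eq_bigl => e; rewrite !inE tF /= subsetI.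
case: (e \subset X); rewrite ?andbF //= !andbT.
case: (boolP (e \subset t)) => et; rewrite ?andbF //= andbT; case: (_ == 2) => //=.
by apply/existsP; exists t; rewrite tF.
Qed.

(** In the incidences between neighbours of [v] and faces at [v], every neighbour and every face
    occurs twice. *)
Lemma card_faces_at v : #|[set t in F | v \in t]| = tri_deg F v.
Proof.
have : \sum_(a in [set w | tri_adj F v w]) \sum_(t in F | (v \in t) && (a \in t)) 1 = 2 * tri_deg F v.
  rewrite (eq_bigr (fun=> 2)) => [|a]; first by rewrite sum_nat_const mulnC.
  rewrite inE => va; case: PT => _ /(_ _ va) E _ _ _.
  rewrite -[RHS]E sum1_card; apply: eq_card => t.
  by rewrite !inE subUset !sub1set.
rewrite (exchange_big_dep (fun t => (t \in F) && (v \in t))) /=; last by move=> a t _ /and3P[-> ->].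
rewrite (eq_bigr (fun=> 2)) => [|t /andP[tF vt]].
  rewrite sum_nat_const mulnC => E; apply/eqP; rewrite -(eqn_pmul2l (isT : 0 < 2)) -E.
  by apply/eqP; congr (2 * _); apply: eq_card => t; rewrite !inE.
rewrite sum1_card; have := card_face tF; rewrite (cardsD1 v t) vt add1n => -[<-].
apply: eq_card => a; rewrite !inE unfold_in tF /= inE andbC.
case: (boolP (a \in t)) => at_ /=; rewrite ?andbF ?andbT //.
apply/idP/idP => [/(adj_neq PT)|n]; first by rewrite eq_sym.
by apply: (face_in_adj PT tF); rewrite // eq_sym.
Qed.

Lemma sum_deg (X : {set V}) :
  \sum_(v in X) tri_deg F v = nfc X 1 + 2 * nfc X 2 + 3 * nfc X 3.
Proof.
have -> : nfc X 1 + 2 * nfc X 2 + 3 * nfc X 3 = \sum_(t in F) #|t :&: X|.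
  by rewrite (sum_faces X id); lia.
rewrite (eq_bigr (fun v => \sum_(t in F | v \in t) 1)) => [|v _].
  rewrite (exchange_big_dep (mem F)) /=; last by move=> ? ? _ /andP[].
  apply: eq_bigr => t tF; rewrite -sum1_card; apply: eq_bigl => v.
  by rewrite !inE tF andbC.
by rewrite -card_faces_at -sum1_card; apply: eq_bigl => t; rewrite !inE.
Qed.

Lemma six_card (X : {set V}) :
  6 * #|X| = pcnt X + nfc X 1 + 2 * nfc X 2 + 3 * nfc X 3.
Proof.
have -> : pcnt X + nfc X 1 + 2 * nfc X 2 + 3 * nfc X 3
    = pcnt X + (nfc X 1 + 2 * nfc X 2 + 3 * nfc X 3) by lia.
rewrite -sum_deg -sum1_card big_distrr /=.
have -> : pcnt X = \sum_(v in X) (v \in pent).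
  by rewrite /pcnt -sum1_card big_mkcond [RHS]big_mkcond; apply: eq_bigr => v _;
     rewrite inE; case: (v \in X); case: (v \in pent).
by rewrite -big_split; apply: eq_bigr => v _; rewrite inE /=; case: (D56 v) => ->.
Qed.

Lemma nfcC (X : {set V}) j : j < 4 -> nfc (~: X) j = nfc X (3 - j).
Proof.
move=> j4; apply: eq_card => t; rewrite !inE; case: (boolP (t \in F)) => //= tF.
have := cardsID X t; rewrite (card_face tF) setDE => E.
by apply/eqP/eqP; lia.
Qed.

(** A cut face has two cut edges and a cut edge lies in two cut faces, so these cancel in Euler's
    formula: the characteristics of [X] and of its complement add up to 2. *)
Lemma euler_split (X : {set V}) :
  #|X| + nfc X 3 + (#|~: X| + nfc X 0) = nei X + nei (~: X) + 2.
Proof.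
have := nei_double X; have := nei_double (~: X); rewrite !nfcC // -[3 - 2]/1 -[3 - 3]/0 => E1 E2.
have E3 := card_faces X; have E4 := cardsC X.
have : #|V| + #|F| = #|tri_edges F| + 2 by case: PT.
have : 2 * #|tri_edges F| = 3 * #|F|.
  have := nei_double setT; rewrite (card_faces setT).
  have -> : nei setT = #|tri_edges F| by apply: eq_card => e; rewrite !inE subsetT andbT.
  have Z j : j != 3 -> nfc setT j = 0.
    move=> nj; apply: eq_card0 => t; rewrite !inE setIT.
    by apply/negP=> /andP[/card_face -> /eqP E]; move: nj; rewrite -E.
  by rewrite (Z 0) // (Z 1) // (Z 2) //; lia.
lia.
Qed.

Lemma pcnt_total : pcnt setT = 12.
Proof.
have := six_card setT; have := euler_split setT; have := nei_double setT.
have Z j : j != 3 -> nfc setT j = 0.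
  move=> nj; apply: eq_card0 => t; rewrite !inE setIT.
  by apply/negP=> /andP[/card_face -> /eqP E]; move: nj; rewrite -E.
have -> : nei (~: setT) = 0.
  apply: eq_card0 => e; rewrite !inE setCT subset0.
  by apply/negP=> /andP[/andP[/eqP c _] /eqP E]; rewrite E cards0 in c.
rewrite setCT cards0 (Z 0) // (Z 1) // (Z 2) //; lia.
Qed.

Lemma card_pent : #|pent| = 12.
Proof. by rewrite -pcnt_total /pcnt setTI. Qed.

Lemma pcntC X : pcnt X + pcnt (~: X) = 12.
Proof.
rewrite -card_pent -(cardsID X pent) /pcnt ![_ :&: pent]setIC.
by rewrite setDE.
Qed.

Lemma pcntS (X Y : {set V}) : X \subset Y -> pcnt X <= pcnt Y.
Proof. by move=> s; apply: subset_leq_card; apply: setSI. Qed.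

Lemma pcntU (X Y : {set V}) : [disjoint X & Y] -> pcnt (X :|: Y) = pcnt X + pcnt Y.
Proof.
move=> d; rewrite /pcnt setIUl cardsU.
suff -> : X :&: pent :&: (Y :&: pent) = set0 by rewrite cards0 subn0.
by rewrite setIACA (disjoint_setI0 d) set0I.
Qed.

(** Six times the Euler characteristic of the full subcomplex on [X] is the curvature [pcnt X] plus
    the turning [nfc X 1 - nfc X 2] of the boundary. *)
Lemma gauss_bonnet (X : {set V}) :
  6 * #|X| + 6 * nfc X 3 + nfc X 2 = 6 * nei X + pcnt X + nfc X 1.
Proof. have := six_card X; have := nei_double X; lia. Qed.

(** Connectedness as an induction principle rather than by paths. The empty set qualifies. *)
Definition conn (X : {set V}) := forall (Y : {set V}) y, y \in X -> y \in Y ->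
  (forall u v, u \in X -> u \in Y -> v \in X -> tri_adj F u v -> v \in Y) -> X \subset Y.

Lemma conn_setT : conn setT.
Proof.
move=> Y y _ yY cl; apply/subsetP=> z _; apply: (closed_graph PT yY) => b c bY bc.
by apply: (cl b); rewrite ?inE.
Qed.

(** The dual graph is connected: a set of faces closed under crossing edges contains all faces at
    each of its vertices, since links are connected, and then reaches every vertex, since the graph
    is connected. *)
Lemma faces_proper (G : {set {set V}}) : G \subset F -> G != set0 -> G != F ->
  exists x y z, [/\ [set x; y; z] \in G & [set x; y; opp F x y z] \notin G].
Proof.
move=> sGF nG0 nGF.
have [/existsP[x /existsP[y /existsP[z /andP[g ng]]]]|] := boolP [exists x, exists y, exists z,
  ([set x; y; z] \in G) && ([set x; y; opp F x y z] \notin G)]; first by exists x, y, z.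
rewrite negb_exists => /forallP H; case/negP: nGF.
have H2 x y z : [set x; y; z] \in G -> [set x; y; opp F x y z] \in G.
  move=> g; apply/negPn/negP=> ng; have /existsP[] := H x.
  by exists y; apply/existsP; exists z; rewrite g ng.
have cl v a b : [set v; a; b] \in G -> forall c d, face F v c d -> [set v; c; d] \in G.
  move=> g; have f : face F v a b by apply: (subsetP sGF).
  pose A := [set c | [exists d, [set v; c; d] \in G]].
  have key c d d' : [set v; c; d] \in G -> face F v c d' -> [set v; c; d'] \in G.
    move=> gc fd; have fc : face F v c d by apply: (subsetP sGF).
    have [_ _ /(_ _ fd)[->|->]//] := opp_spec PT fc; exact: H2.
  have AA : forall c, tri_adj F v c -> c \in A.
    apply: (closed_link PT (face_adj12 PT f)); first by rewrite inE; apply/existsP; exists b.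
    move=> c d; rewrite inE => /existsP[e ge] fcd; rewrite inE; apply/existsP; exists c.
    by rewrite set3_swap23; apply: key ge fcd.
  move=> c d fcd; have := AA c (face_adj12 PT fcd); rewrite inE => /existsP[e ge].
  exact: key ge fcd.
have [t tG] := set0Pn _ nG0; have [x [y [z E]]] := faceP PT (subsetP sGF _ tG).
pose A := [set v | [exists a, exists b, [set v; a; b] \in G]].
have AA : forall v, v \in A.
  apply: (@closed_graph _ _ PT A x) => [|b c].
    by rewrite inE; apply/existsP; exists y; apply/existsP; exists z; rewrite -E.
  rewrite inE => /existsP[a /existsP[a' g]] /(adjP PT)[d f].
  rewrite inE; apply/existsP; exists d; apply/existsP; exists b.
  by rewrite -set3_rot; apply: cl g _ _ f.
rewrite eqEsubset sGF; apply/subsetP=> s sF; have [u [v [w Es]]] := faceP PT sF.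
have := AA u; rewrite inE => /existsP[a /existsP[b g]]; rewrite Es.
by apply: cl g _ _ _; rewrite /face -Es.
Qed.

(* A graph on [X] with edge set [E], phrased by cuts. *)
Definition cutconn (X : {set V}) (E : {set {set V}}) := forall Y : {set V},
  Y \subset X -> Y != set0 -> Y != X -> exists y z, [/\ y \in Y, z \in X :\: Y & [set y; z] \in E].

(** Grow [Y] from [[set x]] one vertex at a time; every step moves at least one more edge into
    [Y]. *)
Lemma cutconn_edges (X : {set V}) E x : x \in X -> cutconn X E -> #|X| <= #|E|.+1.
Proof.
move=> xX cc; suff key n : forall Y : {set V}, Y \subset X -> Y != set0 -> #|X :\: Y| = n ->
    n <= #|[set e in E | ~~ (e \subset Y)]|.
  have := key _ [set x]; rewrite sub1set xX => /(_ _ isT _ erefl).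
  have -> : [set x] != set0 by apply/set0Pn; exists x; rewrite set11.
  move=> /(_ isT) H; rewrite (cardsD1 x) xX add1n ltnS (leq_trans H) //.
  by apply: subset_leq_card; apply/subsetP=> e; rewrite !inE => /andP[].
elim: n => // n IH Y sYX nY cn.
have [|y [z [yY zX yz]]] := cc Y sYX nY.
  by apply: contra_eqN cn => /eqP->; rewrite setDv cards0.
have zD := zX; move: zX; rewrite inE => /andP[zY zX].
have := IH (z |: Y); rewrite subUset sub1set zX sYX => /(_ isT).
have -> : z |: Y != set0 by apply/set0Pn; exists z; rewrite setU11.
have -> : #|X :\: (z |: Y)| = n.
  move: cn; rewrite (cardsD1 z) zD add1n => -[<-]; apply: eq_card => u.
  by rewrite !inE negb_or andbA.
move=> /(_ isT erefl) H; apply: (leq_ltn_trans H).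
apply: proper_card; apply/properP; split.
  apply/subsetP=> e; rewrite !inE => /andP[-> ns]; apply: contraNN ns => /subset_trans.
  by apply; apply: subsetUr.
exists [set y; z]; rewrite inE yz subUset !sub1set ?yY ?zY //.
by rewrite !inE yY eqxx orbT.
Qed.

(** A collapse. A face of [G] whose neighbour across [u v] is not in [G] has the free edge [u v];
    removing the face with this edge costs one of each. Connectivity survives because the other two
    sides of the face remain as a detour. *)
Lemma collapse_count n (X : {set V}) E (G : {set {set V}}) x : x \in X -> #|G| = n ->
  G \subset F -> G != F -> cutconn X E ->
  (forall u v w, [set u; v; w] \in G -> [set u; v] \in E /\ u \in X) ->
  #|X| + n <= #|E|.+1.
Proof.
move=> xX; elim: n E G => [|n IH] E G cG sG nG cc HG.
  by rewrite addn0; apply: cutconn_edges xX cc.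
have G0 : G != set0 by rewrite -cards_eq0 cG.
have [u [v [w [g ng]]]] := faces_proper sG G0 nG.
have f : face F u v w by apply: (subsetP sG).
have /and3P[nuv nuw nvw] := face_neq PT f.
have eE : [set u; v] \in E by have [] := HG _ _ _ g.
have := IH (E :\ [set u; v]) (G :\ [set u; v; w]).
rewrite (cardsD1 [set u; v] E) eE add1n addnS ltnS; apply.
- by move: cG; rewrite (cardsD1 [set u; v; w]) g add1n => -[].
- by apply: subset_trans sG; apply: subsetDl.
- apply: contraNneq nG => E'; rewrite eqEsubset sG -{1}E'; exact: subsetDl.
- have w_edges : [set u; w] \in E :\ [set u; v] /\ [set v; w] \in E :\ [set u; v].
    rewrite !inE; split.
      have [-> _] := HG u w v (ssrfun.etrans (congr1 (fun s => s \in G) (set3_swap23 u w v)) g).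
      rewrite andbT; apply/negP=> /eqP/setP/(_ w); rewrite !inE eqxx orbT.
      by rewrite eq_sym (negPf nuw) eq_sym (negPf nvw).
    have [-> _] := HG v w u (ssrfun.etrans (congr1 (fun s => s \in G) (esym (set3_rot u v w))) g).
    rewrite andbT; apply/negP=> /eqP/setP/(_ w); rewrite !inE eqxx orbT.
    by rewrite eq_sym (negPf nuw) eq_sym (negPf nvw).
  have wX : w \in X.
    have [] := HG w v u; last by [].
    by rewrite set3_rot set3_swap12 in g *.
  move=> Y sY Y0 YX; have [y [z [yY zD yz]]] := cc Y sY Y0 YX.
  case: (eqVneq [set y; z] [set u; v]) => [Eyz|nyz]; last by exists y, z; rewrite !inE nyz yz -in_setD zD.
  have [wu wv] := w_edges.
  have yw : [set y; w] \in E :\ [set u; v] /\ [set z; w] \in E :\ [set u; v].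
    have : y \in [set u; v] by rewrite -Eyz set21.
    have : z \in [set u; v] by rewrite -Eyz set22.
    by case/set2P=> -> /set2P[] ->.
  have [wY|wY] := boolP (w \in Y).
    by exists w, z; rewrite setUC; case: yw.
  by exists y, w; rewrite in_setD wY wX; case: yw.
- move=> a b c; rewrite !inE => /andP[na ga]; have [-> ->] := HG _ _ _ ga; rewrite andbT; split=> //.
  apply/negP=> /eqP Eab; have fa : face F a b c by apply: (subsetP sG).
  have Eabc : [set u; v; c] = [set a; b; c] by rewrite -Eab.
  have fc : face F u v c by rewrite /face Eabc.
  have [_ _ /(_ _ fc)[Ec|Ec]] := opp_spec PT f; first by rewrite -Eabc Ec eqxx in na.
  by rewrite -Ec Eabc ga in ng.
Qed.

Lemma conn_cut (X : {set V}) : conn X -> cutconn X [set e in tri_edges F | e \subset X].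
Proof.
move=> cX Y sY Y0 YX.
suff [y [z [yY zX zY a]]] : exists y z, [/\ y \in Y, z \in X, z \notin Y & tri_adj F y z].
  exists y, z; rewrite !inE zY zX yY; split=> //; move: a; rewrite /tri_adj inE => ->.
  by rewrite subUset !sub1set zX (subsetP sY).
have [y yY] := set0Pn _ Y0.
have [H|] := boolP [exists y, exists z, [&& y \in Y, z \in X, z \notin Y & tri_adj F y z]].
  by have /existsP[u /existsP[z /and4P[]]] := H; exists u, z.
rewrite negb_exists => /forallP H; case/negP: YX; rewrite eqEsubset sY.
apply: cX (subsetP sY _ yY) yY _ => u v uX uY vX uv; apply/negPn/negP=> vY.
by have /existsP[] := H u; exists v; rewrite uY vX vY.
Qed.

Lemma card3_sub t (X : {set V}) : t \in F -> (#|t :&: X| == 3) = (t \subset X).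
Proof.
move=> tF; rewrite -(card_face tF); apply/eqP/idP => [E|/setIidPl-> //].
by apply/setIidPl/eqP; rewrite eqEcard subsetIl E leqnn.
Qed.

Lemma nfc3E (X : {set V}) : nfc X 3 = #|[set t in F | t \subset X]|.
Proof.
apply: eq_card => t; rewrite !inE; case: (boolP (t \in F)) => //= tF.
exact: card3_sub.
Qed.

(** All inner faces can be collapsed, as the faces at [v] are not inner, and a connected graph
    remains. *)
Lemma conn_chi_le1 (X : {set V}) x v : x \in X -> v \notin X -> conn X -> #|X| + nfc X 3 <= (nei X).+1.
Proof.
move=> xX vX cX.
rewrite nfc3E; apply: (@collapse_count _ X _ [set t in F | t \subset X] x) => //.
- by apply/subsetP=> t; rewrite inE => /andP[].
- have [a [b f]] := vertex_face PT v.
  apply: contraNneq vX => E'; have : [set v; a; b] \in F by [].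
  by rewrite -E' inE => /andP[_ /subsetP]; apply; rewrite !inE eqxx.
- exact: conn_cut.
- move=> a b c; rewrite !inE !subUset !sub1set => /andP[f /andP[/andP[-> ->] _]]; split=> //.
  by have := face_adj12 PT (f : face F a b c); rewrite /tri_adj inE => ->.
Qed.

(** Both characteristics are at most 1 and their sum is 2. This takes the place of the Jordan curve
    theorem. *)
Lemma conn_chi1 (X : {set V}) x v : x \in X -> v \notin X -> conn X -> conn (~: X) ->
  #|X| + nfc X 3 = (nei X).+1.
Proof.
move=> xX vX cX cCX; have := conn_chi_le1 xX vX cX; have := euler_split X.
have xC : x \notin ~: X by rewrite inE xX.
have vC : v \in ~: X by rewrite inE.
have := conn_chi_le1 vC xC cCX; rewrite nfcC // subnn; lia.
Qed.

Lemma conn_gb (X : {set V}) x v : x \in X -> v \notin X -> conn X -> conn (~: X) ->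
  nfc X 1 + pcnt X = nfc X 2 + 6.
Proof.
move=> xX vX cX cCX; have := conn_chi1 xX vX cX cCX; have := gauss_bonnet X; lia.
Qed.

End Counting.

(** * Components, interior and boundary of a vertex set *)

Section Components.
Variables (V : finType) (F : {set {set V}}).
Hypothesis PT : plane_triangulation F.

Definition adjin (Z : {set V}) : rel V := [rel x y | [&& x \in Z, y \in Z & tri_adj F x y]].
Definition comp (Z : {set V}) x := [set y in Z | connect (adjin Z) x y].
Definition comps (Z : {set V}) := [set comp Z x | x in Z].

Lemma adjin_sym Z : connect_sym (adjin Z).
Proof.
by apply: sym_connect_sym => x y; rewrite /adjin /= [tri_adj F y x]adj_sym; case: (x \in Z); case: (y \in Z).
Qed.

Lemma comp_self (Z : {set V}) x : x \in Z -> x \in comp Z x.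
Proof. by move=> xZ; rewrite inE xZ connect0. Qed.

Lemma comp_sub (Z : {set V}) x : comp Z x \subset Z.
Proof. by apply/subsetP=> y; rewrite inE => /andP[]. Qed.

Lemma comp_closed (Z : {set V}) x y z :
  y \in comp Z x -> z \in Z -> tri_adj F y z -> z \in comp Z x.
Proof.
rewrite !inE => /andP[yZ xy] zZ yz; rewrite zZ; apply: connect_trans xy _.
by apply: connect1; rewrite /adjin /= yZ zZ.
Qed.

Lemma comp_eq (Z : {set V}) x y : y \in comp Z x -> comp Z y = comp Z x.
Proof.
rewrite inE => /andP[yZ xy]; apply/setP=> z; rewrite !inE.
by rewrite (same_connect (@adjin_sym Z) xy).
Qed.

Lemma comp_least (Z Y : {set V}) x : x \in Y ->
  (forall u v, u \in Y -> u \in Z -> v \in Z -> tri_adj F u v -> v \in Y) -> comp Z x \subset Y.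
Proof.
move=> xY cl; apply/subsetP=> y; rewrite inE => /andP[_ /connectP[p]].
elim: p x xY => [|c p IH] x xY /=; first by move=> _ ->.
by case/andP=> /and3P[xZ cZ xc] pp E; apply: IH pp E; apply: cl xc.
Qed.

Lemma comp_conn (Z : {set V}) x : x \in Z -> conn F (comp Z x).
Proof.
move=> xZ Y y yK yY cl; rewrite -(comp_eq yK).
suff : comp Z y \subset Y :&: comp Z x by rewrite subsetI => /andP[].
apply: comp_least; first by rewrite inE yY.
move=> u v; rewrite in_setI => /andP[uY uK] uZ vZ uv.
have vK := comp_closed uK vZ uv.
by rewrite inE vK andbT; apply: cl uv.
Qed.

Lemma conn_comp (X Z : {set V}) x : conn F X -> X \subset Z -> x \in X -> X \subset comp Z x.
Proof.
move=> cX sXZ xX; apply: (cX _ x) => //; first by rewrite comp_self // (subsetP sXZ).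
by move=> u v uX uK vX; apply: comp_closed uK (subsetP sXZ _ vX).
Qed.

Lemma compsP (Z K : {set V}) : reflect (exists2 x, x \in Z & K = comp Z x) (K \in comps Z).
Proof. exact: imsetP. Qed.

Lemma comps_conn (Z K : {set V}) : K \in comps Z -> conn F K.
Proof. by case/compsP=> x xZ ->; apply: comp_conn. Qed.

Lemma comps_sub (Z K : {set V}) : K \in comps Z -> K \subset Z.
Proof. by case/compsP=> x xZ ->; apply: comp_sub. Qed.

Lemma comps_ex (Z K : {set V}) : K \in comps Z -> exists x, x \in K.
Proof. by case/compsP=> x xZ ->; exists x; apply: comp_self. Qed.

Lemma comp_in (Z : {set V}) x : x \in Z -> comp Z x \in comps Z.
Proof. by move=> xZ; apply/compsP; exists x. Qed.

Lemma comps_uniq (Z K : {set V}) x : K \in comps Z -> x \in K -> K = comp Z x.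
Proof. by case/compsP=> y yZ -> /comp_eq. Qed.

Lemma comps_closed (Z K : {set V}) y z :
  K \in comps Z -> y \in K -> z \in Z -> tri_adj F y z -> z \in K.
Proof. by case/compsP=> x _ ->; apply: comp_closed. Qed.

Lemma conn_comps (X Z K : {set V}) x :
  conn F X -> X \subset Z -> K \in comps Z -> x \in X -> x \in K -> X \subset K.
Proof. by move=> cX s KZ xX xK; rewrite (comps_uniq KZ xK); apply: conn_comp. Qed.

Lemma conn_setU (X Y : {set V}) x y : conn F X -> conn F Y -> x \in X -> y \in Y ->
  tri_adj F x y -> conn F (X :|: Y).
Proof.
move=> cX cY xX yY xy W w wXY wW cl.
have clX : forall u v, u \in X -> u \in W -> v \in X -> tri_adj F u v -> v \in W.
  by move=> u v uX uW vX; apply: (cl u); rewrite ?in_setU ?uX ?vX.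
have clY : forall u v, u \in Y -> u \in W -> v \in Y -> tri_adj F u v -> v \in W.
  by move=> u v uX uW vX; apply: (cl u); rewrite ?in_setU ?uX ?vX ?orbT.
rewrite subUset; move: wXY; rewrite in_setU => /orP[wX|wY].
  have sX := cX W w wX wW clX; rewrite sX; apply: (cY W y) => //.
  by apply: (cl x); rewrite ?in_setU ?xX ?yY ?orbT // (subsetP sX).
have sY := cY W w wY wW clY; rewrite sY andbT; apply: (cX W x) => //.
by apply: (cl y); rewrite ?in_setU ?xX ?yY ?orbT // ?(subsetP sY) // adj_sym.
Qed.

Lemma conn_exit (X Y : {set V}) x y : conn F X -> x \in X -> x \in Y -> y \in X -> y \notin Y ->
  exists u v, [/\ u \in X, u \in Y, v \in X, v \notin Y & tri_adj F u v].
Proof.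
move=> cX xX xY yX yY.
have [/existsP[u /existsP[v /and5P[]]]|] := boolP [exists u, exists v,
  [&& u \in X, u \in Y, v \in X, v \notin Y & tri_adj F u v]]; first by exists u, v.
rewrite negb_exists => /forallP H; case/negP: yY; apply: (subsetP (cX Y x xX xY _)) => // u v uX uY vX uv.
by apply/negPn/negP=> vY; have /existsP[] := H u; exists v; rewrite uX uY vX vY.
Qed.

Lemma sum_comps (Z : {set V}) (g : V -> nat) :
  \sum_(v in Z) g v = \sum_(K in comps Z) \sum_(v in K) g v.
Proof.
rewrite (partition_big (comp Z) (mem (comps Z))) /=; last by move=> x; apply: comp_in.
apply: eq_bigr => K KZ; apply: eq_bigl => v; apply/andP/idP => [[vZ /eqP<-]|vK].
  exact: comp_self.
by rewrite (subsetP (comps_sub KZ)) // -(comps_uniq KZ vK).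
Qed.

Lemma pcnt_sum (X : {set V}) : pcnt F X = \sum_(v in X) (v \in pent F).
Proof.
rewrite /pcnt -sum1_card big_mkcond [RHS]big_mkcond; apply: eq_bigr => v _.
by rewrite inE; case: (v \in X); case: (v \in pent F).
Qed.

Lemma pcnt_comps (Z : {set V}) : pcnt F Z = \sum_(K in comps Z) pcnt F K.
Proof. by rewrite pcnt_sum sum_comps; apply: eq_bigr => K _; rewrite pcnt_sum. Qed.

Lemma card_comps (Z : {set V}) : #|Z| = \sum_(K in comps Z) #|K|.
Proof. by rewrite -sum1_card sum_comps; apply: eq_bigr => K _; rewrite sum1_card. Qed.

Lemma nfcE (X : {set V}) j : nfc F X j = \sum_(t in F) (#|t :&: X| == j).
Proof.
rewrite /nfc -sum1_card big_mkcond [RHS]big_mkcond; apply: eq_bigr => t _.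
by rewrite inE; case: (t \in F); case: (_ == _).
Qed.

(** The vertices of a face that lie in [Z] are pairwise adjacent, hence in one component. Faces that
    miss [Z] are not additive, whence [0 < j]. *)
Lemma nfc_comps (Z : {set V}) j : 0 < j -> nfc F Z j = \sum_(K in comps Z) nfc F K j.
Proof.
move=> j0; rewrite nfcE (eq_bigr _ (fun K _ => nfcE K j)) exchange_big /=.
apply: eq_bigr => t tF.
have [E|/set0Pn[v]] := eqVneq (t :&: Z) set0.
  rewrite E cards0 big1 => [|K KZ]; first by case: j j0.
  have -> : t :&: K = set0.
    by apply/eqP; rewrite -subset0 -E setIS // (comps_sub KZ).
  by rewrite cards0; case: j j0.
rewrite inE => /andP[vt vZ]; rewrite (bigD1 (comp Z v)) ?comp_in //= big1 => [|K /andP[KZ nK]].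
  rewrite addn0; congr (nat_of_bool (#|pred_of_set _| == j)); apply/setP=> u; rewrite !in_setI.
  case: (boolP (u \in t)) => //= ut; apply/idP/idP => [uZ|/(subsetP (comp_sub _ _))//].
  have [<-|n] := eqVneq v u; first exact: comp_self.
  by apply: (@comp_closed Z v v u) => //; [apply: comp_self|apply: (face_in_adj PT tF)].
have -> : t :&: K = set0.
  apply/eqP; rewrite -subset0; apply/subsetP=> u; rewrite inE => /andP[ut uK].
  case/eqP: nK; rewrite (comps_uniq KZ uK); apply/comp_eq.
  have uZ := subsetP (comps_sub KZ) _ uK.
  have [<-|n] := eqVneq v u; first exact: comp_self.
  by apply: (@comp_closed Z v v u) => //; [apply: comp_self|apply: (face_in_adj PT tF)].
by rewrite cards0; case: j j0.
Qed.

Lemma nei_comps (Z : {set V}) : nei F Z = \sum_(K in comps Z) nei F K.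
Proof.
have := nei_double PT Z; rewrite !nfc_comps // big_distrr -big_split /=.
rewrite (eq_bigr (fun K => 2 * nei F K)); last by move=> K _; rewrite nei_double.
by rewrite -big_distrr /=; lia.
Qed.

Definition interior (X : {set V}) := [set x in X | [forall y, tri_adj F x y ==> (y \in X)]].
Definition bdry (X : {set V}) := X :\: interior X.

Lemma interior_sub (X : {set V}) : interior X \subset X.
Proof. by apply/subsetP=> x; rewrite inE => /andP[]. Qed.

Lemma interior_adj (X : {set V}) x y : x \in interior X -> tri_adj F x y -> y \in X.
Proof. by rewrite inE => /andP[_ /forallP/(_ y)/implyP]. Qed.

Lemma bdryP (X : {set V}) x : reflect (x \in X /\ exists2 y, y \notin X & tri_adj F x y) (x \in bdry X).
Proof.
rewrite !inE; apply: (iffP andP) => [[n xX]|[xX [y yX xy]]].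
  split=> //; move: n; rewrite xX negb_forall => /existsP[y]; rewrite negb_imply => /andP[].
  by exists y.
by split=> //; rewrite xX negb_forall; apply/existsP; exists y; rewrite negb_imply xy.
Qed.

Lemma face_interior (X : {set V}) t : t \in F ->
  #|t :&: interior X| + #|t :&: bdry X| = #|t :&: X| /\
  (0 < #|t :&: interior X| -> #|t :&: X| = 3).
Proof.
move=> tF; split.
  rewrite -(cardsID (interior X) (t :&: X)); congr (_ + _); apply: eq_card => x; rewrite !in_setI.
    case: (boolP (x \in interior X)) => xi; rewrite ?andbF ?andbT //.
    by rewrite (subsetP (interior_sub X)) ?andbT.
  by rewrite !in_setD in_setI; case: (x \in t); rewrite ?andbF.
case/card_gt0P=> x; rewrite inE => /andP[xt xi].
apply/eqP; rewrite (card3_sub PT) //; apply/subsetP=> y yt.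
have [<-|n] := eqVneq x y; first exact: (subsetP (interior_sub X)).
by apply: (interior_adj xi); apply: (face_in_adj PT tF).
Qed.

(** A face with a vertex in the interior lies in [X], so the inner faces are sorted by their number
    of interior vertices. *)
Lemma nfc_interior (X : {set V}) : nfc F X 3 = nfc F (interior X) 3 + nfc F (interior X) 2
  + nfc F (interior X) 1 + nfc F (bdry X) 3.
Proof.
rewrite !nfcE -!big_split; apply: eq_bigr => t tF /=.
by have [] := face_interior X tF; have := card_faceI PT X tF; lia.
Qed.

Lemma nfc_bdry (X : {set V}) : nfc F (bdry X) 2 = nfc F (interior X) 1 + nfc F X 2.
Proof.
rewrite !nfcE -!big_split; apply: eq_bigr => t tF /=.
by have [] := face_interior X tF; have := card_faceI PT X tF; lia.
Qed.

Lemma card_bdry (X : {set V}) : #|X| = #|interior X| + #|bdry X|.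
Proof. by rewrite -(cardsID (interior X) X) (setIidPr (interior_sub X)). Qed.

(** The link of [v] meets both [X] and its complement, so it switches sides at least once. The
    number of switches is even, by counting the pairs of a neighbour in [X] and a face at [v]
    containing it. *)
Lemma link_crossing (X : {set V}) v : v \in bdry X -> (exists2 a, a \in X & tri_adj F v a) ->
  2 <= #|[set t in F | (v \in t) && (#|t :&: X| == 2)]|.
Proof.
move=> vb [a aX va]; have [vX [b bX vb']] := bdryP _ _ vb.
set B := [set t in F | _].
have B1 : 0 < #|B|.
  have [/existsP[c /existsP[d /and3P[cX dX f]]]|H] := boolP [exists c, exists d,
      [&& c \in X, d \notin X & face F v c d]].
    apply/card_gt0P; exists [set v; c; d]; rewrite inE [_ \in F]f !inE eqxx /=.
    have -> : [set v; c; d] :&: X = [set v; c].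
      apply/setP=> u; rewrite !inE; case: (u =P v) => [->|_]; first by rewrite vX.
      case: (u =P c) => [->|_]; first by rewrite cX.
      by case: (u =P d) => [->|_]; rewrite ?(negPf dX).
    by have /and3P[n _ _] := face_neq PT f; rewrite cards2 n.
  case/negP: bX; apply: (closed_link PT va aX _ vb') => c d cX f.
  apply/negPn/negP=> dX; case/existsP: H; exists c; apply/existsP; exists d; exact/and3P.
suff : ~~ odd #|B| by case: #|B| B1 => [|[]].
pose A := [set a in X | tri_adj F v a].
have E1 : \sum_(a in A) \sum_(t in F | (v \in t) && (a \in t)) 1 = 2 * #|A|.
  rewrite (eq_bigr (fun=> 2)) => [|c]; first by rewrite sum_nat_const mulnC.
  rewrite inE => /andP[_ vc]; case: PT => _ /(_ _ vc) E _ _ _.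
  rewrite -[RHS]E sum1_card; apply: eq_card => t.
  by rewrite !inE subUset !sub1set.
have E2 : \sum_(a in A) \sum_(t in F | (v \in t) && (a \in t)) 1
    = \sum_(t in F | v \in t) ((#|t :&: X| == 2) + 2 * (#|t :&: X| == 3)).
  rewrite (exchange_big_dep (fun t => (t \in F) && (v \in t))) /=; last by move=> c t _ /and3P[-> ->].
  apply: eq_bigr => t /andP[tF vt].
  have vtX : v \in t :&: X by rewrite inE vt vX.
  have -> : \sum_(c in A | [&& t \in F, v \in t & c \in t]) 1 = #|t :&: X|.-1.
    rewrite (cardsD1 v (t :&: X)) vtX add1n /= -sum1_card; apply: eq_bigl => c.
    rewrite !inE tF vt /=; case: (boolP (c \in t)) => ct; rewrite ?andbF ?andbT //=.
    rewrite andbC; case: (c \in X); rewrite ?andbF ?andbT //.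
    apply/idP/idP => [/(adj_neq PT)|n]; first by rewrite eq_sym.
    by apply: (face_in_adj PT tF); rewrite // eq_sym.
  have : 0 < #|t :&: X| by apply/card_gt0P; exists v.
  by have := card_faceI PT X tF; lia.
have E3 : #|B| = \sum_(t in F | v \in t) (#|t :&: X| == 2).
  rewrite -sum1_card (eq_bigl (fun t => ((t \in F) && (v \in t)) && (#|t :&: X| == 2))) => [|t].
    by rewrite big_mkcondr; apply: eq_bigr => t _; case: (_ == _).
  by rewrite inE andbA.
move: E2; rewrite E1 big_split /= -E3 -big_distrr /= => E.
move: E; clear; move: (#|B|) (#|A|) (\sum_(i in F | v \in i) _) => n m q E.
have -> : n = 2 * (m - q) by lia.
by rewrite mul2n odd_double.
Qed.

(** Every boundary vertex lies on at least two faces with exactly two vertices in [X], and both of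
    these vertices belong to the boundary. *)
Lemma card_bdry_le (X : {set V}) x y : conn F X -> x \in X -> y \in X -> x != y -> #|bdry X| <= nfc F X 2.
Proof.
move=> cX xX yX nxy.
have E : \sum_(v in bdry X) #|[set t in F | (v \in t) && (#|t :&: X| == 2)]| = 2 * nfc F X 2.
  rewrite (eq_bigr (fun v => \sum_(t in F | (v \in t) && (#|t :&: X| == 2)) 1)); last first.
    by move=> v _; rewrite -sum1_card; apply: eq_bigl => t; rewrite inE.
  rewrite (exchange_big_dep (fun t => (t \in F) && (#|t :&: X| == 2))) /=;
    last by move=> c t _ /and3P[-> _ ->].
  rewrite (eq_bigr (fun=> 2)) => [|t /andP[tF t2]].
    by rewrite sum_nat_const mulnC; congr (_ * _); apply: eq_card => t; rewrite inE.
  rewrite -[RHS](eqP t2) -[RHS]sum1_card; apply: eq_bigl => v.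
  rewrite tF t2 andbT /= in_setI andbC; case: (boolP (v \in t)) => //= vt.
  have /andP[bX _] : (bdry X \subset X) && true by rewrite subsetDl.
  apply/idP/idP => [/(subsetP bX)//|vX].
  have [i0 i1] := face_interior X tF; rewrite in_setD vX andbT.
  apply/negP=> vi; have : 0 < #|t :&: interior X| by apply/card_gt0P; exists v; rewrite inE vt.
  by move/i1; rewrite (eqP t2).
rewrite -(leq_pmul2l (isT : 0 < 2)) -E mulnC -sum_nat_const leq_sum // => v vb.
apply: (link_crossing vb); have [vX _] := bdryP _ _ vb.
have [z zX nzv] : exists2 z, z \in X & z != v.
  by have [E'|] := eqVneq x v; [exists y; rewrite // -E' eq_sym|exists x].
have [|u [w [uX uv wX _ uw]]] := @conn_exit X [set v] v z cX vX (set11 v) zX; first by rewrite inE.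
by exists w; rewrite // -(set1P uv).
Qed.

Lemma conn_set1 x : conn F [set x].
Proof. by move=> Y y /set1P-> xY _; rewrite sub1set. Qed.

Lemma conn_star (Z : {set V}) w : w \in Z ->
  (forall u, u \in Z -> exists C, [/\ conn F C, C \subset Z, u \in C & w \in C]) -> conn F Z.
Proof.
move=> wZ H Y y yZ yY cl.
have sub C u : conn F C -> C \subset Z -> u \in C -> u \in Y -> C \subset Y.
  move=> cC sC uC uY; apply: (cC Y u) => // a b aC aY bC.
  by apply: cl; rewrite ?(subsetP sC).
have [C [cC sC yC wC]] := H y yZ; have wY := subsetP (sub C y cC sC yC yY) _ wC.
apply/subsetP=> z /H[C' [cC' sC' zC' wC']].
exact: (subsetP (sub C' w cC' sC' wC' wY)).
Qed.

Lemma bdry_ex (X : {set V}) u w : u \in X -> w \notin X -> exists b, b \in bdry X.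
Proof.
move=> uX wX.
have [p [q [_ pX _ qX pq]]] := conn_exit (conn_setT PT) (in_setT u) uX (in_setT w) wX.
by exists p; apply/bdryP; split=> //; exists q.
Qed.

(** Everything off [K] is linked to [w]: a boundary vertex of [X] has a neighbour outside [X], and
    any other component of the interior touches a boundary vertex. *)
Lemma comps_interior_coconn (X K : {set V}) w : w \notin X -> conn F X -> conn F (~: X) ->
  K \in comps (interior X) -> conn F (~: K).
Proof.
move=> wX cX cCX KX.
have sKi := comps_sub KX.
have sKX : K \subset X := subset_trans sKi (interior_sub X).
have sub : ~: X \subset ~: K by rewrite setCS.
have wK : w \in ~: K by apply: (subsetP sub); rewrite inE.
have bd v : v \in bdry X -> [/\ conn F (~: X :|: [set v]), ~: X :|: [set v] \subset ~: K
    & w \in ~: X :|: [set v]].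
  move=> vb; have [vX [v' v'X vv']] := bdryP _ _ vb; split; last by rewrite !inE wX.
    by apply: (conn_setU (x := v') (y := v)) => //; rewrite ?inE ?v'X // 1?adj_sym //; apply: conn_set1.
  rewrite subUset sub sub1set inE; apply: contraL vb => /(subsetP sKi) vi.
  by rewrite in_setD vi.
apply: (conn_star wK) => u; rewrite inE => uK.
have [uX|uX] := boolP (u \in X); last by exists (~: X); rewrite !inE uX wX.
have [ui|ui] := boolP (u \in interior X); last first.
  have ub : u \in bdry X by rewrite in_setD ui uX.
  by have [? ? ?] := bd u ub; exists (~: X :|: [set u]); split; rewrite // in_setU set11 orbT.
have [b bX] := bdry_ex uX wX.
have bX' : b \in X by case/bdryP: bX.
have bK : b \notin comp (interior X) u.
  by apply: contraL bX => /(subsetP (comp_sub _ _)) bi; rewrite in_setD bi.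
have [p [q [pX pC qX qC pq]]] := conn_exit cX uX (comp_self ui) bX' bK.
have qb : q \in bdry X.
  by rewrite in_setD qX andbT; apply: contraNN qC => qi; apply: comp_closed pC qi pq.
have [c1 s1 w1] := bd q qb.
exists (~: X :|: [set q] :|: comp (interior X) u); split.
- apply: (conn_setU (x := q) (y := p)) => //; rewrite ?in_setU ?set11 ?orbT // 1?adj_sym //.
  exact: comp_conn.
- rewrite subUset s1; apply/subsetP=> z zC; rewrite inE.
  apply: contraNN uK => zK; rewrite (comps_uniq KX zK) (comp_eq zC).
  exact: comp_self.
- by rewrite in_setU comp_self ?orbT.
- by rewrite in_setU w1.
Qed.

End Components.

(** * Isoperimetry *)

Section Isoperimetry.
Variables (V : finType) (F : {set {set V}}).
Hypothesis PT : plane_triangulation F.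
Hypothesis D56 : forall v : V, tri_deg F v = 5 \/ tri_deg F v = 6.

(** Here [a], [a1], [aj] are 6 minus the number of vertices of degree 5 in a disc and in two
    components of its interior; [6 + a <= a1 + aj] says that the components hold no more of them
    than the disc. The gain absorbs the 2 by which the length of the second component shrinks. *)
Lemma iso_pair (a a1 aj r1 s N : nat) : 0 < a -> a <= 6 -> a1 <= aj -> aj <= 6 -> 6 + a <= a1 + aj ->
  a1 <= r1 -> aj <= s + 2 -> aj * N <= (s + 2) ^ 2 -> a * N < s ^ 2 + 2 * r1 * s.
Proof.
move=> a0 a6 a1j aj6 aa r1a sa HN.
suff : a * (s + 2) ^ 2 < aj * (s ^ 2 + 2 * a1 * s).
  move=> H; have : aj * (a * N) < aj * (s ^ 2 + 2 * a1 * s).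
    apply: leq_ltn_trans H; rewrite mulnCA leq_mul2l HN orbT //.
  rewrite ltn_pmul2l; last lia.
  move=> H2; apply: leq_trans H2 _; rewrite leq_add2l leq_mul2r; apply/orP; right; lia.
(* Now [a1], [aj] and [a] take finitely many values, and each case is a polynomial inequality in the
   excess [u]. *)
have [u ->] : exists u, s = u + (aj - 2) by exists (s - (aj - 2)); lia.
clear -a0 a6 a1j aj6 aa.
have : a \in iota 1 6 by rewrite mem_iota; lia.
have : aj \in iota 4 3 by rewrite mem_iota; lia.
have : a1 \in iota 1 6 by rewrite mem_iota; lia.
rewrite !inE; clear a0 a6.
do 5?[case/orP]; move/eqP=> E1; subst a1;
do 2?[case/orP]; move/eqP=> E2; subst aj; rewrite //;
do 5?[case/orP]; move/eqP=> E3; subst a; try (exfalso; lia); nia.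
Qed.

(** The case without interior vertices: [(t + 2) ^ 2 - (6 * t + 1)] equals [(t - 1) ^ 2 + 2]. *)
Lemma iso_base a (b : bool) t l : a <= 6 -> t + 2 <= l -> a * t + b <= l ^ 2.
Proof.
move=> a6 tl; have : (t + 2) ^ 2 <= l ^ 2 by rewrite leq_sqr.
have : a * t <= 6 * t by rewrite leq_mul2r a6 orbT.
by case: t tl => [|[|t]] _; case: b; nia.
Qed.

(** Expanding the square on the right, the mixed products of different [s i] are given away. *)
Lemma sum_sqr_le (I : finType) (P : {pred I}) (s : I -> nat) (r : nat) (N : I -> nat) (a : nat) :
  (forall i, i \in P -> a * N i <= s i ^ 2 + 2 * r * s i) ->
  r ^ 2 + a * (\sum_(i in P) N i) <= (r + \sum_(i in P) s i) ^ 2.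
Proof.
move=> H; apply: (@leq_trans (r ^ 2 + \sum_(i in P) (s i ^ 2 + 2 * r * s i))).
  by rewrite leq_add2l big_distrr leq_sum.
elim: (index_enum I) => [|i l IH].
  by rewrite !big_nil !addn0.
rewrite !big_cons; case: ifP => // _; move: IH.
set A := \sum_(_ <- _ | _) _; set B := \sum_(_ <- _ | _) _; nia.
Qed.

Lemma interior_comps (X : {set V}) x v K : x \in X -> v \notin X -> conn F X -> conn F (~: X) ->
  K \in comps F (interior F X) ->
  [/\ conn F K, conn F (~: K), K \subset X, #|K| < #|X| & exists z, z \in K /\ v \notin K].
Proof.
move=> xX vX cX cCX KI; have sK : K \subset X := subset_trans (comps_sub KI) (interior_sub F X).
have vK : v \notin K by apply: contraNN vX => /(subsetP sK).
split=> //; first exact: (comps_conn KI); first exact: (comps_interior_coconn PT vX).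
  have b1 : 0 < #|bdry F X|.
    by have [b bX] := bdry_ex PT xX vX; apply/card_gt0P; exists b.
  by have := subset_leq_card (comps_sub KI); have := card_bdry F X; lia.
by have [z zK] := comps_ex KI; exists z.
Qed.

(** How much length is lost with the boundary layer: [X] has characteristic 1, its interior has one
    for each component, and the layer has at most [nfc F X 2] vertices. *)
Lemma peel (X : {set V}) x y v : x \in X -> y \in X -> x != y -> v \notin X ->
  conn F X -> conn F (~: X) ->
  nfc F (interior F X) 1 + nfc F (bdry F X) 3 + 2 <= nfc F X 2 + 2 * #|comps F (interior F X)|.
Proof.
move=> xX yX nxy vX cX cCX.
have bl := card_bdry_le PT cX xX yX nxy.
have X1 := nfc_interior PT X; have X2 := nfc_bdry PT X; have X3 := card_bdry F X.
have X4 := conn_chi1 PT xX vX cX cCX.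
have X5 := nei_double PT X; have X6 := nei_double PT (bdry F X).
have X7 := nei_double PT (interior F X).
have chiI : #|interior F X| + nfc F (interior F X) 3 = nei F (interior F X) + #|comps F (interior F X)|.
  rewrite (card_comps F) (nfc_comps PT) // (nei_comps PT) -sum1_card -!big_split; apply: eq_bigr => K KI.
  have [c1 c2 _ _ [z [zK vK]]] := interior_comps xX vX cX cCX KI.
  by rewrite /= (conn_chi1 PT zK vK c1 c2) addn1.
lia.
Qed.

(** Induction by layers. For a component [K] of the interior with inner length [l] and [n] inner
    faces, [n + 2 * l + a] faces touch [K] and its outer length is [l + a], by [conn_gb]; so
    [a * n <= l ^ 2] yields [a * (n + 2 * l + a) <= (l + a) ^ 2]. The squares of the components are
    then merged into one by [iso_pair]. The boolean term records strictness for two or more vertices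
    of degree 5. *)
Lemma isoperimetry n (X : {set V}) x v : #|X| <= n -> x \in X -> v \notin X ->
  conn F X -> conn F (~: X) -> pcnt F X <= 5 ->
  (6 - pcnt F X) * nfc F X 3 + (2 <= pcnt F X) <= nfc F X 2 ^ 2.
Proof.
elim: n X x => [|n IH] X x cn xX vX cX cCX p5.
  by move: cn; rewrite leqn0 cards_eq0 => /eqP E; rewrite E inE in xX.
have [/eqP/cards1P[y Ey]|n1] := eqVneq #|X| 1.
  have c1 : forall t, t \in F -> #|t :&: X| <= 1.
    by move=> t _; rewrite Ey -(cards1 y) subset_leq_card // subsetIr.
  have -> : nfc F X 3 = 0 by rewrite nfcE big1 // => t /c1; lia.
  have : pcnt F X <= 1 by rewrite Ey -(cards1 y) subset_leq_card // subsetIl.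
  by rewrite muln0; lia.
have [y yX nxy] : exists2 y, y \in X & x != y.
  have /card_gt0P[y] : 0 < #|X :\ x| by move: n1; rewrite (cardsD1 x X) xX; lia.
  by rewrite !inE => /andP[nyx yX]; exists y => //; rewrite eq_sym.
have X1 := nfc_interior PT X; have key := peel xX yX nxy vX cX cCX.
set I := interior F X in X1 key *; set t := nfc F (bdry F X) 3 in X1 key *.
have compK K : K \in comps F I -> [/\ conn F K, conn F (~: K), K \subset X,
    #|K| <= n & exists z, z \in K /\ v \notin K].
  move=> KI; have [c1 c2 sK cK zv] := interior_comps xX vX cX cCX KI.
  by split=> //; rewrite -ltnS; apply: leq_trans cK cn.
pose N K := nfc F K 3 + nfc F K 2 + nfc F K 1.
pose m := #|comps F I|; rewrite -/m in key.
have Nsum : nfc F X 3 = \sum_(K in comps F I) N K + t.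
  by rewrite X1 !(nfc_comps PT) // -!big_split.
have Kprop K : K \in comps F I -> [/\ nfc F K 1 + pcnt F K = nfc F K 2 + 6,
   pcnt F K <= pcnt F X & (6 - pcnt F K) * N K + (2 <= pcnt F K) <= nfc F K 1 ^ 2].
  move=> KI; have [c1 c2 sK cK [z [zK vK]]] := compK K KI.
  have pK := pcntS F sK; have G := conn_gb PT D56 zK vK c1 c2.
  split=> //; have := IH K z cK zK vK c1 c2 (leq_trans pK p5).
  have [a Ea] : exists a, a + pcnt F K = 6 by exists (6 - pcnt F K); lia.
  have -> : 6 - pcnt F K = a by lia.
  have E1 : nfc F K 1 = nfc F K 2 + a by lia.
  rewrite /N E1; move: (nfc F K 3) (nfc F K 2) (nat_of_bool _) => u l b; nia.
have [a Ea] : exists a, a + pcnt F X = 6 by exists (6 - pcnt F X); lia.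
have -> : 6 - pcnt F X = a by lia.
have [m0|/card_gt0P[K0 K0I]] := posnP m.
  have E0 : comps F I = set0 by apply/eqP; rewrite -cards_eq0 -/m m0.
  have I1 : nfc F I 1 = 0 by rewrite (nfc_comps PT) // E0 big_set0.
  rewrite Nsum E0 big_set0 add0n; apply: iso_base; first lia.
  by move: key; rewrite I1 m0; lia.
(* The component richest in vertices of degree 5 keeps its full length; every other one gives up 2,
   which pays for the summand [2 * m] of [peel]. *)
pose K1 := [arg max_(K > K0 in comps F I) pcnt F K].
have [K1I K1max] : K1 \in comps F I /\ forall K, K \in comps F I -> pcnt F K <= pcnt F K1.
  by rewrite /K1; case: arg_maxnP.
have [E1 p1 N1] := Kprop K1 K1I.
pose r1 := nfc F K1 1; pose s K := nfc F K 1 - 2.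
have pair K : K \in comps F I :\ K1 -> pcnt F K + pcnt F K1 <= pcnt F X.
  rewrite in_setD1 => /andP[nK KI].
  apply: leq_trans (pcntS F (interior_sub F X)); rewrite -/I (pcnt_comps F I) (bigD1 K1 K1I) /= (bigD1 K) /=; last by apply/andP.
  lia.
have s2 K : K \in comps F I :\ K1 -> nfc F K 1 = s K + 2 /\ a * N K < s K ^ 2 + 2 * r1 * s K.
  move=> KI'; have pp := pair K KI'; move: KI'; rewrite in_setD1 => /andP[nK KI].
  have [E p N'] := Kprop K KI; have mx := K1max K KI.
  have Es : nfc F K 1 = s K + 2 by rewrite /s; lia.
  split=> //; apply: (@iso_pair a (6 - pcnt F K1) (6 - pcnt F K)); lia.
have lsum : r1 + \sum_(K in comps F I :\ K1) s K + t <= nfc F X 2.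
  have : nfc F I 1 = r1 + \sum_(K in comps F I :\ K1) s K + 2 * (m - 1).
    rewrite (nfc_comps PT) // (big_setD1 K1 K1I) /= -addnA; congr (_ + _).
    rewrite (eq_bigr (fun K => s K + 2)) => [|K KI]; last by have [] := s2 K KI.
    by rewrite big_split /= sum_nat_const mulnC /m (cardsD1 K1 (comps F I)) K1I; lia.
  have : 0 < m by apply/card_gt0P; exists K0.
  lia.
have Nsum2 : nfc F X 3 = N K1 + \sum_(K in comps F I :\ K1) N K + t.
  by rewrite Nsum (big_setD1 K1 K1I).
have sq := @sum_sqr_le _ (mem (comps F I :\ K1)) s r1 N a (fun K KI => ltnW (proj2 (s2 K KI))).
have r1a : 6 - pcnt F K1 <= r1 by rewrite /r1; lia.
have N1' : a * N K1 + ((2 <= pcnt F X) && ((pcnt F X == pcnt F K1) || true)) <= r1 ^ 2.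
  have NK1 : 0 < N K1 by rewrite /N; lia.
  rewrite orbT andbT; move: N1; rewrite -/r1.
  have [->|] := eqVneq (pcnt F K1) (pcnt F X).
    by rewrite (_ : 6 - pcnt F X = a) //; lia.
  move=> ne; have [b Eb] : exists b, 6 - pcnt F K1 = a + b.+1 by exists (6 - pcnt F K1 - a - 1); lia.
  rewrite Eb; move: (nat_of_bool (1 < pcnt F K1)) => c.
  case: (1 < pcnt F X) => /=; nia.
move: N1'; rewrite orbT andbT => N1'.
rewrite Nsum2.
have a6 : a <= r1 by lia.
have : (r1 + \sum_(K in comps F I :\ K1) s K + t) ^ 2 <= nfc F X 2 ^ 2 by rewrite leq_sqr.
move: sq N1' a6; move: (\sum_(K in _) s K) (\sum_(K in _) N K) (nfc F X 2) (N K1) (nat_of_bool _).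
clearbody r1 t; clear; move=> S M l N1 b sq N1' ar1; nia.
Qed.

End Isoperimetry.

(** * Disjoint moats *)

(** [N] moats of total area [Q] lie inside a disc of area [n], and a moat of area [2 * l + a] is put
    around it. The constant 5 is the minimum of [p * (6 - p)]: it gives [5 * N <= p * l], so the new
    moat adds at least [10 * N + 5] on the right. Equality needs [b = 0]. *)
Lemma moat_step (p a N Q n l b : nat) : a + p = 6 -> 0 < p <= 5 -> Q <= n ->
  a * n + b <= l ^ 2 -> 5 * N ^ 2 <= p * Q -> (1 < p -> 0 < b) ->
  5 * N.+1 ^ 2 <= p * (Q + (2 * l + a)) /\ (5 * N.+1 ^ 2 = p * (Q + (2 * l + a)) -> p = 1).
Proof.
move=> ap /andP[p0 p5] Qn al NQ pb.
have pa : 5 <= p * a.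
  have : p \in iota 1 5 by rewrite mem_iota; lia.
  have -> : a = 6 - p by lia.
  by rewrite !inE; do 4?[case/orP]; move/eqP->.
have H1 : 25 * N ^ 2 + p ^ 2 * b <= (p * l) ^ 2.
  have h1 : p ^ 2 * (a * n + b) <= p ^ 2 * l ^ 2 by rewrite leq_mul2l al orbT.
  have h2 : (p * a) * (p * Q) <= (p * a) * (p * n) by rewrite !leq_mul2l Qn !orbT.
  have h3 : (p * a) * (5 * N ^ 2) <= (p * a) * (p * Q) by rewrite leq_mul2l NQ orbT.
  have h4 : 5 * (5 * N ^ 2) <= (p * a) * (5 * N ^ 2) by rewrite leq_mul2r pa orbT.
  have E : p ^ 2 * (a * n + b) = (p * a) * (p * n) + p ^ 2 * b by lia.
  have E2 : (p * l) ^ 2 = p ^ 2 * l ^ 2 by rewrite expnMn.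
  rewrite E2; lia.
have H2 : 5 * N <= p * l.
  rewrite -leq_sqr; apply: leq_trans H1; rewrite expnMn; lia.
split; first nia.
move=> Eq; have [pl pa5] : p * l = 5 * N /\ p * a = 5 by split; nia.
apply/eqP; move: H1; rewrite pl expnMn => H1.
case: (ltngtP p 1) => // [|p1]; first lia.
by have := pb p1; nia.
Qed.

(** Cauchy-Schwarz: [(N1 + N2) ^ 2 / (p1 + p2)] is at most [N1 ^ 2 / p1 + N2 ^ 2 / p2], with
    equality only for proportional pairs. *)
Lemma moat_join (p1 p2 Q1 Q2 N1 N2 : nat) : 0 < p1 -> 0 < p2 ->
  5 * N1 ^ 2 <= p1 * Q1 -> 5 * N2 ^ 2 <= p2 * Q2 ->
  5 * (N1 + N2) ^ 2 <= (p1 + p2) * (Q1 + Q2) /\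
  (5 * (N1 + N2) ^ 2 = (p1 + p2) * (Q1 + Q2) ->
    [/\ 5 * N1 ^ 2 = p1 * Q1, 5 * N2 ^ 2 = p2 * Q2 & N1 * p2 = N2 * p1]).
Proof.
move=> p10 p20 H1 H2.
have pp : 0 < p1 * p2 by rewrite muln_gt0 p10.
have h1 : p1 ^ 2 * (5 * N2 ^ 2) <= p1 ^ 2 * (p2 * Q2) by rewrite leq_mul2l H2 orbT.
have h2 : p2 ^ 2 * (5 * N1 ^ 2) <= p2 ^ 2 * (p1 * Q1) by rewrite leq_mul2l H1 orbT.
have h3 : 2 * ((p1 * N2) * (p2 * N1)) <= (p1 * N2) ^ 2 + (p2 * N1) ^ 2 by apply: nat_Cauchy.
have E : (p1 * p2) * (p1 * Q2 + p2 * Q1) = p1 ^ 2 * (p2 * Q2) + p2 ^ 2 * (p1 * Q1) by lia.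
have h4 : (p1 * p2) * (10 * (N1 * N2)) <= (p1 * p2) * (p1 * Q2 + p2 * Q1).
  rewrite E; apply: leq_trans (leq_add h1 h2).
  move: h3; rewrite !expnMn; lia.
have h5 : 10 * (N1 * N2) <= p1 * Q2 + p2 * Q1 by rewrite -(leq_pmul2l pp).
have ED : (p1 + p2) * (Q1 + Q2) = p1 * Q1 + p2 * Q2 + (p1 * Q2 + p2 * Q1).
  by rewrite mulnDl !mulnDr; lia.
have EN : 5 * (N1 + N2) ^ 2 = 5 * N1 ^ 2 + 5 * N2 ^ 2 + 10 * (N1 * N2) by rewrite sqrnD; lia.
rewrite ED EN; split; first exact: (leq_add (leq_add H1 H2) h5).
move=> Eq; have [e1 [e2 e3]] : 5 * N1 ^ 2 = p1 * Q1 /\ 5 * N2 ^ 2 = p2 * Q2 /\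
   10 * (N1 * N2) = p1 * Q2 + p2 * Q1.
  move: Eq H1 H2 h5; clear.
  move: (5 * N1 ^ 2) (5 * N2 ^ 2) (10 * (N1 * N2)) (p1 * Q1) (p2 * Q2) (p1 * Q2 + p2 * Q1) => *; lia.
split=> //; move: E; rewrite -e3 -e1 -e2; move=> {h1 h2 h3 h4 h5 ED EN Eq e1 e2 e3 H1 H2} E.
have : (p1 * N2) ^ 2 + (p2 * N1) ^ 2 = 2 * (p1 * N2 * (p2 * N1)) by rewrite !expnMn; lia.
have -> : N1 * p2 = p2 * N1 by rewrite mulnC.
have -> : N2 * p1 = p1 * N2 by rewrite mulnC.
move: (p1 * N2) (p2 * N1) => x y; clear => E.
by have := nat_Cauchy x y; rewrite -E => -[_]; rewrite eqxx => /esym/eqP.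
Qed.

(** * Moats around a laminar family of discs *)

Section Moats.
Variables (V : finType) (F : {set {set V}}).
Hypothesis PT : plane_triangulation F.
Hypothesis D56 : forall v : V, tri_deg F v = 5 \/ tri_deg F v = 6.

(* A pair [(X, n)] encodes a vertex set of the midpoint subdivision of the
   triangulation: [X], the midpoints of the edges inside [X] and, when [n] is
   [false], also the midpoints of the edges leaving [X].  Each face is cut by
   the subdivision into three corners [(t, Some c)] and a central
   triangle [(t, None)]. *)
Definition insd (X : {set V}) (n : bool) (Y : {set V}) (m : bool) : Prop :=
  X \subset Y /\ forall x y, x \in X -> y \notin Y -> tri_adj F x y -> n && ~~ m.

Definition subfaces (gN : pred nat) (gS : pred bool) (gC : pred nat) (X : {set V}) :
    {set {set V} * option V} :=
  [set q | (q.1 \in F) && (if q.2 is Some c then (c \in q.1) && (gS (c \in X) && gC #|q.1 :&: X|)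
                           else gN #|q.1 :&: X|)].
Definition core := subfaces (leq 3) predT (leq 3).
Definition mid := subfaces (leq 2) id predT.
Definition wide := subfaces (leq 1) predT (leq 1).
(** [tot] collects the small triangles that meet the encoded set and [ins] those inside it. [mid]
    serves twice, since the triangles inside [(X, false)] are the ones that meet [(X, true)]. *)
Definition tot (X : {set V}) (n : bool) := if n then mid X else wide X.
Definition ins (X : {set V}) (n : bool) := if n then core X else mid X.
Definition moat (X : {set V}) (n : bool) := tot X n :\: ins X n.

Lemma insd_compl X n Y m : insd X n Y m -> insd (~: Y) (~~ m) (~: X) (~~ n).
Proof.
case=> sXY H; split; first by rewrite setCS.
move=> x y; rewrite !inE negbK => xY yX xy; rewrite negbK andbC.
by apply: (H y x); rewrite // adj_sym.
Qed.

Lemma face_two t (X Y : {set V}) n m : t \in F -> insd X n Y m ->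
  0 < #|t :&: X| -> #|t :&: Y| < 3 -> n && ~~ m.
Proof.
move=> tF [sXY H] /card_gt0P[x]; rewrite inE => /andP[xt xX] lt3.
have : ~~ (t \subset Y) by rewrite -(card3_sub PT Y tF) neq_ltn lt3.
case/subsetPn=> y yt yY; apply: (H x y) => //; apply: (face_in_adj PT tF) => //.
by apply: contraNneq yY => <-; apply: (subsetP sXY).
Qed.

(** By [insd], an edge may run from [X] out of [Y] only if its midpoint belongs to the second
    encoded set but not to the first; hence no small triangle meets the first set and leaves the
    second. *)
Lemma tot_ins X n Y m : insd X n Y m -> tot X n \subset ins Y m.
Proof.
move=> H; have sXY : X \subset Y by case: H.
apply/subsetP=> -[t o]; rewrite /tot /ins.
have [tF|tF] := boolP (t \in F); last by case: n H; rewrite inE /= (negPf tF).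
have sI : #|t :&: X| <= #|t :&: Y| by apply: subset_leq_card; apply: setIS.
have Y3 := card_faceI PT Y tF.
have key : 0 < #|t :&: X| -> (#|t :&: Y| = 3) \/ (n = true /\ m = false).
  move=> X0; case: (ltnP #|t :&: Y| 3) => [lt3|]; last by left; lia.
  by right; have /andP[-> /negPf->] := face_two tF H X0 lt3.
have [X0|X0] := posnP #|t :&: X|.
  have nX c : c \in t -> (c \in X) = false.
    move=> ct; apply/negP=> cX; have : 0 < #|t :&: X| by apply/card_gt0P; exists c; rewrite inE ct.
    by rewrite X0.
  case: n {key H}; rewrite inE /= X0 ?andbF //; case: o => [c|]; rewrite ?andbF //.
  by case: (boolP (c \in t)) => [/nX->|]; rewrite ?andbF.
case: (key X0) => [E3|[-> ->]].
  case: o => [c|].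
    have cY : c \in t -> c \in Y.
      by move=> ct; have /subsetP-> : t \subset Y by rewrite -(card3_sub PT Y tF) E3.
    by case: n {key H}; case: m; rewrite !inE /= ?E3 tF ?andbT //=; case: (boolP (c \in t)) => //= ct; rewrite cY.
  by case: n {key H}; case: m; rewrite !inE /= ?E3 tF.
rewrite !inE tF /=; case: o => [c|]; last by move=> /leq_trans; apply.
by rewrite !andbT; case: (boolP (c \in t)) => //= ct; apply: (subsetP sXY).
Qed.

Lemma ins_tot X n : ins X n \subset tot X n.
Proof.
apply/subsetP=> -[t o]; rewrite /tot /ins; case: n; rewrite !inE /=; case: (boolP (t \in F)) => //= tF.
  case: o => [c|]; last exact: leq_trans.
  case: (boolP (c \in t)) => //= ct X3; rewrite andbT.
  have : t \subset X by rewrite -(card3_sub PT X tF) eqn_leq X3 andbT -ltnS (card_faceI PT).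
  by move/subsetP->.
case: o => [c|]; last by move=> h; apply: leq_trans h.
by case: (boolP (c \in t)) => //= ct; rewrite andbT => cX; apply/card_gt0P; exists c; rewrite inE ct.
Qed.

Lemma insC_tot X n q : q \in ins (~: X) (~~ n) -> q \notin tot X n.
Proof.
case: q => t o; rewrite /tot /ins; case: n; rewrite /= !inE /=; case: (boolP (t \in F)) => //= tF.
  have := cardsID X t; rewrite (card_face PT tF) setDE => E.
  case: o => [c|]; last by lia.
  by case: (c \in t) => //=; rewrite !andbT inE.
have := cardsID X t; rewrite (card_face PT tF) setDE => E.
by case: o => [c|]; last lia; case: (c \in t) => //=; lia.
Qed.

Lemma apart_tot X n Y m : insd X n (~: Y) (~~ m) -> [disjoint tot X n & tot Y m].
Proof.
move=> /tot_ins H; rewrite disjoint_subset; apply: subset_trans H _.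
by apply/subsetP=> q /insC_tot.
Qed.

Lemma card_subfaces gN gS gC X :
  #|subfaces gN gS gC X| =
  \sum_(t in F) (gN #|t :&: X| + #|[set c in t | gS (c \in X) && gC #|t :&: X|]|).
Proof.
rewrite big_split /=.
pose A := (fun t : {set V} => (t, None : option V)) @: [set t in F | gN #|t :&: X|].
pose B := (fun p : {set V} * V => (p.1, Some p.2)) @:
  [set p | [&& p.1 \in F, p.2 \in p.1 & gS (p.2 \in X) && gC #|p.1 :&: X|]].
have -> : subfaces gN gS gC X = A :|: B.
  apply/setP=> -[t [c|]]; rewrite inE in_setU /=; apply/idP/orP.
  - by move=> h; right; apply/imsetP; exists (t, c); rewrite ?inE.
  - by case=> /imsetP[p] //; rewrite inE => h [-> ->].
  - by move=> h; left; apply/imsetP; exists t; rewrite ?inE.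
  - by case=> /imsetP[p] //; rewrite inE => h [->].
rewrite cardsU (_ : A :&: B = set0) ?cards0 ?subn0; last first.
  by apply/eqP; rewrite -subset0; apply/subsetP=> q; rewrite inE => /andP[/imsetP[t _ ->] /imsetP[p]].
congr (_ + _).
  rewrite card_imset; last by move=> t t' [].
  by rewrite -sum1_card big_mkcond [RHS]big_mkcond; apply: eq_bigr => t _; rewrite inE; case: (t \in F); case: (gN _).
rewrite card_imset; last by move=> [t c] [t' c'] [-> ->].
rewrite -sum1_card (eq_bigr (fun t : {set V} => \sum_(c | (c \in t) && (gS (c \in X) && gC #|t :&: X|)) 1)); last first.
  by move=> t _; rewrite -sum1_card; apply: eq_bigl => c; rewrite inE.
by rewrite pair_big_dep /=; apply: eq_bigl => -[t c]; rewrite inE.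
Qed.

Lemma card_mid X : #|mid X| = nfc F X 1 + 3 * nfc F X 2 + 4 * nfc F X 3.
Proof.
rewrite card_subfaces (eq_bigr (fun t : {set V} => (2 <= #|t :&: X|) + #|t :&: X|)) => [|t _].
  by rewrite (sum_faces PT X (fun m => (2 <= m) + m)) /=; lia.
by congr (_ + _); apply: eq_card => c; rewrite !inE andbT.
Qed.

Lemma card_core X : #|core X| = 4 * nfc F X 3.
Proof.
rewrite card_subfaces (eq_bigr (fun t : {set V} => 4 * (3 <= #|t :&: X|))) => [|t tF].
  by rewrite (sum_faces PT X (fun m => 4 * (3 <= m))) /=; lia.
case: (3 <= _); last by rewrite eq_card0 // => c; rewrite inE /= andbF.
have -> : [set c in t | predT (c \in X) && true] = t by apply/setP=> c; rewrite inE /= andbT.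
by rewrite (card_face PT tF).
Qed.

Lemma card_wide X : #|wide X| = 4 * (nfc F X 1 + nfc F X 2 + nfc F X 3).
Proof.
rewrite card_subfaces (eq_bigr (fun t : {set V} => 4 * (1 <= #|t :&: X|))) => [|t tF].
  by rewrite (sum_faces PT X (fun m => 4 * (1 <= m))) /=; lia.
case: (1 <= _); last by rewrite eq_card0 // => c; rewrite inE /= andbF.
have -> : [set c in t | predT (c \in X) && true] = t by apply/setP=> c; rewrite inE /= andbT.
by rewrite (card_face PT tF).
Qed.

Lemma card_moat X n : #|moat X n| = if n then nfc F X 1 + 3 * nfc F X 2 else 3 * nfc F X 1 + nfc F X 2.
Proof.
rewrite /moat cardsD (setIidPr (ins_tot X n)) /tot /ins; case: n; rewrite ?card_mid ?card_core ?card_wide; lia.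
Qed.

Variables (I : finType) (S : I -> {set V}) (nr : I -> bool).
Hypothesis Sconn : forall s, conn F (S s).
Hypothesis SCconn : forall s, conn F (~: S s).
Hypothesis Sp : forall s, 0 < pcnt F (S s) <= 5.
Hypothesis Slam : forall s t, s != t -> [\/ insd (S s) (nr s) (S t) (nr t),
  insd (S t) (nr t) (S s) (nr s) | insd (S s) (nr s) (~: S t) (~~ nr t)].

Definition cup (B : {set I}) := \bigcup_(s in B) S s.
Definition cupm (B : {set I}) := \bigcup_(s in B) moat (S s) (nr s).

Let Sx s : exists x v, x \in S s /\ v \notin S s.
Proof.
have /andP[p0 p5] := Sp s.
have /card_gt0P[x] := p0; rewrite inE => /andP[xS _].
have : 0 < pcnt F (~: S s) by have := pcntC PT D56 (S s); lia.
by case/card_gt0P=> v; rewrite !inE => /andP[vS _]; exists x, v.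
Qed.

Let Sgb s : nfc F (S s) 1 + pcnt F (S s) = nfc F (S s) 2 + 6.
Proof. by have [x [v [xS vS]]] := Sx s; apply: (conn_gb PT D56 xS vS). Qed.

Let ins_lt s : #|ins (S s) (nr s)| < #|tot (S s) (nr s)|.
Proof.
have /andP[p0 p5] := Sp s; have G := Sgb s.
have : 0 < #|moat (S s) (nr s)| by rewrite card_moat; case: (nr s); lia.
by rewrite cardsD (setIidPr (ins_tot _ _)) subn_gt0.
Qed.

(** A set [u] with the largest [tot] lies inside no other. If it contains all sets, the other moats
    lie in its [ins] and [moat_step] applies; otherwise the sets inside [u] and the sets apart from
    [u] are combined by [moat_join]. The proportionality there spreads the sets evenly over the
    vertices of degree 5. *)
Lemma moat_ineq (B : {set I}) :
  5 * #|B| ^ 2 <= pcnt F (cup B) * #|cupm B| /\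
  (5 * #|B| ^ 2 = pcnt F (cup B) * #|cupm B| ->
     (forall s, s \in B -> pcnt F (S s) = 1) /\
     (forall t, t \in cup B :&: pent F -> pcnt F (cup B) * #|[set s in B | t \in S s]| = #|B|)).
Proof.
have [n cB] := ubnP #|B|; elim: n B cB => // n IH B cB.
have [->|/set0Pn[s0 s0B]] := eqVneq B set0.
  rewrite cards0 /=; split=> // _; split=> [s|t]; first by rewrite inE.
  by rewrite /cup big_set0 set0I inE.
pose u := [arg max_(s > s0 in B) #|tot (S s) (nr s)|].
have [uB umax] : u \in B /\ forall s, s \in B -> #|tot (S s) (nr s)| <= #|tot (S u) (nr u)|.
  by rewrite /u; case: arg_maxnP.
have rel s : s \in B -> s != u -> insd (S s) (nr s) (S u) (nr u) \/ insd (S s) (nr s) (~: S u) (~~ nr u).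
  move=> sB su; case: (Slam su) => [H|H|H]; [by left| |by right].
  have := subset_leq_card (tot_ins H); have := ins_lt s; have := umax s sB; lia.
pose B1 := [set s in B | S s \subset S u]; pose B2 := B :\: B1.
have uB1 : u \in B1 by rewrite inE uB subxx.
have B1rel s : s \in B1 -> s != u -> insd (S s) (nr s) (S u) (nr u).
  rewrite inE => /andP[sB sS] su; case: (rel s sB su) => // -[sC _].
  have [x [_ [xS _]]] := Sx s; have := subsetP sC _ xS.
  by rewrite inE (subsetP sS).
have B2rel s : s \in B2 -> insd (S s) (nr s) (~: S u) (~~ nr u).
  rewrite in_setD => /andP[sB1 sB]; have su : s != u by apply: contraNneq sB1 => ->.
  case: (rel s sB su) => // -[sS _]; case/negP: sB1; rewrite inE sB; exact: sS.
have moat_tot s : s \in B1 -> moat (S s) (nr s) \subset tot (S u) (nr u).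
  move=> sB1; have [->|su] := eqVneq s u; first exact: subsetDl.
  apply: subset_trans (subsetDl _ _) _; apply: subset_trans (tot_ins (B1rel s sB1 su)) _.
  exact: ins_tot.
have [B20|B20] := eqVneq B2 set0.
  have EB : B = B1.
    by apply/eqP; rewrite eqEsubset -setD_eq0 -/B2 B20 eqxx; apply/subsetP=> s; rewrite inE => /andP[].
  pose B' := B :\ u.
  have cB' : #|B| = #|B'|.+1 by rewrite (cardsD1 u B) uB.
  have [IH1 _] := IH B' ltac:(by rewrite -ltnS -cB').
  have Ecup : cup B = S u.
    apply/eqP; rewrite eqEsubset; apply/andP; split; last exact: (bigcup_sup u).
    by apply/bigcupsP=> s; rewrite EB inE => /andP[].
  have sub' : cup B' \subset S u.
    by apply/bigcupsP=> s; rewrite in_setD1 EB => /andP[_]; rewrite inE => /andP[].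
  have Qsub : cupm B' \subset ins (S u) (nr u).
    apply/bigcupsP=> s; rewrite in_setD1 EB => /andP[su sB1].
    by apply: subset_trans (subsetDl _ _) _; apply: tot_ins; apply: B1rel.
  have Ecupm : cupm B = cupm B' :|: moat (S u) (nr u).
    by rewrite /cupm (big_setD1 u uB) setUC.
  have cQ : #|cupm B| = #|cupm B'| + #|moat (S u) (nr u)|.
    rewrite Ecupm cardsU (_ : _ :&: _ = set0) ?cards0 ?subn0 //.
    by apply/eqP; rewrite setI_eq0 disjoint_sym disjoint_subset; apply/subsetP=> q;
       rewrite in_setD inE => /andP[qi _]; apply: contraNN qi => /(subsetP Qsub).
  have Q0 := subset_leq_card Qsub.
  have [x [v [xS vS]]] := Sx u; have G := Sgb u; have /andP[p0 p5] := Sp u.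
  have iso := isoperimetry PT D56 (leqnn _) xS vS (@Sconn u) (@SCconn u) p5.
  have NQ : 5 * #|B'| ^ 2 <= pcnt F (S u) * #|cupm B'|.
    by apply: leq_trans IH1 _; rewrite leq_mul2r pcntS ?orbT.
  have [a Ea] : exists a, a + pcnt F (S u) = 6 by exists (6 - pcnt F (S u)); lia.
  have Ea' : 6 - pcnt F (S u) = a by lia.
  (* Isoperimetry in small triangles: lengths double and areas quadruple. For the flag [false] the
     inner region is wider by half a layer, and its length grows by [a]. *)
  have Em : exists l n, [/\ #|moat (S u) (nr u)| = 2 * l + a, #|cupm B'| <= n
      & a * n + (1 < pcnt F (S u)) <= l ^ 2].
    move: Q0 iso; rewrite Ea' card_moat /ins; case: (nr u); rewrite ?card_core ?card_mid => Q0 iso.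
      exists (2 * nfc F (S u) 2), (4 * nfc F (S u) 3); split=> //; first lia.
      by rewrite expnMn; case: (1 < _) iso; nia.
    exists (2 * nfc F (S u) 2 + a), (4 * nfc F (S u) 3 + 4 * nfc F (S u) 2 + a); split=> //; [lia|lia|].
    by case: (1 < _) iso; nia.
  have [l [m [E1 E2 E3]]] := Em.
  have [||C1 C2] := @moat_step (pcnt F (S u)) a #|B'| #|cupm B'| m l (1 < pcnt F (S u)) Ea _ E2 E3 NQ.
  - by rewrite p0.
  - by move=> ->.
  rewrite Ecup cQ E1 cB'; split=> // Eq; have p1 := C2 Eq.
  have all1 s : s \in B -> pcnt F (S s) = 1.
    rewrite EB inE => /andP[_ sS]; have := pcntS F sS; have /andP[] := Sp s; lia.
  split=> // t; rewrite inE => /andP[tS tT]; rewrite p1 mul1n -cB'; apply: eq_card => s; rewrite inE.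
  case: (boolP (s \in B)) => //= sB.
  have := sB; rewrite EB inE => /andP[_ sS].
  have : S s :&: pent F = S u :&: pent F.
    by apply/eqP; rewrite eqEcard setSI //= -/(pcnt F _) -/(pcnt F _) p1 all1.
  by move/setP/(_ t); rewrite !in_setI tS tT => /andP[].
have sB1B : B1 \subset B by apply/subsetP=> s; rewrite inE => /andP[].
have cc : #|B| = #|B1| + #|B2| by rewrite -(cardsID B1 B) (setIidPr sB1B).
have c1 : 0 < #|B1| by apply/card_gt0P; exists u.
have c2 : 0 < #|B2| by rewrite card_gt0.
have [IH1 Eq1] := IH B1 ltac:(lia); have [IH2 Eq2] := IH B2 ltac:(lia).
have UB : B = B1 :|: B2 by rewrite /B2 setDE setUIr setUCr setIT; apply/esym/setUidPr.
have Ecup : cup B = cup B1 :|: cup B2 by rewrite {1}UB /cup bigcup_setU.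
have Ecupm : cupm B = cupm B1 :|: cupm B2 by rewrite {1}UB /cupm bigcup_setU.
have dcup : [disjoint cup B1 & cup B2].
  rewrite disjoint_sym disjoint_subset; apply/subsetP=> x /bigcupP[s sB2 xs]; rewrite inE.
  apply/negP=> /bigcupP[t]; rewrite inE => /andP[_ tS] xt.
  have [sC _] := B2rel s sB2; have := subsetP sC _ xs.
  by rewrite inE (subsetP tS).
have dcupm : [disjoint cupm B1 & cupm B2].
  rewrite disjoint_sym disjoint_subset; apply/subsetP=> q /bigcupP[s sB2 qs]; rewrite inE.
  apply/negP=> /bigcupP[t tB1 qt].
  have /pred0P/(_ q) := apart_tot (B2rel s sB2); rewrite /= (subsetP (moat_tot t tB1) _ qt) andbT.
  by move: qs; rewrite in_setD => /andP[_ ->].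
have cQ : #|cupm B| = #|cupm B1| + #|cupm B2|.
  by rewrite Ecupm cardsU (disjoint_setI0 dcupm) cards0 subn0.
have cP : pcnt F (cup B) = pcnt F (cup B1) + pcnt F (cup B2) by rewrite Ecup pcntU.
have pp (B' : {set I}) : 0 < #|B'| -> 0 < pcnt F (cup B').
  case/card_gt0P=> s sB'; have /andP[p0 _] := Sp s; apply: leq_trans p0 _.
  by apply: pcntS; apply: (bigcup_sup s).
have [J1 J2] := moat_join (pp _ c1) (pp _ c2) IH1 IH2.
rewrite cQ cP cc; split=> // Eq; have [e1 e2 e3] := J2 Eq.
have [a1 b1] := Eq1 e1; have [a2 b2] := Eq2 e2.
split=> [s|t]; first by rewrite UB in_setU => /orP[]; [apply: a1|apply: a2].
have P1 := pp _ c1; have P2 := pp _ c2.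
have cnt B' B'' : B = B' :|: B'' -> (forall s, s \in B'' -> t \notin S s) ->
    [set s in B | t \in S s] = [set s in B' | t \in S s].
  move=> -> H; apply/setP=> s; rewrite !inE; case: (boolP (s \in B'')) => [/H/negPf->|]; rewrite ?andbF ?orbF //.
rewrite inE Ecup in_setU => /andP[/orP[tU|tU] tT].
  have := b1 t; rewrite inE tU tT => /(_ isT).
  rewrite (cnt B1 B2 UB); first by move: (#|[set _ in _ | _]|) => c; nia.
  move=> s sB2; apply/negP=> ts; have /pred0P/(_ t) := dcup; rewrite /= tU /=.
  by move/negP; apply; apply/bigcupP; exists s.
have := b2 t; rewrite inE tU tT => /(_ isT).
rewrite (cnt B2 B1); last first.
- move=> s sB1; apply/negP=> ts; have /pred0P/(_ t) := dcup; rewrite /= tU andbT.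
  by move/negP; apply; apply/bigcupP; exists s.
- by rewrite setUC.
by move: (#|[set _ in _ | _]|) => c; nia.
Qed.

End Moats.

(** * From connected odd sets to discs *)

Section Filling.
Variables (V : finType) (F : {set {set V}}).
Hypothesis PT : plane_triangulation F.
Hypothesis D56 : forall v : V, tri_deg F v = 5 \/ tri_deg F v = 6.

(** Laminarity on the sphere: a fourth alternative makes the relation invariant under complementing
    either set. *)
Definition cross_free (X : {set V}) (n : bool) (Y : {set V}) (m : bool) :=
  [\/ insd F X n Y m, insd F Y m X n, insd F X n (~: Y) (~~ m) | insd F (~: X) (~~ n) Y m].

Lemma cross_free_sym X n Y m : cross_free X n Y m -> cross_free Y m X n.
Proof.
case=> H; [by constructor 2|by constructor 1|constructor 3|constructor 4].
  by have := insd_compl H; rewrite setCK negbK.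
by have := insd_compl H; rewrite setCK negbK.
Qed.

Lemma cross_free_compl X n Y m : cross_free X n Y m -> cross_free (~: X) (~~ n) Y m.
Proof.
case=> H; [constructor 4|constructor 3|constructor 2|by constructor 1].
- by rewrite setCK negbK.
- exact: insd_compl H.
- by have := insd_compl H; rewrite setCK negbK.
Qed.

Lemma moat_cut X n q : q \in moat F X n ->
  exists x y, [/\ q.1 \in F, x \in q.1, y \in q.1, x \in X & y \notin X].
Proof.
case: q => t o /=.
have [tF|tF] := boolP (t \in F); last first.
  by rewrite in_setD /tot; case: n; rewrite !inE /= (negPf tF) ?andbF.
have [X0|/card_gt0P[x]] := posnP #|t :&: X|.
  rewrite in_setD => /andP[_]; rewrite /tot.
  have nX c : c \in t -> (c \in X) = false.
    move=> ct; apply/negP=> cX; have : 0 < #|t :&: X| by apply/card_gt0P; exists c; rewrite inE ct.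
    by rewrite X0.
  case: n; rewrite !inE /= X0 ?andbF; case: o => [c|]; rewrite ?andbF ?andbT //.
  by case: (boolP (c \in t)) => [/nX->|]; rewrite ?andbF.
rewrite inE => /andP[xt xX].
have [tX|/subsetPn[y yt yX]] := boolP (t \subset X); last by exists x, y.
rewrite in_setD => /andP[ni ti]; case/negP: ni; rewrite /ins.
have E3 : #|t :&: X| = 3 by apply/eqP; rewrite (card3_sub PT).
have oc : (if o is Some c then c \in t else true).
  by move: ti; rewrite /tot; case: o => // c; case: n; rewrite inE /= => /and3P[].
by case: n {ti}; rewrite !inE /= tF E3; case: o oc => // c ct; rewrite ?(subsetP tX) ?ct.
Qed.

Variables (I : finType) (D : I -> {set V}) (nr : I -> bool).
Hypothesis Dconn : forall s, conn F (D s).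
Hypothesis Dodd : forall s, odd (pcnt F (D s)).
Hypothesis Dlam : forall s t, s != t -> [\/ insd F (D s) (nr s) (D t) (nr t),
  insd F (D t) (nr t) (D s) (nr s) | insd F (D s) (nr s) (~: D t) (~~ nr t)].

Definition oddc s := odflt set0 [pick K in comps F (~: D s) | odd (pcnt F K)].

Lemma oddcP s : oddc s \in comps F (~: D s) /\ odd (pcnt F (oddc s)).
Proof.
rewrite /oddc; case: pickP => [K /andP[]//|H].
have : odd (pcnt F (~: D s)).
  by have := congr1 odd (pcntC PT D56 (D s)); rewrite oddD Dodd; case: (odd _).
rewrite pcnt_comps; suff -> : odd (\sum_(K in comps F (~: D s)) pcnt F K) = false by [].
apply: (big_ind (fun n => odd n = false)) => // [x y Ex Ey|K KD]; first by rewrite oddD Ex Ey.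
by have := H K; rewrite KD.
Qed.

Let K_in s : oddc s \in comps F (~: D s). Proof. by case: (oddcP s). Qed.
Let K_sub s x : x \in oddc s -> x \notin D s.
Proof. by move/(subsetP (comps_sub (K_in s))); rewrite inE. Qed.
Let K_conn s : conn F (oddc s). Proof. exact: comps_conn (K_in s). Qed.
Let K_clos s x y : y \in oddc s -> x \notin D s -> tri_adj F x y -> x \in oddc s.
Proof. by move=> yK xD xy; apply: (comps_closed (K_in s) yK); rewrite ?inE // adj_sym. Qed.
Let K_max s (X : {set V}) x : conn F X -> X \subset ~: D s -> x \in X -> x \in oddc s ->
  X \subset oddc s.
Proof. by move=> cX sX xX xK; apply: conn_comps (K_in s) xX xK. Qed.
Let D_ex s : exists x, x \in D s.
Proof.
have : 0 < pcnt F (D s) by case: (pcnt F (D s)) (Dodd s).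
by case/card_gt0P=> x; rewrite inE => /andP[]; exists x.
Qed.

Let comp_adj s C : C \in comps F (~: D s) -> exists p q, [/\ p \in C, q \in D s & tri_adj F p q].
Proof.
move=> CD; have [u uC] := comps_ex CD; have [w wD] := D_ex s.
have wC : w \notin C by apply: contraL wD => /(subsetP (comps_sub CD)); rewrite inE.
have [p [q [_ pC _ qC pq]]] := conn_exit (conn_setT PT) (in_setT u) uC (in_setT w) wC.
exists p, q; split=> //; apply: contraNT qC => qD.
by apply: (comps_closed CD pC); rewrite ?inE.
Qed.

Let KD_conn s : conn F (oddc s :|: D s).
Proof.
have [p [q [pK qD pq]]] := comp_adj (K_in s).
exact: (conn_setU (@K_conn s) (@Dconn s) pK qD pq).
Qed.

(** The set consists of [D s] and the remaining components of its complement, each of which touches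
    [D s]. *)
Lemma fill_conn s : conn F (~: oddc s).
Proof.
have [w wD] := D_ex s.
have DL : D s \subset ~: oddc s by apply/subsetP=> x xD; rewrite inE; apply: contraL xD => /K_sub.
apply: (conn_star (subsetP DL _ wD)) => u; rewrite inE => uK.
have [uD|uD] := boolP (u \in D s); first by exists (D s).
have uD' : u \in ~: D s by rewrite inE.
have [p [q [pC qD pq]]] := comp_adj (comp_in F uD').
exists (comp F (~: D s) u :|: D s); split.
- exact: (conn_setU (comp_conn uD') (@Dconn s) pC qD pq).
- rewrite subUset DL andbT; apply/subsetP=> z zC; rewrite inE.
  apply: contraNN uK => zK; rewrite (comps_uniq (K_in s) zK) (comp_eq zC).
  exact: comp_self.
- by rewrite in_setU comp_self.
- by rewrite in_setU wD orbT.
Qed.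

Let L s := ~: oddc s.
(** Filling the other components creates no new cut edges: every edge into the odd component starts
    in [D s]. *)
Let L_D s x y : x \in L s -> y \in oddc s -> tri_adj F x y -> x \in D s.
Proof. by rewrite inE => xK yK xy; apply: contraNT xK => xD; apply: K_clos yK xD xy. Qed.

(** The odd component of [t] avoids [D s]. If it meets the odd component of [s], it lies in it and
    the filled sets are nested; if not, the two filled sets cover everything. *)
Let cf_inside s t : insd F (D s) (nr s) (D t) (nr t) -> cross_free (L s) (nr s) (L t) (nr t).
Proof.
case=> sD H; have sub : oddc t \subset ~: D s.
  by apply/subsetP=> x /K_sub xD; rewrite inE; apply: contraNN xD => /(subsetP sD).
have [z /andP[zt zs]|H0] := pickP (fun z => (z \in oddc t) && (z \in oddc s)).
  have sK := K_max (@K_conn t) sub zt zs; constructor 1; split; first by rewrite setCS.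
  move=> x y xL; rewrite inE negbK => yK xy; apply: (H x y) => //; last exact: K_sub.
  by apply: L_D xL _ xy; apply: (subsetP sK).
constructor 4.
have -> : ~: L s = oddc s by rewrite setCK.
split; first by apply/subsetP=> x xs; rewrite inE; apply/negP=> xt; have := H0 x; rewrite xs xt.
move=> x y xs; rewrite inE negbK => yt xy; have := H0 y; rewrite yt /=.
suff -> : y \in oddc s by [].
by apply: (K_clos xs); rewrite 1?adj_sym //; have := subsetP sub _ yt; rewrite inE.
Qed.

Let cf_c2 s t (z : V) : insd F (D s) (nr s) (~: D t) (~~ nr t) ->
  z \in D t -> z \in oddc s -> (forall x, x \in D s -> x \notin oddc t) ->
  insd F (L s) (nr s) (L t) (nr t).
Proof.
case=> sD H zt zs dis.
have sub : oddc t :|: D t \subset ~: D s.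
  apply/subsetP=> x; rewrite in_setU inE => /orP[xK|xD]; apply/negP=> xs.
    by have := dis x xs; rewrite xK.
  by have := subsetP sD _ xs; rewrite inE xD.
have zU : z \in oddc t :|: D t by rewrite in_setU zt orbT.
have := K_max (@KD_conn t) sub zU zs; rewrite subUset => /andP[sK _].
split; first by rewrite setCS.
move=> x y xL; rewrite inE negbK => yt xy; have xs := L_D xL (subsetP sK _ yt) xy.
have := dis x xs; suff -> : x \in oddc t by [].
by apply: (K_clos yt _ xy); have := subsetP sD _ xs; rewrite inE.
Qed.

Let dsym s t : insd F (D s) (nr s) (~: D t) (~~ nr t) -> insd F (D t) (nr t) (~: D s) (~~ nr s).
Proof. by move=> H; have := insd_compl H; rewrite setCK negbK. Qed.

(** Four cases, according to whether each of the two sets meets the odd component of the other;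
    meeting it means lying in it. *)
Let cf_apart s t : insd F (D s) (nr s) (~: D t) (~~ nr t) -> cross_free (L s) (nr s) (L t) (nr t).
Proof.
move=> H; have [sD HD] := H.
have Dsub (a b : I) z : D b \subset ~: D a -> z \in D b -> z \in oddc a -> D b \subset oddc a.
  by move=> sb zb za; apply: (K_max (@Dconn b) sb zb za).
have sD' : D t \subset ~: D s by rewrite subsetC.
have [z /andP[zt zs]|H0] := pickP (fun z => (z \in D t) && (z \in oddc s));
have [z' /andP[zs' zt']|H1] := pickP (fun z => (z \in D s) && (z \in oddc t)).
- have st := Dsub s t z sD' zt zs; have ts := Dsub t s z' sD zs' zt'.
  have LL (a b : I) : D b \subset oddc a -> D a \subset oddc b -> L a \subset oddc b.
    move=> ba ab; have [w wa] := D_ex a.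
    apply: (K_max (@fill_conn a) _ _ (subsetP ab _ wa)); first by rewrite setCS.
    by rewrite inE; apply: contraL wa => /K_sub.
  constructor 3; split; first by rewrite setCK; apply: LL.
  move=> x y xL; rewrite setCK => yK xy; have yL : y \in L t by rewrite inE.
  have xs : x \in D s by apply: L_D xL _ xy; apply: (subsetP (LL t s ts st)).
  have yt : y \in D t.
    by apply: (L_D yL _ (etrans (adj_sym F y x) xy)); apply: (subsetP (LL s t st ts)).
  by apply: (HD x y) => //; rewrite inE yt.
- constructor 1; apply: cf_c2 H zt zs _ => x xs; apply/negP=> xt.
  by have := H1 x; rewrite xs xt.
- constructor 2; apply: cf_c2 (dsym H) zs' zt' _ => x xs; apply/negP=> xt.
  by have := H0 x; rewrite xs xt.
- constructor 4; rewrite setCK.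
  have key x : x \in oddc s -> x \notin oddc t.
    move=> xs; apply/negP=> xt.
    have sub : oddc s :|: D s \subset ~: D t.
      apply/subsetP=> u; rewrite in_setU => /orP[us|/(subsetP sD)//].
      by rewrite inE; apply/negP=> ut; have := H0 u; rewrite us ut.
    have xU : x \in oddc s :|: D s by rewrite in_setU xs.
    have := K_max (@KD_conn s) sub xU xt; rewrite subUset => /andP[_ sDt].
    by have [w ws] := D_ex s; have := H1 w; rewrite ws (subsetP sDt).
  split; first by apply/subsetP=> x /key; rewrite inE.
  move=> x y xs; rewrite inE negbK => yt xy; have := key x xs; suff -> : x \in oddc t by [].
  by apply: (K_clos yt _ xy); apply/negP=> xt; have := H0 x; rewrite xs xt.
Qed.

Let cf s t : s != t -> cross_free (L s) (nr s) (L t) (nr t).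
Proof.
by case/Dlam=> H; [apply: cf_inside|apply: cross_free_sym; apply: cf_inside|apply: cf_apart].
Qed.

(** The smaller side by number of vertices of degree 5. Complementing flips the flag, because a
    midpoint left out of one side belongs to the other. *)
Definition side s := if 5 < pcnt F (~: oddc s) then oddc s else ~: oddc s.
Definition snr s := if 5 < pcnt F (~: oddc s) then ~~ nr s else nr s.

Lemma side_conn s : conn F (side s).
Proof. by rewrite /side; case: ifP => _; [apply: K_conn|apply: fill_conn]. Qed.
Lemma side_coconn s : conn F (~: side s).
Proof. by rewrite /side; case: ifP => _; rewrite ?setCK; [apply: fill_conn|apply: K_conn]. Qed.
Lemma side_pcnt s : 0 < pcnt F (side s) <= 5.
Proof.
have := pcntC PT D56 (oddc s); have [_ o] := oddcP s; rewrite /side.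
have : odd (pcnt F (~: oddc s)).
  by have := congr1 odd (pcntC PT D56 (oddc s)); rewrite oddD o; case: (odd _).
by case: ifP => h; move: (pcnt F _) (pcnt F _) h o => a b; lia.
Qed.

(** The fourth case of [cross_free] would put at least 7 vertices of degree 5 into a side that has
    at most 5. *)
Lemma side_lam s t : s != t -> [\/ insd F (side s) (snr s) (side t) (snr t),
  insd F (side t) (snr t) (side s) (snr s) | insd F (side s) (snr s) (~: side t) (~~ snr t)].
Proof.
move=> st; have : cross_free (side s) (snr s) (side t) (snr t).
  have := cf st; rewrite /side /snr /L.
  case: ifP => _ H; last first.
    case: ifP => _ //; apply: cross_free_sym; rewrite -[oddc t]setCK; apply: cross_free_compl.
    exact: cross_free_sym.
  have := cross_free_compl H; rewrite setCK => {}H.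
  case: ifP => _ //; apply: cross_free_sym; rewrite -[oddc t]setCK; apply: cross_free_compl.
  exact: cross_free_sym.
case=> H; [by constructor 1|by constructor 2|by constructor 3|].
have [sub _] := H; have := pcntS F sub; have := pcntC PT D56 (side s).
by have /andP[_] := side_pcnt s; have /andP[_] := side_pcnt t; lia.
Qed.

Definition touched := [set t in F | [exists s, ~~ [disjoint t & D s]]].

(** A small triangle of a moat lies in a face cut by the odd component; a cut edge of this face has
    an end in [D s], by [L_D]. Each face has four small triangles. *)
Lemma cupm_touched : #|cupm F side snr setT| <= 4 * #|touched|.
Proof.
have E : #|subfaces touched predT predT predT (set0 : {set V})| = 4 * #|touched|.
  rewrite card_subfaces (eq_bigr (fun=> 4)) => [|t]; first by rewrite sum_nat_const mulnC.
  rewrite inE => /andP[tF _]; have -> : [set c in t | predT (c \in set0) && predT #|t :&: set0|] = t.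
    by apply/setP=> c; rewrite inE /= andbT.
  by rewrite (card_face PT tF).
rewrite -E subset_leq_card //; apply/bigcupsP=> s _; apply/subsetP=> q qm.
have [x [y [qF xq yq xS yS]]] := moat_cut qm; rewrite inE; apply/andP; split; last first.
  case: q qm {qF xq yq} => t [c|] //= /setDP[+ _]; rewrite /tot.
  by case: (snr s); rewrite inE /= => /and3P[_ -> _].
rewrite inE qF; apply/existsP; exists s.
have nxy : x != y by apply: contraNneq yS => <-.
have xy := face_in_adj PT qF xq yq nxy.
suff [z zq zD] : exists2 z, z \in q.1 & z \in D s.
  by apply/negP=> /pred0P/(_ z); rewrite /= zq zD.
move: xS yS; rewrite /side; case: ifP => _ xS yS.
  by exists y => //; apply: (L_D _ xS); rewrite 1?adj_sym // inE.
by exists x => //; apply: (L_D xS _ xy); move: yS; rewrite inE negbK.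
Qed.

(** The factor 48 is 12 vertices of degree 5 times 4 small triangles for each face. *)
Lemma packing_ineq : 5 * #|I| ^ 2 <= 48 * #|touched|.
Proof.
have [H _] := moat_ineq PT D56 side_conn side_coconn side_pcnt side_lam setT.
rewrite cardsT in H; apply: leq_trans H _.
have := pcntS F (subsetT (cup side setT)); rewrite (pcnt_total PT D56) => p12.
by rewrite (_ : 48 = 12 * 4) // -mulnA leq_mul // cupm_touched.
Qed.

(** Equality leaves no slack anywhere: the sides together hold all 12 vertices, the moats fill all
    faces, and [moat_ineq] is an equality. *)
Lemma packing_tight : 5 * #|I| ^ 2 = 48 * #|F| ->
  (forall s, pcnt F (side s) = 1) /\
  (forall t, t \in pent F -> 12 * #|[set s | t \in side s]| = #|I|).
Proof.
move=> Eq; have [H1 H2] := moat_ineq PT D56 side_conn side_coconn side_pcnt side_lam setT.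
rewrite cardsT in H1 H2.
have := pcntS F (subsetT (cup side setT)); rewrite (pcnt_total PT D56) => p12.
have cm := cupm_touched.
have tF : #|touched| <= #|F| by apply: subset_leq_card; apply/subsetP=> t; rewrite inE => /andP[].
have F0 : 0 < #|F|.
  have /card_gt0P[v _] : 0 < #|pent F| by rewrite (card_pent PT D56).
  by have [a [b f]] := vertex_face PT v; apply/card_gt0P; exists [set v; a; b].
have [EP EQ] : pcnt F (cup side setT) = 12 /\ #|cupm F side snr setT| = 4 * #|F|.
  move: H1 p12 cm tF F0; rewrite Eq; move: (pcnt F _) #|cupm F _ _ _| #|touched| #|F| => p q t f; nia.
have [|A B] := H2; first by rewrite Eq EP EQ; lia.
split=> [s|t tT]; first exact: A.
rewrite -EP -[RHS](B t).
  by congr (_ * _); apply: eq_card => s; rewrite !inE.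
suff -> : cup side setT :&: pent F = pent F by [].
by apply/eqP; rewrite eqEcard subsetIr (card_pent PT D56) -/(pcnt F _) EP.
Qed.

Lemma packing_eq : 5 * #|I| ^ 2 = 48 * #|F| -> exists (S : I -> {set V}) (n : I -> bool),
  [/\ forall s, pcnt F (S s) = 1,
      forall s t, s != t -> [\/ insd F (S s) (n s) (S t) (n t),
         insd F (S t) (n t) (S s) (n s) | insd F (S s) (n s) (~: S t) (~~ n t)] &
      forall t, t \in pent F -> 12 * #|[set s | t \in S s]| = #|I|].
Proof.
by move=> /packing_tight[A B]; exists side, snr; split=> //; apply: side_lam.
Qed.

Lemma packing_comp s : 5 * #|I| ^ 2 = 48 * #|F| ->
  exists2 K, K \in comps F (~: D s) & pcnt F K = 1 \/ pcnt F (~: K) = 1.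
Proof.
move=> /packing_tight[/(_ s)A _]; exists (oddc s); first by have [] := oddcP s.
by move: A; rewrite /side; case: ifP; [left|right].
Qed.

End Filling.

(** * Potentials of T-joins *)

Section SymDiff.
Variable T : finType.
(** Locked so that [inE] does not unfold it; membership is computed by [in_sd]. *)
Definition sd (A B : {set T}) := locked ((A :\: B) :|: (B :\: A)).

Lemma in_sd A B x : (x \in sd A B) = (x \in A) (+) (x \in B).
Proof. by rewrite /sd -lock !inE; case: (x \in A); case: (x \in B). Qed.

Lemma card_sd A B : #|sd A B| + 2 * #|A :&: B| = #|A| + #|B|.
Proof.
rewrite /sd -lock cardsU (_ : _ :&: _ = set0) ?cards0 ?subn0; last first.
  by apply/setP=> x; rewrite !inE; case: (x \in A); case: (x \in B).
by rewrite -(cardsID B A) -(cardsID A B) [B :&: A]setIC; lia.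
Qed.

Lemma odd_sd A B : odd #|sd A B| = odd #|A| (+) odd #|B|.
Proof. by have := congr1 odd (card_sd A B); rewrite oddD oddM /= addbF oddD. Qed.

Lemma sdI A B C : sd A B :&: C = sd (A :&: C) (B :&: C).
Proof. by apply/setP=> x; rewrite in_sd !in_setI in_sd; case: (x \in C); rewrite ?andbF ?andbT. Qed.

Lemma odd_set1I x (C : {set T}) : odd #|[set x] :&: C| = (x \in C).
Proof.
case: (boolP (x \in C)) => xC.
  by rewrite (setIidPl _) ?cards1 // sub1set.
by rewrite (_ : _ :&: _ = set0) ?cards0 //; apply/eqP; rewrite setI_eq0 disjoints1.
Qed.

Lemma odd_sum (A : {set T}) (f : T -> nat) :
  odd (\sum_(i in A) f i) = odd #|[set i in A | odd (f i)]|.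
Proof.
rewrite -sum1_card !(big_morph odd oddD (erefl : odd 0 = false)) big_mkcond [RHS]big_mkcond.
by apply: eq_bigr => i _; rewrite inE; case: (i \in A); case: (odd (f i)).
Qed.

End SymDiff.

(** * Joins, cuts and optimal potentials *)

Section Joins.
Variables (V : finType) (E : {set {set V}}).
Hypothesis E2 : forall e, e \in E -> exists x y, x != y /\ e = [set x; y].

Definition bd (J : {set {set V}}) := [set v | odd (jdeg J v)].
Definition len (l : {set V} -> nat) (J : {set {set V}}) := \sum_(e in J) l e.
Definition crs (X : {set V}) (J : {set {set V}}) := [set e in J | #|e :&: X| == 1].

Lemma bd_sd J K : bd (sd J K) = sd (bd J) (bd K).
Proof.
apply/setP=> v; rewrite in_sd !inE /jdeg -odd_sd; congr (odd #|pred_of_set _|).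
by apply/setP=> e; rewrite [RHS]in_sd ![in RHS]inE [LHS]inE in_sd; case: (v \in e); rewrite ?andbT ?andbF.
Qed.

Lemma bd_set1 x y : x != y -> bd [set [set x; y]] = sd [set x] [set y].
Proof.
move=> nxy; apply/setP=> v; rewrite in_sd !inE /jdeg.
have -> : [set e in [set [set x; y]] | v \in e] = if v \in [set x; y] then [set [set x; y]] else set0.
  apply/setP=> e; rewrite inE in_set1; case: (e =P [set x; y]) => [->|ne] /=.
    by case: ifP => h; rewrite ?in_set1 ?in_set0 ?eqxx.
  by case: ifP => _; rewrite ?in_set1 ?in_set0 //; apply/esym/eqP.
rewrite !inE; case: (v =P x) => [->|_]; first by rewrite /= cards1 (negPf nxy).
by case: (v =P y) => _ /=; rewrite ?cards1 ?cards0.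
Qed.

Lemma bd_set0 : bd set0 = set0.
Proof.
by apply/setP=> v; rewrite !inE /jdeg eq_card0 // => e; rewrite !inE.
Qed.

Lemma len_mem l J : len l J = \sum_e (e \in J) * l e.
Proof. by rewrite /len big_mkcond; apply: eq_bigr => e _; case: (e \in J); rewrite ?mul1n. Qed.

Lemma len_sd_le l J K : len l (sd J K) <= len l J + len l K.
Proof.
rewrite !len_mem -big_split leq_sum // => e _; rewrite in_sd /=.
by case: (e \in J); case: (e \in K); rewrite /= ?mul1n ?mul0n ?addn0 ?leq_addr.
Qed.

Lemma len_sub l (J K : {set {set V}}) : J \subset K -> len l J <= len l K.
Proof.
move=> sJK; rewrite !len_mem leq_sum // => e _; case: (boolP (e \in J)) => // eJ.
by rewrite (subsetP sJK).
Qed.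

Lemma len_exchange l (J Q C : {set {set V}}) : C \subset sd J Q ->
  len l J + len l Q = len l (sd J C) + len l (sd Q C).
Proof.
move=> sC; rewrite !len_mem -!big_split; apply: eq_bigr => e _; rewrite !in_sd /=.
have := subsetP sC e; rewrite in_sd.
by case: (e \in C) => [/(_ isT)|_]; case: (e \in J); case: (e \in Q) => //=; rewrite ?mul1n ?mul0n ?addn0.
Qed.

Lemma sd_sub (J K L : {set {set V}}) : J \subset L -> K \subset L -> sd J K \subset L.
Proof.
move=> sJ sK; apply/subsetP=> e; rewrite in_sd.
by case: (boolP (e \in J)) => [/(subsetP sJ)//|_] /= /(subsetP sK).
Qed.

Lemma edgeI (J : {set {set V}}) (X : {set V}) e : J \subset E -> e \in J -> #|e :&: X| < 3.
Proof.
move=> sJ eJ; have [x [y [nxy ->]]] := E2 (subsetP sJ _ eJ).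
by rewrite ltnS -[2]/(true.+1) -nxy -cards2 subset_leq_card // subsetIl.
Qed.

Lemma sum_jdeg (J : {set {set V}}) (g : V -> nat) (X : {set V}) : J \subset E ->
  \sum_(v in X) jdeg J v * g v = \sum_(e in J) \sum_(v in e :&: X) g v.
Proof.
move=> sJ; rewrite (eq_bigr (fun v => \sum_(e in J | v \in e) g v)) => [|v _].
  rewrite (exchange_big_dep (mem J)) /=; last by move=> ? ? _ /andP[].
  by apply: eq_bigr => e eJ; apply: eq_bigl => v; rewrite inE eJ andbC.
rewrite sum_nat_const; congr (_ * _); apply: eq_card => e.
by rewrite inE.
Qed.

(** Handshake modulo 2: in the sum of the degrees over [X], an edge inside [X] is counted twice. *)
Lemma odd_crs (J : {set {set V}}) (X : {set V}) : J \subset E -> odd #|bd J :&: X| = odd #|crs X J|.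
Proof.
move=> sJ; have -> : bd J :&: X = [set v in X | odd (jdeg J v)].
  by apply/setP=> v; rewrite !inE andbC.
rewrite -odd_sum; have := sum_jdeg (fun=> 1) X sJ.
rewrite (eq_bigr (jdeg J)) => [|v _]; last by rewrite muln1.
move=> ->; rewrite (eq_bigr (fun e => #|e :&: X|)) => [|e _]; last by rewrite sum1_card.
rewrite odd_sum; congr (odd #|pred_of_set _|); apply/setP=> e; rewrite !inE.
case: (boolP (e \in J)) => //= eJ; have := edgeI X sJ eJ.
by case: #|e :&: X| => [|[|[]]].
Qed.

Lemma crsC (J : {set {set V}}) (X : {set V}) : J \subset E -> crs (~: X) J = crs X J.
Proof.
move=> sJ; apply/setP=> e; rewrite !inE; case: (boolP (e \in J)) => //= eJ.
have [x [y [nxy Ee]]] := E2 (subsetP sJ _ eJ).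
have := cardsID X e; rewrite setDE {3}Ee cards2 nxy => H.
by apply/eqP/eqP; lia.
Qed.

Lemma crsE (J : {set {set V}}) (X : {set V}) e : J \subset E -> e \in crs X J ->
  exists x y, [/\ e = [set x; y], x \in X, y \notin X, x != y & e \in J].
Proof.
move=> sJ; rewrite inE => /andP[eJ c1]; have [x [y [nxy Ee]]] := E2 (subsetP sJ _ eJ).
have key : (x \in X) (+) (y \in X).
  move: c1; rewrite Ee setIUl cardsU.
  have -> : [set x] :&: X :&: ([set y] :&: X) = set0.
    by apply/setP=> z; rewrite !inE; case: eqP => [->|//]; rewrite (negPf nxy) !andbF.
  rewrite cards0 subn0 => c1.
  have H z : #|[set z] :&: X| = (z \in X) :> nat.
    case: (boolP (z \in X)) => zX; first by rewrite (setIidPl _) ?cards1 // sub1set.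
    by rewrite (_ : _ :&: _ = set0) ?cards0 //; apply/eqP; rewrite setI_eq0 disjoints1.
  by move: c1; rewrite !H; case: (x \in X); case: (y \in X).
have [xX|xX] := boolP (x \in X); rewrite ?(negPf xX) ?xX /= in key.
  by exists x, y.
by exists y, x; rewrite setUC eq_sym; split=> //; rewrite ?negbK // xX.
Qed.

Lemma mem_crs (J : {set {set V}}) (X : {set V}) x y : [set x; y] \in J -> x \in X -> y \notin X -> [set x; y] \in crs X J.
Proof.
move=> eJ xX yX; rewrite inE eJ /= (_ : _ :&: _ = [set x]) ?cards1 //.
apply/setP=> z; rewrite !inE; case: (z =P x) => [->|_] //=.
by case: (z =P y) => [->|_]; rewrite ?(negPf yX).
Qed.

Lemma even_bd (J : {set {set V}}) : J \subset E -> ~~ odd #|bd J|.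
Proof.
move=> sJ; rewrite -[bd J]setIT (odd_crs _ sJ) (_ : crs _ _ = set0) ?cards0 //.
apply/setP=> e; rewrite [RHS]inE; apply/negP=> /(crsE sJ)[x [y [_ _]]].
by rewrite inE.
Qed.

Lemma path_join (r : rel V) (E' : {set {set V}}) u v :
  (forall x y, r x y -> [set x; y] \in E' /\ x != y) -> connect r u v ->
  exists2 P : {set {set V}}, P \subset E' & bd P = sd [set u] [set v].
Proof.
move=> H /connectP[p]; elim: p u => [|c p IH] u /= => [_ ->|/andP[uc pp] Ev].
  by exists set0; rewrite ?sub0set // bd_set0; apply/setP=> z; rewrite in_sd !inE addbb.
have [P sP bP] := IH c pp Ev; have [eE nuc] := H u c uc.
exists (sd [set [set u; c]] P); first by apply: sd_sub => //; rewrite sub1set.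
rewrite bd_sd bd_set1 // bP; apply/setP=> z; rewrite !in_sd.
by case: (z \in _); case: (z \in _); case: (z \in _).
Qed.

(** An even set is joined up pair by pair. The predicate [P] allows the use for joins of length 0 as
    well as for all joins. *)
Lemma even_join (P : {set {set V}} -> Prop) (D : {set V}) :
  P set0 -> (forall J K, P J -> P K -> P (sd J K)) ->
  (forall u v, u \in D -> v \in D -> exists2 Z, P Z & bd Z = sd [set u] [set v]) ->
  forall A : {set V}, A \subset D -> ~~ odd #|A| -> exists2 Z, P Z & bd Z = A.
Proof.
move=> P0 Psd PD A; have [n] := ubnP #|A|; elim: n A => // n IH A cA sA oA.
have [->|/set0Pn[u uA]] := eqVneq A set0; first by exists set0; rewrite ?bd_set0.
have cu := cardsD1 u A; rewrite uA in cu.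
have /set0Pn[v vA] : A :\ u != set0.
  by apply: contraNneq oA => E0; rewrite cu E0 cards0.
have cv := cardsD1 v (A :\ u); rewrite vA in cv.
have [|||Z PZ bZ] := IH (A :\ u :\ v).
- by move: cA; rewrite cu cv; lia.
- by apply: subset_trans sA; apply: subset_trans (subsetDl _ _) (subsetDl _ _).
- by move: oA; rewrite cu cv !oddD /= negbK.
have vA' : v \in A by move: vA; rewrite !inE => /andP[].
have [Y PY bY] := PD u v (subsetP sA _ uA) (subsetP sA _ vA').
exists (sd Z Y); first exact: Psd.
rewrite bd_sd bZ bY; apply/setP=> z; rewrite !in_sd !inE.
move: vA; rewrite !inE => /andP[nvu _].
case: (z =P v) => [->|_] /=; first by rewrite vA' (negPf nvu).
by case: (z =P u) => [->|_] /=; rewrite ?uA ?addbF.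
Qed.

Variables (T : {set V}) (x0 : V).
Definition tgt (x : V) := sd T (sd [set x0] [set x]).

Definition opt (l : {set V} -> nat) (lam : V -> nat) := forall x,
  (exists J : {set {set V}}, [/\ J \subset E, bd J = tgt x & len l J = lam x]) /\
  (forall J : {set {set V}}, J \subset E -> bd J = tgt x -> lam x <= len l J).

(** * Contraction of one component of the lowest level *)

Section Step.
Variables (l l' : {set V} -> nat) (lam lam' : V -> nat) (D : {set V}) (m : nat) (b : V).
Hypothesis opt_l : opt l lam.
Hypothesis bD : b \in D.
Hypothesis lamD : forall x, x \in D -> lam x = m.
Hypothesis lam_min : forall x, m <= lam x.
Hypothesis zero_conn : forall u v, u \in D -> v \in D ->
  exists2 Z : {set {set V}}, (Z \subset E) /\ len l Z = 0 & bd Z = sd [set u] [set v].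
Hypothesis parity : forall x y, [set x; y] \in E -> odd (l [set x; y]) = odd (lam x + lam y).
Hypothesis cut_pos : forall e, e \in crs D E -> 0 < l e.

Let zj (Z : {set {set V}}) := (Z \subset E) /\ len l Z = 0.
Let zj_sd Z Y : zj Z -> zj Y -> zj (sd Z Y).
Proof.
move=> [sZ lZ] [sY lY]; split; first exact: sd_sub.
by apply/eqP; rewrite -leqn0 (leq_trans (len_sd_le _ _ _)) // lZ lY.
Qed.

Let zj_crs Z : zj Z -> crs D Z = set0.
Proof.
case=> sZ lZ; apply/setP=> e; rewrite [RHS]inE; apply/negP=> ec.
have eZ : e \in Z by move: ec; rewrite inE => /andP[].
have eE : e \in crs D E by move: ec; rewrite !inE => /andP[/(subsetP sZ)-> ->].
have := cut_pos eE; rewrite ltnNge; case/negP.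
by move: lZ; rewrite /len (big_setD1 e eZ) /=; lia.
Qed.

(** If an optimal join for [c] used the cut edge [x y], dropping this edge and passing from [c] to
    [x] at length 0 would give a join for [y] of length below the minimum [m]. *)
Let opt_nocross (Q : {set {set V}}) c : c \in D -> Q \subset E -> bd Q = tgt c -> len l Q = m -> crs D Q = set0.
Proof.
move=> cD sQ bQ lQ; apply/setP=> e; rewrite [RHS]inE; apply/negP=> ec.
have [x [y [Ee xD yD nxy eQ]]] := crsE sQ ec.
have [Z [sZ lZ] bZ] := zero_conn cD xD.
have eE : e \in crs D E by move: ec; rewrite !inE => /andP[/(subsetP sQ)-> ->].
have le := cut_pos eE.
have bW : bd (sd (sd Q [set e]) Z) = tgt y.
  rewrite !bd_sd bQ bZ Ee bd_set1 //; apply/setP=> z; rewrite !in_sd.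
  by case: (z \in T); case: (z \in [set x0]); case: (z \in [set x]); case: (z \in [set y]); case: (z \in [set c]).
have sW : sd (sd Q [set e]) Z \subset E.
  by rewrite !sd_sub // sub1set (subsetP sQ).
have [_ /(_ _ sW bW) H] := opt_l y.
have H1 := len_sd_le l (sd Q [set e]) Z.
have H2 : len l (sd Q [set e]) + l e = m.
  rewrite -lQ /len (big_setD1 e eQ) /= addnC; congr (_ + _); apply: eq_bigl => z.
  by rewrite in_sd !inE; case: (z =P e) => [->|_]; rewrite ?eQ ?addbF.
by move: (lam_min y) H H1 H2 le; rewrite lZ; clear; lia.
Qed.

Let Qb : exists Q : {set {set V}}, [/\ Q \subset E, bd Q = tgt b, len l Q = m & crs D Q = set0].
Proof.
have [[Q [sQ bQ lQ]] _] := opt_l b; rewrite lamD // in lQ.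
by exists Q; split=> //; apply: opt_nocross bD sQ bQ lQ.
Qed.

Let odd_tgt x (X : {set V}) : odd #|tgt x :&: X| = odd #|tgt b :&: X| (+) (x \in X) (+) (b \in X).
Proof.
rewrite -!odd_set1I -!odd_sd; congr (odd #|pred_of_set _|); apply/setP=> z.
by rewrite !in_sd !in_setI !in_sd; case: (z \in T); case: (z \in [set x0]);
  case: (z \in [set x]); case: (z \in [set b]); case: (z \in X).
Qed.

(** An optimal join for [b] does not cross the cut of [D], so its boundary [tgt b] meets [D] in an
    even set. *)
Lemma step_odd : odd #|T :&: D| = (x0 \notin D).
Proof.
have [Q [sQ bQ _ cQ]] := Qb; have := odd_crs D sQ; rewrite cQ cards0 bQ /tgt !sdI !odd_sd !odd_set1I bD.
by case: (odd _); case: (x0 \in D).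
Qed.

Let parityT x : odd #|tgt x :&: ~: D| = (x \notin D).
Proof.
have [Q [sQ bQ _ cQ]] := Qb; rewrite odd_tgt -bQ (odd_crs _ sQ) crsC // cQ cards0 !inE bD.
by rewrite addbF.
Qed.

Let even_tgt x : ~~ odd #|tgt x|.
Proof.
have [Q [sQ bQ _ _]] := Qb; rewrite -[tgt x]setIT odd_tgt !inE setIT -bQ (negPf (even_bd sQ)) //.
Qed.

Let fix_join (J : {set {set V}}) x : J \subset E -> sd (bd J) (tgt x) \subset D ->
  exists2 Z, zj Z & bd (sd J Z) = tgt x.
Proof.
move=> sJ sD; have [||Z zZ bZ] := @even_join zj D _ zj_sd zero_conn _ sD.
- by split; rewrite ?sub0set // /len big_set0.
- by rewrite odd_sd (negPf (even_bd sJ)) (negPf (even_tgt x)).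
exists Z => //; rewrite bd_sd bZ; apply/setP=> z; rewrite !in_sd.
by case: (z \in bd J); case: (z \in T); case: (z \in [set x0]); case: (z \in [set x]).
Qed.

(** Modulo 2 the length of a join is the sum of [lam] over its boundary, by [parity]. *)
Let parity_len (J J' : {set {set V}}) : J \subset E -> J' \subset E -> bd J = bd J' -> odd (len l J) = odd (len l J').
Proof.
move=> sJ sJ' eb.
have key (K : {set {set V}}) : K \subset E -> odd (len l K) = \big[addb/false]_v ((v \in bd K) && odd (lam v)).
  move=> sK; transitivity (odd (\sum_(v in [set: V]) jdeg K v * lam v)).
    rewrite sum_jdeg // /len !(big_morph odd oddD (erefl : odd 0 = false)).
    apply: eq_bigr => e eK; have [x [y [nxy Ee]]] := E2 (subsetP sK _ eK).
    rewrite Ee parity -?Ee ?(subsetP sK) // setIT Ee.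
    by rewrite big_setU1 ?inE //= big_set1.
  rewrite (big_morph odd oddD (erefl : odd 0 = false)).
  by apply: eq_big => v; rewrite ?inE // oddM.
by rewrite !key // eb.
Qed.

(** Each pair of crossings of [D] costs two units. If [J] crosses at least twice, some piece [C] of
    [J + Q'] outside [D] connects two crossings. Exchanging [C] frees [J] of both, while [Q']
    becomes longer by at least 2, and the total length is unchanged. *)
Let claim n (J : {set {set V}}) x : #|crs D J| <= n -> J \subset E -> (forall e, e \in J -> ~~ (e \subset D)) ->
  sd (bd J) (tgt x) \subset D -> lam x + #|crs D J| <= len l J + (x \notin D).
Proof.
elim: n J => [|n IH] J cn sJ outJ sD; last first.
  have par : odd #|crs D J| = (x \notin D).
    rewrite -parityT -crsC // -odd_crs //; congr (odd #|pred_of_set _|); apply/setP=> z; rewrite !in_setI in_setC.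
    case: (boolP (z \in D)) => zD; rewrite ?andbF ?andbT //.
    have : z \notin sd (bd J) (tgt x) by apply: contraNN zD => /(subsetP sD).
    by rewrite in_sd; case: (z \in bd J); case: (z \in tgt x).
  have [small|big] := leqP #|crs D J| 1.
    have -> : #|crs D J| = (x \notin D) by rewrite -par; case: #|crs D J| small => [|[]].
    rewrite leq_add2r; have [Z [sZ lZ] bZ] := fix_join sJ sD.
    have [_ /(_ (sd J Z)) H] := opt_l x.
    by rewrite -[len l J]addn0 -lZ (leq_trans (H _ bZ) (len_sd_le _ _ _)) // sd_sub.
  have [Q [sQ bQ lQ cQ]] := Qb.
  (* Edges inside [D] are irrelevant, as its vertices are joined at length 0; what is left of [Q]
     does not touch the cut. *)
  pose Q' := [set e in Q | ~~ (e \subset D)].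
  have sQ'Q : Q' \subset Q by apply/subsetP=> e; rewrite inE => /andP[].
  have sQ' := subset_trans sQ'Q sQ.
  have cQ' : crs D Q' = set0.
    apply/eqP; rewrite -subset0 -cQ; apply/subsetP=> e; rewrite !inE => /andP[/andP[-> _] ->//].
  have Q'D : sd (bd Q') (tgt b) \subset D.
    rewrite -bQ -bd_sd; apply/subsetP=> v; rewrite in_set /jdeg => od.
    have /card_gt0P[e] : 0 < #|[set e in sd Q' Q | v \in e]| by case: #|_| od.
    rewrite in_set in_sd in_set => /andP[].
    by case: (e \in Q) => //=; rewrite addbT negbK => /subsetP; apply.
  pose N := sd J Q'.
  have sN : N \subset E by apply: sd_sub.
  have outN e : e \in N -> ~~ (e \subset D).
    rewrite /N in_sd; case: (boolP (e \in J)) => [/outJ//|_] /=.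
    by rewrite inE => /andP[].
  have crsN : crs D N = crs D J.
    apply/setP=> e; rewrite !in_set /N in_sd; case: (boolP (#|e :&: D| == 1)) => e1; rewrite ?andbF ?andbT //.
    have : e \notin crs D Q' by rewrite cQ' inE.
    by rewrite inE e1 andbT => /negPf->; rewrite addbF.
  have bdN v : v \notin D -> (v \in bd N) = (v == x).
    move=> vD; have nb : (v == b) = false by apply: contraNF vD => /eqP->.
    have h1 : v \notin sd (bd J) (tgt x) by apply: contraNN vD => /(subsetP sD).
    have h2 : v \notin sd (bd Q') (tgt b) by apply: contraNN vD => /(subsetP Q'D).
    move: h1 h2; rewrite /N bd_sd !in_sd !in_set1 nb.
    by case: (v \in bd J); case: (v \in bd Q'); case: (v \in T); case: (v == x0); case: (v == x).
  pose r : rel V := [rel u v | [&& [set u; v] \in N, u != v, u \notin D & v \notin D]].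
  have rsym : connect_sym r.
    apply: sym_connect_sym => u v; rewrite /r /= setUC eq_sym.
    by case: (u \notin D); case: (v \notin D); rewrite ?andbF.
  pose K y := [set w | connect r y w].
  have KD y w : y \notin D -> w \in K y -> w \notin D.
    move=> yD; rewrite inE => /connectP[p]; elim: p y yD => [|c p IHp] y yD /=; first by move=> _ ->.
    by case/andP=> /and4P[_ _ _ cD] pp; apply: IHp.
  have Kcrs y e : y \notin D -> e \in crs (K y) N ->
      exists u w, [/\ e = [set u; w], u \in D, w \in K y, w \notin D & e \in crs D J].
    move=> yD /(crsE sN)[w [u [Ee wK uK nwu eN]]].
    have wD := KD y w yD wK.
    have uD : u \in D.
      apply: contraNT uK => uD; move: wK; rewrite !inE => yw; apply: connect_trans yw _.
      by apply: connect1; rewrite /r /= -Ee eN nwu wD.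
    by exists u, w; rewrite -crsN Ee setUC; split=> //; apply: mem_crs; rewrite // setUC -Ee.
  (* Outside [D] the boundary of [N] can only be [x]. A component of [N] outside [D] that avoids [x]
     therefore has an even number of edges into [D]; if the components of both chosen edges contain
     [x], they coincide. *)
  have two : exists e1 e2 u1 u2 w1 w2, [/\ e1 != e2, e1 \in crs D J /\ e2 \in crs D J,
      e1 = [set u1; w1] /\ e2 = [set u2; w2], u1 \in D /\ u2 \in D &
      (w1 \notin D /\ w2 \notin D) /\ connect r w1 w2].
    have [e1 e1J] : exists e, e \in crs D J by apply/card_gt0P; apply: ltnW.
    have [e2 e2J ne] : exists2 e, e \in crs D J & e != e1.
      have : 0 < #|crs D J :\ e1| by move: big; rewrite (cardsD1 e1 (crs D J)) e1J add1n ltnS.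
      by case/card_gt0P=> e; rewrite !inE => /andP[? ?]; exists e; rewrite ?inE.
    have [u1 [w1 [E1 u1D w1D _ _]]] := crsE sJ e1J.
    have [u2 [w2 [E2' u2D w2D _ _]]] := crsE sJ e2J.
    have key e u w : e \in crs D J -> e = [set u; w] -> u \in D -> w \notin D -> x \notin K w ->
        exists e1 e2 u1 u2 w1 w2, [/\ e1 != e2, e1 \in crs D J /\ e2 \in crs D J,
        e1 = [set u1; w1] /\ e2 = [set u2; w2], u1 \in D /\ u2 \in D &
        (w1 \notin D /\ w2 \notin D) /\ connect r w1 w2].
      move=> eJ Ee uD wD xK.
      have ev : ~~ odd #|crs (K w) N|.
        rewrite -odd_crs // (_ : _ :&: _ = set0) ?cards0 //; apply/setP=> z; rewrite in_setI [RHS]inE.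
        apply/negP=> /andP[zN zK]; move: zN; rewrite (bdN z (KD w z wD zK)) => /eqP Ez.
        by rewrite -Ez zK in xK.
      have ec : e \in crs (K w) N.
        rewrite Ee setUC; apply: mem_crs; first by rewrite setUC -Ee; move: eJ; rewrite -crsN inE => /andP[].
          by rewrite inE connect0.
        by apply: contraL uD => /(KD w u wD).
      have [e' e'K ne'] : exists2 e', e' \in crs (K w) N & e' != e.
        have : 0 < #|crs (K w) N :\ e|.
          by move: ev; rewrite (cardsD1 e) ec; case: #|_ :\ _|.
        by case/card_gt0P=> e'; rewrite in_setD1 => /andP[? ?]; exists e'.
      have [u' [w' [E' u'D w'K w'D e'J]]] := Kcrs w e' wD e'K.
      exists e, e', u, u', w, w'; split=> //; first by rewrite eq_sym.
      by split=> //; move: w'K; rewrite inE.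
    have [c12|c12] := boolP (connect r w1 w2).
      by exists e1, e2, u1, u2, w1, w2; split=> //; rewrite eq_sym.
    have [x1|x1] := boolP (x \in K w1); last exact: key e1J E1 u1D w1D x1.
    have [x2|x2] := boolP (x \in K w2); last exact: key e2J E2' u2D w2D x2.
    by case/negP: c12; move: x1 x2; rewrite !inE => x1 x2; rewrite (connect_trans x1) // rsym.
  have [e1 [e2 [u1 [u2 [w1 [w2 [ne [c1 c2] [E1 E2'] [u1D u2D] [[w1D w2D] cw]]]]]]]] := two.
  have [P sP bP] : exists2 P : {set {set V}}, P \subset [set e in N | [disjoint e & D]] & bd P = sd [set w1] [set w2].
    apply: path_join cw => u v /and4P[uvN nuv uD vD]; split=> //; rewrite inE uvN /=.
    by rewrite disjoint_subset; apply/subsetP=> z; rewrite !inE => /orP[]/eqP->.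
  have sPN : P \subset N by apply: subset_trans sP _; apply/subsetP=> e; rewrite inE => /andP[].
  have eP (e : {set V}) u : u \in e -> u \in D -> e \notin P.
    move=> ue uD; apply/negP=> /(subsetP sP); rewrite inE => /andP[_ /pred0P/(_ u)].
    by rewrite /= ue uD.
  have e1P : e1 \notin P by apply: (eP _ u1); rewrite // E1 set21.
  have e2P : e2 \notin P by apply: (eP _ u2); rewrite // E2' set21.
  pose C := sd P (sd [set e1] [set e2]).
  have inC e : e \in C = [|| e \in P, e == e1 | e == e2].
    rewrite /C !in_sd !in_set1; case: (e =P e1) => [->|_]; first by rewrite (negPf e1P) (negPf ne).
    by case: (e =P e2) => [->|_]; rewrite ?(negPf e2P) ?addbF ?orbF.
  have e1J0 : e1 \in J by move: c1; rewrite inE => /andP[].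
  have e2J0 : e2 \in J by move: c2; rewrite inE => /andP[].
  have e1N : e1 \in N by move: c1; rewrite -crsN inE => /andP[].
  have e2N : e2 \in N by move: c2; rewrite -crsN inE => /andP[].
  have sC : C \subset N.
    by apply/subsetP=> e; rewrite inC => /or3P[/(subsetP sPN)//|/eqP->|/eqP->].
  have nuw u w : u \in D -> w \notin D -> u != w by move=> uD; apply: contraNneq => <-.
  have bC : bd C = sd [set u1] [set u2].
    rewrite /C !bd_sd bP E1 E2' !bd_set1 ?nuw //; apply/setP=> z; rewrite !in_sd.
    by case: (z \in [set w1]); case: (z \in [set w2]); case: (z \in [set u1]); case: (z \in [set u2]).
  have bCD : bd C \subset D.
    rewrite bC; apply/subsetP=> z; rewrite in_sd !in_set1.
    by case: (z =P u1) => [->//|_]; case: (z =P u2) => [->|].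
  have sJC : sd J C \subset E by apply: sd_sub => //; apply: subset_trans sC sN.
  have crsJC : crs D J = [set e1; e2] :|: crs D (sd J C) /\ #|crs D J| = 2 + #|crs D (sd J C)|.
    have d e : e \in crs D (sd J C) = (e \in crs D J) && (e \notin [set e1; e2]).
      rewrite !in_set in_sd inC !in_set1; case: (e =P e1) => [->|_].
        by rewrite e1J0 orbT /= andbF.
      case: (e =P e2) => [->|_]; first by rewrite e2J0 /= orbT /= andbF.
      rewrite orbF andbT; case: (boolP (e \in P)) => eP'; rewrite ?addbF //.
      have := subsetP sP _ eP'; rewrite inE => /andP[_ /disjoint_setI0->].
      by rewrite cards0 !andbF.
    have Eu : crs D J = [set e1; e2] :|: crs D (sd J C).
      apply/setP=> e; rewrite in_setU d; case: (boolP (e \in [set e1; e2])) => /=; last by rewrite andbT.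
      by case/set2P=> ->.
    split=> //; rewrite Eu cardsU cards2 ne (_ : _ :&: _ = set0) ?cards0 ?subn0 //.
    by apply/setP=> e; rewrite in_setI d [RHS]inE; case: (e \in [set e1; e2]); rewrite ?andbF.
  have [crsEq crsC2] := crsJC.
  have H1 : lam x + #|crs D (sd J C)| <= len l (sd J C) + (x \notin D).
    apply: IH => //; first by move: cn crsC2; clear; lia.
      move=> e; rewrite in_sd; case: (boolP (e \in J)) => [/outJ//|_] /=.
      by move/(subsetP sC)/outN.
    apply/subsetP=> z; rewrite bd_sd => h; apply/negPn/negP=> zD.
    have h1 : z \notin sd (bd J) (tgt x) by apply: contraNN zD => /(subsetP sD).
    have h2 : z \notin bd C by apply: contraNN zD => /(subsetP bCD).
    move: h h1; rewrite !in_sd (negPf h2) addbF.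
    by move=> ->.
  (* The completed join crosses [D] at [e1], so it is not optimal for [b]; its length has the parity
     of [m] and so is at least [m + 2]. *)
  have H2 : m + 2 <= len l (sd Q' C).
    have sQC : sd Q' C \subset E by apply: sd_sub => //; apply: subset_trans sC sN.
    have [|Z [sZ lZ] bZ] := @fix_join (sd Q' C) b sQC.
      apply/subsetP=> z; rewrite bd_sd => h; apply/negPn/negP=> zD.
      have h1 : z \notin sd (bd Q') (tgt b) by apply: contraNN zD => /(subsetP Q'D).
      have h2 : z \notin bd C by apply: contraNN zD => /(subsetP bCD).
      by move: h h1; rewrite !in_sd (negPf h2) addbF => ->.
    have sW : sd (sd Q' C) Z \subset E by apply: sd_sub.
    have lW : len l (sd (sd Q' C) Z) <= len l (sd Q' C).
      by rewrite -[X in _ <= X]addn0 -lZ len_sd_le.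
    apply: leq_trans lW.
    have [_ /(_ _ sW bZ)] := opt_l b; rewrite lamD // => mW.
    have pW : odd (len l (sd (sd Q' C) Z)) = odd m.
      by rewrite -lQ; apply: parity_len; rewrite // bZ bQ.
    have nW : len l (sd (sd Q' C) Z) != m.
      apply/eqP=> eW; have := opt_nocross bD sW bZ eW; move/setP/(_ e1); rewrite [RHS]inE.
      rewrite in_set in_sd; move: (c1); rewrite inE => /andP[e1J ->]; rewrite andbT.
      have -> : (e1 \in Z) = false.
        apply/negP=> e1Z; have := zj_crs (conj sZ lZ); move/setP/(_ e1); rewrite [RHS]inE inE e1Z.
        by move: c1; rewrite inE => /andP[_ ->].
      rewrite addbF in_sd inC eqxx orbT addbT.
      have : e1 \notin crs D Q' by rewrite cQ' inE.
      by rewrite inE; move: c1; rewrite inE => /andP[_ ->]; rewrite andbT => ->.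
    move: mW pW nW; move: (len l _) => n'; case: (ltngtP m n') => // lt _ pW _.
    have H' : n' != m.+1 by apply: contra_eqN pW => /eqP-> /=; case: (odd m).
    by move: lt H'; clear; lia.
  move: (len_exchange l sC) (len_sub l sQ'Q) H1 H2 crsC2; rewrite lQ; clear; lia.
have -> : #|crs D J| = 0 by apply/eqP; rewrite -leqn0.
apply: leq_trans (leq_addr _ _); rewrite addn0; have [Z [sZ lZ] bZ] := fix_join sJ sD.
have [_ /(_ (sd J Z)) H] := opt_l x.
by rewrite -[len l J]addn0 -lZ (leq_trans (H _ bZ) (len_sd_le _ _ _)) // sd_sub.
Qed.

Lemma step_pos x : x \notin D -> 0 < lam x.
Proof.
move=> xD; have [[J [sJ bJ lJ]] _] := opt_l x.
have : odd #|crs D J| by rewrite -crsC // -odd_crs // bJ parityT.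
case: (posnP #|crs D J|) => [->//|/card_gt0P[e ec] _].
have eE : e \in crs D E by move: ec; rewrite !inE => /andP[/(subsetP sJ)-> ->].
have eJ : e \in J by move: ec; rewrite inE => /andP[].
by rewrite -lJ /len (big_setD1 e eJ) /= addn_gt0 cut_pos.
Qed.

Hypothesis l'_cut : forall e, e \in crs D E -> l' e + 1 = l e.
Hypothesis l'_in : forall e, e \in E -> e \subset D -> l' e <= l e /\ ~~ odd (l' e).
Hypothesis l'_out : forall e, e \in E -> e \notin crs D E -> ~~ (e \subset D) -> l' e = l e.
Hypothesis lam'E : forall x, lam' x + (x \notin D) = lam x.

(** The lower bound is [claim]. Conversely an [l]-optimal join stays optimal: by [claim] and parity
    it crosses the cut exactly [x \notin D] times and has length 0 inside [D]. *)
Lemma step_opt : opt l' lam'.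
Proof.
have outer (J : {set {set V}}) x : J \subset E -> bd J = tgt x ->
    lam x + #|crs D J| <= len l [set e in J | ~~ (e \subset D)] + (x \notin D) /\
    len l' [set e in J | ~~ (e \subset D)] + #|crs D J| = len l [set e in J | ~~ (e \subset D)].
  move=> sJ bJ; set J0 := [set e in J | _].
  have sJ0J : J0 \subset J by apply/subsetP=> e; rewrite inE => /andP[].
  have sJ0 := subset_trans sJ0J sJ.
  have Ec : crs D J0 = crs D J.
    apply/setP=> e; rewrite !inE; case: (boolP (e \in J)) => //= eJ.
    case: (boolP (#|e :&: D| == 1)) => e1; rewrite ?andbF ?andbT //.
    have [x1 [y1 [nxy Ee]]] := E2 (subsetP sJ _ eJ).
    by apply/negP=> /setIidPl h; rewrite h Ee cards2 nxy in e1.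
  split.
    rewrite -Ec; apply: (@claim #|crs D J0|) => //; first by move=> e; rewrite inE => /andP[].
    rewrite -bJ -bd_sd; apply/subsetP=> v; rewrite in_set /jdeg => od.
    have /card_gt0P[e] : 0 < #|[set e in sd J0 J | v \in e]| by case: #|_| od.
    rewrite in_set in_sd in_set => /andP[].
    by case: (e \in J) => //=; rewrite addbT negbK => /subsetP; apply.
  have -> : #|crs D J| = \sum_(e in J0) (#|e :&: D| == 1).
    rewrite -Ec -sum1_card big_mkcond [RHS]big_mkcond; apply: eq_bigr => e _; rewrite inE.
    by case: (e \in J0); case: (_ == 1).
  rewrite /len -big_split; apply: eq_bigr => e eJ0 /=.
  have eE := subsetP sJ0 _ eJ0; have nD : ~~ (e \subset D) by move: eJ0; rewrite inE => /andP[].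
  case: (boolP (#|e :&: D| == 1)) => e1; first by rewrite l'_cut // inE eE.
  by rewrite addn0 l'_out // inE eE (negPf e1).
have sub0 (J : {set {set V}}) : [set e in J | ~~ (e \subset D)] \subset J by apply/subsetP=> e; rewrite inE => /andP[].
move=> x; split; last first.
  move=> J sJ bJ; have [A B] := outer J x sJ bJ.
  move: (len_sub l' (sub0 J)) (lam'E x) A B; clear; lia.
have [[J [sJ bJ lJ]] _] := opt_l x; exists J; split=> //.
have [A B] := outer J x sJ bJ.
have inner : len l' J <= len l' [set e in J | ~~ (e \subset D)] + len l [set e in J | e \subset D].
  rewrite !len_mem -big_split leq_sum // => e _; rewrite !inE /=.
  case: (boolP (e \in J)) => //= eJ; case: (boolP (e \subset D)) => eD; rewrite /= !mul1n ?mul0n ?addn0 //.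
  by have [] := l'_in (subsetP sJ _ eJ) eD.
have total : len l J = len l [set e in J | ~~ (e \subset D)] + len l [set e in J | e \subset D].
  rewrite !len_mem -big_split; apply: eq_bigr => e _; rewrite !inE /=.
  by case: (e \in J); case: (e \subset D); rewrite /= ?mul1n ?mul0n ?addn0.
have par : odd #|crs D J| = (x \notin D).
  by rewrite -parityT -crsC // -odd_crs // bJ.
have lo : lam' x <= len l' J.
  by move: (len_sub l' (sub0 J)) (lam'E x) A B; clear; lia.
have q : (x \notin D) <= #|crs D J| by move: par; case: (x \notin D) => //; case: #|crs D J|.
move: (lam'E x) A B inner total lo q; rewrite lJ; clear; lia.
Qed.

Lemma step_parity x y : [set x; y] \in E -> odd (l' [set x; y]) = odd (lam' x + lam' y).
Proof.
move=> eE; have p := parity eE; have := lam'E x; have := lam'E y.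
have mc u v : [set u; v] \in E -> u \in D -> v \notin D -> [set u; v] \in crs D E by apply: mem_crs.
case: (boolP (x \in D)) => xD; case: (boolP (y \in D)) => yD /= Ey Ex.
- have [|_ /negPf->] := l'_in eE; first by rewrite subUset !sub1set xD yD.
  by move: (lamD xD) (lamD yD) Ex Ey; clear; lia.
- by move: (l'_cut (mc x y eE xD yD)) Ex Ey p; clear; lia.
- have := l'_cut (mc y x (etrans (congr1 (fun s => s \in E) (setUC _ _)) eE) yD xD).
  by rewrite [[set y; x]]setUC; move: Ex Ey p; clear; lia.
- rewrite l'_out //; first by move: Ex Ey p; clear; lia.
    rewrite inE eE /= (_ : _ :&: _ = set0) ?cards0 //; apply/setP=> z; rewrite !inE.
    by apply/negP=> /andP[/orP[]/eqP->]; rewrite ?(negPf xD) ?(negPf yD).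
  by rewrite subUset sub1set (negPf xD).
Qed.

End Step.

Definition cutdown (l : {set V} -> nat) (D : {set V}) (e : {set V}) :=
  if e \subset D then 0 else l e - (#|e :&: D| == 1).

Lemma cutdownE Ds l e : foldl cutdown l Ds e =
  if has (fun D : {set V} => e \subset D) Ds then 0
  else l e - count (fun D : {set V} => #|e :&: D| == 1) Ds.
Proof.
elim: Ds l => [|D Ds IH] l /=; first by rewrite subn0.
rewrite IH /cutdown; case: (e \subset D) => /=; first by rewrite sub0n; case: ifP.
by rewrite subnDA.
Qed.

(** The components are contracted one after another. An edge between two of them has even positive
    length, by parity, so it remains positive after losing one unit and the next step still
    applies. *)
Lemma iter_opt (Ds : seq {set V}) l lam m : opt l lam -> uniq Ds ->
  {in Ds &, forall D D' : {set V}, D != D' -> [disjoint D & D']} ->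
  (forall x, m <= lam x) ->
  (forall x y, [set x; y] \in E -> odd (l [set x; y]) = odd (lam x + lam y)) ->
  {in Ds, forall D : {set V}, [/\ D != set0, forall x, x \in D -> lam x = m,
     forall u v, u \in D -> v \in D ->
       exists2 Z : {set {set V}}, (Z \subset E) /\ len l Z = 0 & bd Z = sd [set u] [set v] &
     forall e, e \in crs D E -> 0 < l e]} ->
  {in Ds, forall D : {set V}, odd #|T :&: D| = (x0 \notin D)} /\
  exists2 lam', opt (foldl cutdown l Ds) lam' &
    (forall x, lam' x + count (fun D : {set V} => x \notin D) Ds = lam x) /\
    (forall x y, [set x; y] \in E -> odd (foldl cutdown l Ds [set x; y]) = odd (lam' x + lam' y)).
Proof.
elim: Ds l lam m => [|D Ds IH] l lam m opt_l uD disD lmin par HD.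
  by split=> //; exists lam => //; split=> // x; rewrite addn0.
have [D0 lamD zD cD] := HD D (mem_head _ _).
have [b bD] := set0Pn _ D0.
have oddD := step_odd opt_l bD lamD lmin zD cD.
pose lam' x := lam x - (x \notin D).
have lam'E x : lam' x + (x \notin D) = lam x.
  have := @step_pos l lam D m b opt_l bD lamD lmin zD cD x.
  rewrite /lam'; case: (x \notin D) => [/(_ isT)|_]; clear; lia.
have cut1 e : e \in crs D E -> cutdown l D e + 1 = l e.
  move=> ec; have le := cD e ec; rewrite /cutdown.
  have [eE e1] : e \in E /\ #|e :&: D| == 1 by apply/andP; rewrite inE in ec.
  have [x [y [nxy Ee]]] := E2 eE.
  case: ifP => [/setIidPl h|_]; first by rewrite h Ee cards2 nxy in e1.
  by rewrite e1; move: le; clear; lia.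
have cut2 e : e \in E -> e \subset D -> cutdown l D e <= l e /\ ~~ odd (cutdown l D e).
  by move=> _ eD; rewrite /cutdown eD.
have cut3 e : e \in E -> e \notin crs D E -> ~~ (e \subset D) -> cutdown l D e = l e.
  by move=> eE; rewrite inE eE /= /cutdown => /negPf-> /negPf->; rewrite subn0.
have opt' := step_opt opt_l bD lamD lmin zD par cD cut1 cut2 cut3 lam'E.
have par' := step_parity lamD par cut1 cut2 cut3 lam'E.
have [||||H1 [lam2 opt2 [E2' par2]]] := IH (cutdown l D) lam' m.-1 opt' _ _ _ par'.
- by case/andP: uD.
- by move=> D1 D2 D1s D2s; apply: disD; rewrite inE (D1s, D2s) orbT.
- by move=> x; rewrite /lam'; move: (lmin x); case: (x \notin D); clear; lia.
- move=> D1 D1s; have [n0 lamD1 z1 c1] := HD D1 (mem_behead (s := D :: Ds) D1s).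
  have dD : [disjoint D & D1].
    apply: disD; rewrite ?mem_head ?inE ?D1s ?orbT //.
    by apply: contraTneq (D1s) => <-; case/andP: uD.
  have nD x : x \in D1 -> x \notin D.
    by move=> xD1; apply/negP=> xD; have /pred0P/(_ x) := dD; rewrite /= xD xD1.
  split=> //.
  - by move=> x xD1; rewrite /lam' (nD x xD1) lamD1 // subn1.
  - move=> u v uD1 vD1; have [Z [sZ lZ] bZ] := z1 u v uD1 vD1; exists Z => //; split=> //.
    apply/eqP; rewrite -leqn0 -lZ /len leq_sum // => e eZ.
    by rewrite /cutdown; case: ifP => // _; apply: leq_subr.
  - move=> e ec; have le := c1 e ec; rewrite /cutdown.
    have [x [y [Ee xD1 yD1 nxy eE]]] := crsE (subxx E) ec.
    have -> : (e \subset D) = false.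
      by apply/negP=> /subsetP/(_ x); rewrite Ee set21 (negPf (nD x xD1)) => /(_ isT).
    case: (boolP (#|e :&: D| == 1)) => e1; last by rewrite subn0.
    have yD : y \in D.
      move: e1; apply: contraLR => yD; rewrite (_ : _ :&: _ = set0) ?cards0 //.
      apply/setP=> z; rewrite Ee !inE; apply/negP=> /andP[/orP[]/eqP-> h].
        by have := nD x xD1; rewrite h.
      by rewrite h in yD.
    have := par x y; rewrite -Ee => /(_ eE); rewrite lamD1 // lamD // addnn odd_double.
    by case: (l e) le => [|[]].
split; first by move=> D1; rewrite inE => /orP[/eqP->//|/H1].
exists lam2 => //; split=> // x /=; rewrite -(lam'E x) -(E2' x); clear; lia.
Qed.

End Joins.

(** * Level components of the potential of a triangulation *)

Section Levels.
Variables (V : finType) (F : {set {set V}}).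
Hypothesis PT : plane_triangulation F.
Hypothesis D56 : forall v : V, tri_deg F v = 5 \/ tri_deg F v = 6.
Let E := tri_edges F.

Lemma edge2 e : e \in E -> exists x y, x != y /\ e = [set x; y].
Proof. by case/edgeP=> x [y [-> /(adj_neq PT)]]; exists x, y. Qed.

Lemma join_ex (A : {set V}) : ~~ odd #|A| -> exists2 J : {set {set V}}, J \subset E & bd J = A.
Proof.
apply: (@even_join _ (fun J : {set {set V}} => J \subset E) setT) => //; first exact: sub0set.
  by move=> J K; apply: sd_sub.
move=> u v _ _; apply: (path_join _ (graph_connect PT u v)) => x y xy.
by split; [exact: xy|exact: (adj_neq PT xy)].
Qed.

Lemma tjoinE S J : is_Tjoin F S J = (J \subset E) && (bd J == S).
Proof. by []. Qed.

Lemma tau_le S (J : {set {set V}}) : J \subset E -> bd J = S -> tau F S <= #|J|.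
Proof.
move=> sJ bJ; have PJ : is_Tjoin F S J by rewrite tjoinE sJ bJ eqxx.
rewrite /tau; elim: (index_enum _) (mem_index_enum J) => // K r IH; rewrite inE big_cons => /orP[/eqP<-|/IH le].
  by rewrite PJ geq_minl.
by case: ifP => // _; apply: leq_trans (geq_minr _ _) le.
Qed.

Lemma tau_ex (S : {set V}) : ~~ odd #|S| -> exists J : {set {set V}}, [/\ J \subset E, bd J = S & #|J| = tau F S].
Proof.
move=> /join_ex[K sK bK].
suff : tau F S = #|E|.+1 \/ exists J : {set {set V}}, [/\ J \subset E, bd J = S & #|J| = tau F S].
  case=> // H; have := tau_le sK bK; rewrite H => /leq_ltn_trans/(_ (ltnSn _)).
  by have := subset_leq_card sK; lia.
rewrite /tau; apply: (big_ind (fun n => n = #|E|.+1 \/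
   exists J : {set {set V}}, [/\ J \subset E, bd J = S & #|J| = n])); first by left.
- by move=> a b Ha Hb; rewrite /minn; case: ifP.
- by move=> J; rewrite tjoinE => /andP[sJ /eqP bJ]; right; exists J.
Qed.

Variable x0 : V.
Definition mu x := tau F (tgt (pent F) x0 x).

Lemma even_tgt x : ~~ odd #|tgt (pent F) x0 x|.
Proof. by rewrite /tgt !odd_sd (card_pent PT D56) !cards1. Qed.

Lemma mu_adj x y : tri_adj F x y -> mu x <= mu y + 1.
Proof.
move=> xy; have [J [sJ bJ cJ]] := tau_ex (even_tgt y).
have nxy := adj_neq PT xy.
have sK : sd J [set [set x; y]] \subset E by apply: sd_sub; rewrite // sub1set.
have bK : bd (sd J [set [set x; y]]) = tgt (pent F) x0 x.
  rewrite bd_sd bJ bd_set1 //; apply/setP=> z; rewrite !in_sd.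
  by case: (z \in pent F); case: (z \in [set x0]); case: (z \in [set x]); case: (z \in [set y]).
apply: leq_trans (tau_le sK bK) _; rewrite /mu -cJ.
have := card_sd J [set [set x; y]]; rewrite cards1; lia.
Qed.

(** What remains of the length of [e] when all levels below [c] are contracted; at [c = 0] it is 2,
    one unit for each half edge. *)
Definition lev (c : nat) (e : {set V}) : nat :=
  [forall v in e, c <= 2 * mu v] + (c <= \sum_(v in e) mu v).

Lemma levE c x y : x != y ->
  lev c [set x; y] = ((c <= 2 * mu x) && (c <= 2 * mu y)) + (c <= mu x + mu y).
Proof.
move=> nxy; rewrite /lev big_setU1 ?inE //= big_set1; congr (nat_of_bool _ + _).
apply/forall_inP/andP => [H|[h1 h2] v /set2P[]->//].
by split; apply: H; rewrite !inE eqxx ?orbT.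
Qed.

(** In doubled scale a vertex has height [2 * mu x] and a midpoint [mu x + mu y]. The strict bound
    selects the edges with [lev c] equal to 0. *)
Definition lrel c : rel V := [rel x y | tri_adj F x y && (mu x + mu y < c)].
Definition low c := [set x | 2 * mu x <= c].
Definition lcomp c x := [set y | connect (lrel c) x y].
Definition lcomps c := [set lcomp c x | x in low c].

Lemma lrel_sym c : connect_sym (lrel c).
Proof. by apply: sym_connect_sym => x y; rewrite /lrel /= adj_sym addnC. Qed.

Lemma lrel_low c x y : lrel c x y -> x \in low c /\ y \in low c.
Proof.
rewrite /lrel /= => /andP[xy lt]; have h1 := mu_adj xy; have := mu_adj (etrans (adj_sym F y x) xy).
by move: h1 lt; rewrite !inE; clear; lia.
Qed.

Lemma lcomp_low c x : x \in low c -> lcomp c x \subset low c.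
Proof.
move=> xl; apply/subsetP=> y; rewrite inE => /connectP[p]; elim: p x xl => [|z p IH] x xl /=.
  by move=> _ ->.
by case/andP=> /lrel_low[_ zl] pp; apply: IH.
Qed.

Lemma lcomps_low c (D : {set V}) : D \in lcomps c -> D \subset low c.
Proof. by case/imsetP=> x xl ->; apply: lcomp_low. Qed.

Lemma lcomps_eq c D x : D \in lcomps c -> x \in D -> D = lcomp c x.
Proof.
case/imsetP=> y _ ->; rewrite inE => yx; apply/setP=> z; rewrite !inE.
exact: (same_connect (@lrel_sym c) yx).
Qed.

Lemma lcomps_connect c D x y : D \in lcomps c -> x \in D -> y \in D -> connect (lrel c) x y.
Proof. by move=> Dc xD; rewrite (lcomps_eq Dc xD) inE. Qed.

Lemma lcomps_conn c D : D \in lcomps c -> conn F D.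
Proof.
move=> Dc Y y yD yY cl; apply/subsetP=> z zD; have /connectP[p] := lcomps_connect Dc yD zD.
elim: p y yD yY => [|w p IH] y yD yY /=; first by move=> _ ->.
case/andP=> yw pp Ez; have wD : w \in D by rewrite (lcomps_eq Dc yD) inE connect1.
by apply: IH pp Ez => //; apply: (cl y) => //; case/andP: yw.
Qed.

Lemma lcomps_edge c D x y : D \in lcomps c -> x \in D -> y \notin D -> tri_adj F x y ->
  (2 * mu x = c /\ 2 * mu y = c) \/ ((c = 2 * mu x \/ c = 2 * mu x + 1) /\ mu y = mu x + 1).
Proof.
move=> Dc xD yD xy; have xl : 2 * mu x <= c by have := subsetP (lcomps_low Dc) _ xD; rewrite inE.
have nl : c <= mu x + mu y.
  rewrite leqNgt; apply: contraNN yD => lt; rewrite (lcomps_eq Dc xD) inE connect1 //.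
  by rewrite /lrel /= xy.
have := mu_adj xy; have := mu_adj (etrans (adj_sym F y x) xy).
by move: xl nl; clear; lia.
Qed.

Lemma lcomps_mono c c' (D D' : {set V}) : c <= c' -> D \in lcomps c -> D' \in lcomps c' ->
  D \subset D' \/ [disjoint D & D'].
Proof.
move=> cc Dc Dc'; have [x /andP[xD xD']|H] := pickP (fun x => (x \in D) && (x \in D')).
  left; apply/subsetP=> z zD; rewrite (lcomps_eq Dc' xD') inE.
  apply: connect_sub (lcomps_connect Dc xD zD) => u v /andP[uv lt]; apply: connect1.
  by rewrite /lrel /= uv (leq_trans lt).
by right; apply/pred0P.
Qed.

Definition nlev c := \sum_(i < c) #|lcomps i|.

(** By [iter_opt], level [c] costs a vertex one unit for each component other than its own. A vertex
    above the level pays for all of them, a vertex at or below it is spared one, which turns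
    [2 * mu x] into the maximum with [c]. *)
Lemma lev_opt c : (exists2 lam, opt E (pent F) x0 (lev c) lam &
    (forall x, lam x + nlev c = maxn (2 * mu x) c) /\
    (forall x y, [set x; y] \in E -> odd (lev c [set x; y]) = odd (lam x + lam y))) /\
  (forall i (D : {set V}), i < c -> D \in lcomps i -> odd (pcnt F D) = (x0 \notin D)).
Proof.
elim: c => [|c [[lam opt_l [lamE par]] IHodd]].
  split=> //; exists (fun x => 2 * mu x).
    move=> x; have lenE (J : {set {set V}}) : len (lev 0) J = 2 * #|J|.
      by rewrite /len /lev -sum1_card big_distrr; apply: eq_bigr => e _; rewrite (introT forall_inP).
    split; last by move=> J sJ bJ; rewrite lenE leq_mul2l tau_le.
    by have [J [sJ bJ cJ]] := tau_ex (even_tgt x); exists J; rewrite lenE cJ.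
  split; first by move=> x; rewrite /nlev big_ord0 maxn0 addn0.
  move=> x y eE; rewrite levE; last exact: (adj_neq PT (eE : tri_adj F x y)).
  by rewrite /=; clear; lia.
have [D0|[D00 D00c]] : lcomps c = set0 \/ exists D, D \in lcomps c.
  by case: (set_0Vmem (lcomps c)) => [->|[D Dc]]; [left|right; exists D].
  have ll e : e \in E -> lev c.+1 e = lev c e.
    move=> /edge2[x [y [nxy ->]]]; rewrite !levE //.
    have hi z : c < 2 * mu z.
      by rewrite ltnNge; apply/negP=> h; have : lcomp c z \in lcomps c by [apply: imset_f; rewrite inE]; rewrite D0 inE.
    by have := hi x; have := hi y; clear; lia.
  have lenl (J : {set {set V}}) : J \subset E -> len (lev c.+1) J = len (lev c) J.
    by move=> sJ; apply: eq_bigr => e eJ; rewrite ll // (subsetP sJ).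
  have hi z : c < 2 * mu z.
    by rewrite ltnNge; apply/negP=> h; have : lcomp c z \in lcomps c by [apply: imset_f; rewrite inE]; rewrite D0 inE.
  split.
    exists lam.
      move=> x; have [[J [sJ bJ lJ]] H] := opt_l x; split; first by exists J; rewrite lenl.
      by move=> K sK bK; rewrite lenl //; apply: H.
    split; last by move=> x y eE; rewrite ll //; apply: par.
    move=> x; rewrite /nlev big_ord_recr /= D0 cards0 addn0 lamE.
    by have := hi x; clear; lia.
  move=> i D; rewrite ltnS leq_eqVlt => /orP[/eqP->|]; last exact: IHodd.
  by rewrite D0 inE.
pose Ds := enum (lcomps c).
have mem_Ds D : (D \in Ds) = (D \in lcomps c) by rewrite mem_enum.
have [z zD] : exists z, z \in D00.
  by case/imsetP: D00c => z _ ->; exists z; rewrite inE connect0.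
have Nle : nlev c <= c.
  have := lamE z; have := subsetP (lcomps_low D00c) _ zD; rewrite inE.
  by clear; lia.
have lamlow x : x \in low c -> lam x = c - nlev c.
  by rewrite inE => h; have := lamE x; move: h; clear; lia.
have disj (D D' : {set V}) : D \in lcomps c -> D' \in lcomps c -> D != D' -> [disjoint D & D'].
  move=> Dc Dc' ne; apply/pred0P=> x /=; apply/negP=> /andP[xD xD'].
  by rewrite (lcomps_eq Dc xD) -(lcomps_eq Dc' xD') eqxx in ne.
have [|||||Hodd [lam' opt' [lam'E par']]] := @iter_opt _ E edge2 (pent F) x0 Ds (lev c) lam (c - nlev c) opt_l.
- exact: enum_uniq.
- by move=> D D'; rewrite !mem_Ds; apply: disj.
- by move=> x; have := lamE x; clear; lia.
- exact: par.
- move=> D; rewrite mem_Ds => Dc; split.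
  + by case/imsetP: Dc => x _ ->; apply/set0Pn; exists x; rewrite inE connect0.
  + by move=> x xD; apply: lamlow; apply: (subsetP (lcomps_low Dc)).
  + move=> u v uD vD; have cuv := lcomps_connect Dc uD vD.
    have [x y|P sP bP] := @path_join _ (lrel c) [set e in E | lev c e == 0] u v _ cuv.
      move=> /andP[xy lt]; have nxy := adj_neq PT xy; split=> //.
      by rewrite inE levE // [_ \in E]xy /=; apply/eqP; move: lt; clear; lia.
    exists P => //; split; first by apply: subset_trans sP _; apply/subsetP=> e; rewrite inE => /andP[].
    by rewrite /len big1 // => e /(subsetP sP); rewrite inE => /andP[_ /eqP].
  + move=> e /(crsE edge2 (subxx _))[x [y [-> xD yD nxy eE]]]; rewrite levE //.
    have := lcomps_edge Dc xD yD eE; clear; lia.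
have cnt_in x : count (fun D : {set V} => x \notin D) Ds + (x \in low c) = #|lcomps c|.
  rewrite cardE -/Ds -(count_predC (fun D : {set V} => x \in D) Ds) addnC; congr (_ + _).
  case: (boolP (x \in low c)) => xl; last first.
    apply/esym/eqP; rewrite -leqn0 leqNgt -has_count; apply/hasPn=> D; rewrite mem_Ds => Dc.
    by apply: contraNN xl => /(subsetP (lcomps_low Dc)).
  have xc : lcomp c x \in lcomps c by apply: imset_f.
  have -> : count (fun D : {set V} => x \in D) Ds = count_mem (lcomp c x) Ds.
    apply: eq_in_count => D; rewrite mem_Ds => Dc /=; apply/idP/eqP => [/(lcomps_eq Dc)//|->].
    by rewrite inE connect0.
  by rewrite count_uniq_mem ?enum_uniq // mem_Ds xc.
(* An edge inside no component loses one unit for each end in [low c]. If both ends are low, they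
   have height exactly [c] and lie in different components. *)
have folded e : e \in E -> foldl (@cutdown V) (lev c) Ds e = lev c.+1 e.
  move=> eE; have [x [y [Ee xy]]] := edgeP eE; have nxy := adj_neq PT xy; subst e.
  have h1 := mu_adj xy; have h2 := mu_adj (etrans (adj_sym F y x) xy).
  rewrite cutdownE; case: ifP => [/hasP[D]|/hasPn H].
    rewrite mem_Ds => Dc; rewrite subUset !sub1set => /andP[xD yD].
    have := subsetP (lcomps_low Dc) _ xD; have := subsetP (lcomps_low Dc) _ yD.
    by rewrite levE // !inE; clear; lia.
  have H' D : D \in lcomps c -> ~~ ((x \in D) && (y \in D)).
    by move=> Dc; have := H D; rewrite mem_Ds Dc subUset !sub1set => /(_ isT).
  have nlt : x \in low c -> y \in low c -> 2 * mu x = c /\ 2 * mu y = c.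
    move=> xl yl; have xc : lcomp c x \in lcomps c by apply: imset_f.
    have xx : x \in lcomp c x by rewrite inE connect0.
    have yD : y \notin lcomp c x by have := H' _ xc; rewrite xx.
    have := lcomps_edge xc xx yD xy; move: xl yl; rewrite !inE; clear; lia.
  have -> : count (fun D : {set V} => #|[set x; y] :&: D| == 1) Ds = (x \in low c) + (y \in low c).
    have -> : count (fun D : {set V} => #|[set x; y] :&: D| == 1) Ds
        = count (fun D : {set V} => x \in D) Ds + count (fun D : {set V} => y \in D) Ds.
      rewrite -count_predUI [X in _ = _ + X](_ : _ = 0) ?addn0; last first.
        by apply/eqP; rewrite -leqn0 leqNgt -has_count; apply/hasPn=> D; rewrite mem_Ds => /H'.
      apply: eq_in_count => D; rewrite mem_Ds => /H'/= nn.
      have -> : [set x; y] :&: D = (if x \in D then [set x] else set0) :|: (if y \in D then [set y] else set0).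
        have ifE w v : (w \in if v \in D then [set v] else set0) = (w == v) && (v \in D).
          by case: ifP => _; rewrite !inE ?andbT ?andbF.
        apply/setP=> w; rewrite in_setU !ifE in_setI in_set2 andb_orl.
        by congr (_ || _); case: eqP => [->|].
      by move: nn; case: (x \in D); case: (y \in D); rewrite //= ?setU0 ?set0U ?cards1 ?cards0.
    have co w : count (fun D : {set V} => w \in D) Ds = (w \in low c).
      have h := cnt_in w; rewrite cardE -/Ds -(count_predC (fun D : {set V} => w \in D) Ds) in h.
      have e : count (predC (fun D : {set V} => w \in D)) Ds = count (fun D : {set V} => w \notin D) Ds by [].
      rewrite e in h; move: h; move: (count (fun D : {set V} => w \notin D) Ds) => a.
      by move: (count _ _) (nat_of_bool _); clear; lia.
    by rewrite !co.
  rewrite !levE //; move: nlt; rewrite !inE; case: (leqP (2 * mu x) c); case: (leqP (2 * mu y) c) => hy hx nlt.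
  - by have [] := nlt isT isT; clear; lia.
  - by move: h1 h2 hx hy; clear; lia.
  - by move: h1 h2 hx hy; clear; lia.
  - by move: h1 h2 hx hy; clear; lia.
have lenl (J : {set {set V}}) : J \subset E -> len (lev c.+1) J = len (foldl (@cutdown V) (lev c) Ds) J.
  by move=> sJ; apply: eq_bigr => e eJ; rewrite folded // (subsetP sJ).
split; last first.
  move=> i D; rewrite ltnS leq_eqVlt => /orP[/eqP->|]; last exact: IHodd.
  by move=> Dc; have := Hodd D; rewrite mem_Ds setIC => /(_ Dc).
exists lam'.
  move=> x; have [[J [sJ bJ lJ]] H] := opt' x; split; first by exists J; rewrite lenl.
  by move=> K sK bK; rewrite lenl //; apply: H.
split; last by move=> x y eE; rewrite -folded //; apply: par'.
move=> x; rewrite /nlev big_ord_recr /= -/(nlev c) -(cnt_in x).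
have := lam'E x; have := lamE x; rewrite inE; clear; lia.
Qed.

Definition topl := (2 * \max_x mu x).+1.

(** Above all heights every edge has length 0, so [lam x0 = 0]. *)
Lemma nlev_top : nlev topl = topl.
Proof.
have [[lam opt_l [lamE _]] _] := lev_opt topl.
have mx x : 2 * mu x < topl by rewrite /topl ltnS leq_mul2l; apply: (leq_bigmax x).
have [[J [sJ bJ lJ]] _] := opt_l x0.
have : len (lev topl) J = 0.
  apply: big1 => e /(subsetP sJ)/edge2[x [y [nxy ->]]]; rewrite levE //.
  by have := mx x; have := mx y; clear; lia.
by rewrite lJ => l0; have := lamE x0; have := mx x0; rewrite l0; clear; lia.
Qed.

(** By [lev_opt] the components that avoid [x0] are those with an odd number of vertices of degree
    5. *)
Definition lidx := {p : 'I_topl * {set V} | (p.2 \in lcomps p.1) && (x0 \notin p.2)}.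
Definition lset (s : lidx) := (val s).2.
(** By [lcomps_edge], the midpoint of an edge leaving a component of odd level has exactly this
    level and is included; at even levels these midpoints are left out. *)
Definition lnear (s : lidx) := ~~ odd (val s).1.

(** There are [topl] components in all, and [x0] lies in exactly one of each level from [2 * mu x0]
    on. *)
Lemma card_lidx : #|{: lidx}| = 2 * mu x0.
Proof.
rewrite card_sig -sum1_card.
have -> : \sum_(p : 'I_topl * {set V} | (p.2 \in lcomps p.1) && (x0 \notin p.2)) 1
   = \sum_(c < topl) (#|lcomps c| - (2 * mu x0 <= c)).
  transitivity (\sum_(c < topl) \sum_(D : {set V} | (D \in lcomps c) && (x0 \notin D)) 1).
    by rewrite pair_big_dep.
  apply: eq_bigr => c _; rewrite sum1_card.
  have -> : #|lcomps c| = #|[pred D in lcomps c | x0 \notin D]| + (2 * mu x0 <= c).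
    rewrite -(cardID (fun D : {set V} => x0 \notin D) (lcomps c)); congr (_ + _).
    case: (leqP (2 * mu x0) c) => h.
      have xl : x0 \in low c by rewrite inE.
      rewrite (@eq_card1 _ (lcomp c x0)) // => D; rewrite !inE.
      rewrite [in X in ~~ X]/in_mem /= negbK.
      apply/andP/eqP => [[xD Dc]|->]; first exact: (lcomps_eq Dc xD).
      have h1 : x0 \in lcomp c x0 by rewrite inE connect0.
      by split; [exact: h1|apply: imset_f].
    apply: eq_card0 => D; rewrite !inE [in X in ~~ X]/in_mem /= negbK; apply/negP=> /andP[xD Dc].
    by have := subsetP (lcomps_low Dc) _ xD; rewrite inE leqNgt h.
  by rewrite addnK; apply: eq_card => D; rewrite !inE.
have pos (c : nat) : (2 * mu x0 <= c) <= #|lcomps c|.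
  case: (leqP (2 * mu x0) c) => h //; apply/card_gt0P; exists (lcomp c x0).
  by apply: imset_f; rewrite inE.
rewrite sumnB; last by move=> i _; apply: pos.
have -> : \sum_(i < topl) #|lcomps i| = topl := nlev_top.
have -> : \sum_(i < topl) (2 * mu x0 <= i) = topl - 2 * mu x0.
  have mx : 2 * mu x0 < topl by rewrite /topl ltnS leq_mul2l; apply: (leq_bigmax x0).
  elim: topl mx => // n IH mx; rewrite big_ord_recr /=.
  have [/IH->|h] := ltnP (2 * mu x0) n; first by move: mx; clear; lia.
  have E0 : 2 * mu x0 = n by move: mx h; clear; lia.
  rewrite big1 => [|i _]; first by rewrite E0 leqnn subSnn.
  by rewrite E0 leqNgt ltn_ord.
have mx : 2 * mu x0 < topl by rewrite /topl ltnS leq_mul2l; apply: (leq_bigmax x0).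
by move: mx; clear; lia.
Qed.

Lemma lset_in s : lset s \in lcomps (val s).1.
Proof. by have /andP[] := valP s. Qed.

Lemma lset_odd s : odd (pcnt F (lset s)).
Proof.
have [_ H] := lev_opt topl; rewrite (H (val s).1) ?lset_in //.
by have /andP[] := valP s.
Qed.

Lemma lset_lam s t : s != t -> [\/ insd F (lset s) (lnear s) (lset t) (lnear t),
  insd F (lset t) (lnear t) (lset s) (lnear s) | insd F (lset s) (lnear s) (~: lset t) (~~ lnear t)].
Proof.
have disj (a b : lidx) : (val a).1 <= (val b).1 -> a != b -> [disjoint lset a & lset b] ->
    insd F (lset a) (lnear a) (~: lset b) (~~ lnear b).
  move=> ab nab dab; split; first by rewrite -disjoints_subset.
  move=> x y xa; rewrite inE negbK => yb xy.
  have xb : x \notin lset b by apply/negP=> xb; have /pred0P/(_ x) := dab; rewrite /= xa xb.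
  have ya : y \notin lset a by apply/negP=> ya; have /pred0P/(_ y) := dab; rewrite /= ya yb.
  have h1 := lcomps_edge (lset_in a) xa ya xy.
  have h2 := lcomps_edge (lset_in b) yb xb (etrans (adj_sym F y x) xy).
  by rewrite /lnear negbK; move: h1 h2; clear; lia.
have key (a b : lidx) : (val a).1 <= (val b).1 -> a != b ->
    insd F (lset a) (lnear a) (lset b) (lnear b) \/ insd F (lset a) (lnear a) (~: lset b) (~~ lnear b).
  move=> ab nab; have [sub|dis] := lcomps_mono ab (lset_in a) (lset_in b); last by right; apply: disj.
  left; split=> // x y xa yb xy.
  have xb := subsetP sub _ xa.
  have ya : y \notin lset a by apply: contraNN yb => /(subsetP sub).
  have h1 := lcomps_edge (lset_in a) xa ya xy.
  have h2 := lcomps_edge (lset_in b) xb yb xy.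
  have ne : (val a).1 <> (val b).1 :> nat.
    move=> Ec; case/eqP: nab; apply: val_inj.
    have Ec' : (val a).1 = (val b).1 by apply: val_inj.
    rewrite [val a]surjective_pairing [val b]surjective_pairing Ec'; congr (_, _).
    have ha := lset_in a; have hb := lset_in b; rewrite Ec' in ha.
    by rewrite -/(lset a) -/(lset b) (lcomps_eq ha xa) -(lcomps_eq hb xb).
  by rewrite /lnear; move: h1 h2 ne ab; clear; lia.
move=> st; case: (leqP (val s).1 (val t).1) => [le|/ltnW le].
  by case: (key s t le st) => H; [constructor 1|constructor 3].
rewrite eq_sym in st; case: (key t s le st) => H; [by constructor 2|constructor 3].
by have := insd_compl H; rewrite setCK negbK.
Qed.

Lemma mu_x0 : mu x0 = tau F (pent F).
Proof. by congr (tau F _); apply/setP=> z; rewrite !in_sd addbb addbF. Qed.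

Lemma lset_conn s : conn F (lset s).
Proof. exact: lcomps_conn (lset_in s). Qed.

Lemma tau_ineq : 5 * tau F (pent F) ^ 2 <= 12 * #|F|.
Proof.
have := packing_ineq PT D56 lset_conn lset_odd lset_lam.
rewrite card_lidx mu_x0 expnMn => H.
have : #|touched F lset| <= #|F|.
  by apply: subset_leq_card; apply/subsetP=> t; rewrite inE => /andP[].
by move: H; clear; lia.
Qed.

Lemma tau_tight : 5 * tau F (pent F) ^ 2 = 12 * #|F| ->
  exists (I : finType) (S : I -> {set V}) (n : I -> bool),
  [/\ forall s, pcnt F (S s) = 1,
      forall s t, s != t -> [\/ insd F (S s) (n s) (S t) (n t),
         insd F (S t) (n t) (S s) (n s) | insd F (S s) (n s) (~: S t) (~~ n t)] &
      forall t, t \in pent F -> 12 * #|[set s | t \in S s]| = 2 * tau F (pent F)].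
Proof.
move=> Eq; have [|S [n [H1 H2 H3]]] := packing_eq PT D56 lset_conn lset_odd lset_lam.
  by rewrite card_lidx mu_x0 expnMn; move: Eq; clear; lia.
by exists {: lidx}, S, n; split=> // t /H3->; rewrite card_lidx mu_x0.
Qed.

End Levels.

(** * Distances between vertices of degree five *)

Section Balls.
Variables (V : finType) (F : {set {set V}}).
Hypothesis PT : plane_triangulation F.
Hypothesis D56 : forall v : V, tri_deg F v = 5 \/ tri_deg F v = 6.

Fixpoint ball (t : V) (r : nat) : {set V} :=
  if r is r'.+1 then ball t r' :|: [set y | [exists x in ball t r', tri_adj F x y]] else [set t].

Lemma ballS t r x y : x \in ball t r -> tri_adj F x y -> y \in ball t r.+1.
Proof. by move=> xB xy; rewrite /= !inE; apply/orP; right; apply/exists_inP; exists x. Qed.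

Lemma ball_sub t r r' : r <= r' -> ball t r \subset ball t r'.
Proof.
elim: r' => [|r' IH]; first by rewrite leqn0 => /eqP->.
rewrite leq_eqVlt => /orP[/eqP->//|/IH s]; apply: subset_trans s _.
exact: subsetUl.
Qed.

Lemma ball_self t r : t \in ball t r.
Proof. by apply: (subsetP (ball_sub t (leq0n r))); rewrite inE. Qed.

Lemma ballP t r y : reflect (exists p, [/\ path (tri_adj F) t p, last t p = y & size p <= r]) (y \in ball t r).
Proof.
apply: (iffP idP).
  elim: r y => [|r IH] y /=; first by rewrite inE => /eqP->; exists [::].
  rewrite !inE => /orP[/IH[p [pp lp sp]]|/exists_inP[x /IH[p [pp lp sp]] xy]].
    by exists p; split=> //; apply: leqW.
  by exists (rcons p y); rewrite rcons_path last_rcons size_rcons pp lp; split.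
case=> p [pp lp sp]; apply: (subsetP (ball_sub t sp)); move: pp lp {sp}.
elim/last_ind: p y => [|p z IH] y; first by move=> _ <-; rewrite inE.
rewrite rcons_path last_rcons size_rcons => /andP[pp pz] <-.
exact: ballS (IH _ pp erefl) pz.
Qed.

Lemma ball_trans t u v n m : u \in ball t n -> v \in ball u m -> v \in ball t (n + m).
Proof.
move/ballP=> [p [pp lp sp]] /ballP[q [qq lq sq]]; apply/ballP; exists (p ++ q).
by rewrite cat_path pp lp last_cat lp size_cat leq_add.
Qed.

Lemma ball_sym t u n : u \in ball t n -> t \in ball u n.
Proof.
elim: n u => [|n IH] u /=; first by rewrite !inE eq_sym.
rewrite !inE => /orP[/IH uB|/exists_inP[x /IH xB xu]]; first by rewrite uB.
have : t \in ball u (1 + n).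
  apply: ball_trans xB; apply: (@ballS u 0 u); first by rewrite inE.
  by rewrite adj_sym.
by rewrite add1n /= !inE.
Qed.

Lemma ball_conn t r : conn F (ball t r).
Proof.
apply: (conn_star (ball_self t r)) => u uB; exists (ball t r).
suff H r' : forall x, x \in ball t r' -> exists C, [/\ conn F C, C \subset ball t r', x \in C & t \in C].
  have [C [cC sC uC tC]] := H r u uB; split=> //; last exact: ball_self.
  by apply: (conn_star (ball_self t r)) => w wB; apply: H.
elim: r' => [|r' IH] x /=; first by move/set1P->; exists [set t]; rewrite set11; split=> //; apply: conn_set1.
rewrite in_setU => /orP[/IH[C [cC sC xC tC]]|].
  by exists C; split=> //; apply: subset_trans sC (subsetUl _ _).
rewrite inE => h; have /exists_inP[y /IH[C [cC sC yC tC]] yx] := h.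
exists (C :|: [set x]); split.
- exact: (conn_setU cC (@conn_set1 _ F x) yC (set11 x) yx).
- by rewrite subUset (subset_trans sC (subsetUl _ _)) sub1set !in_setU inE h orbT.
- by rewrite in_setU set11 orbT.
- by rewrite in_setU tC.
Qed.

Definition far k := forall t u n, t \in pent F -> u \in pent F -> t != u -> u \in ball t n -> 2 * k <= n.

(** A path from [t] to [u] leaves the [2 * k] sets at [t] and enters the [2 * k] sets at [u]. No two
    of these boundaries can cross the path on the same half edge, so it has at least [2 * k]
    edges. *)
Lemma tight_far k : tau F (pent F) = 12 * k -> #|F| = 60 * k ^ 2 -> far k.
Proof.
move=> Et Ef; have [x0 _] : exists x0 : V, x0 \in pent F by apply/card_gt0P; rewrite (card_pent PT D56).
have [|I [S [n [S1 Slam Scnt]]]] := tau_tight PT D56 x0; first by rewrite Et Ef expnMn; lia.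
have cnt t : t \in pent F -> #|[set s | t \in S s]| = 2 * k.
  by move=> /Scnt; rewrite Et; clear; lia.
move=> t u m tT uT ntu /ballP[p [pp lp sp]].
have two s : t \in S s -> u \in S s -> False.
  move=> ts us; have : [set t; u] \subset S s :&: pent F.
    by apply/subsetP=> w /set2P[]->; rewrite inE ?ts ?us ?tT ?uT.
  by move/subset_leq_card; rewrite cards2 ntu -/(pcnt F _) S1.
pose x i := nth t (t :: p) i.
pose L := size p.
have xL : x L = u by rewrite /x /L -[size p]/((size (t :: p)).-1) nth_last.
have xadj i : i < L -> tri_adj F (x i) (x i.+1).
  by move=> iL; have /(pathP t)/(_ i iL) := pp.
pose A := [set s | t \in S s]; pose B := [set s | u \in S s].
pose chg s := find (fun i => (x i \in S s) != (x i.+1 \in S s)) (iota 0 L).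
have chgP s : s \in A :|: B -> [/\ chg s < L, (x (chg s) \in S s) = (t \in S s)
    & (x (chg s).+1 \in S s) = ~~ (t \in S s)].
  move=> sAB; pose a i := (x i \in S s) != (x i.+1 \in S s).
  have ends : (x 0 \in S s) != (x L \in S s).
    rewrite xL /x /=; move: sAB; rewrite !inE; case: (boolP (t \in S s)) => ts; case: (boolP (u \in S s)) => us //=.
    by have := two s ts us.
  have const j : (forall i, i < j -> ~~ a i) -> (x j \in S s) = (x 0 \in S s).
    elim: j => // j IH H; rewrite -IH => [|i ij]; last by apply: H; apply: ltnW.
    by have := H j (ltnSn j); rewrite negbK => /eqP.
  have hs : has a (iota 0 L).
    apply: contraNT ends => /hasPn H; rewrite (const L) ?eqxx // => i iL.
    by apply: H; rewrite mem_iota.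
  have fL : chg s < L by move: hs; rewrite has_find size_iota.
  have nthE i : i < L -> nth 0 (iota 0 L) i = i by move=> iL; rewrite nth_iota.
  have before i : i < chg s -> ~~ a i.
    by move=> ic; have := before_find 0 ic; rewrite nthE ?(ltn_trans ic) // => /negbT.
  have e0 : (x (chg s) \in S s) = (t \in S s) by rewrite (const _ before).
  have := nth_find 0 hs; rewrite -/(chg s) nthE // /a e0.
  by move=> b; split=> //; move: b; case: (t \in S s); case: (x _ \in S s).
(* The number of the half edge of the path where it crosses the boundary of [S s]. With [n s] the
   boundary runs next to the end inside [S s]: first half on leaving, second half on entering. *)
pose code s := 2 * chg s + (if t \in S s then ~~ n s else n s).
have codeL s : s \in A :|: B -> code s < 2 * L.
  by case/chgP=> lt _ _; rewrite /code; case: (if _ then _ else _); move: lt; clear; lia.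
have inj : {in A :|: B &, injective code}.
  move=> s s' sAB s'AB Ec; apply/eqP; apply/negPn/negP=> ne.
  have [l1 a1 b1] := chgP s sAB; have [l2 a2 b2] := chgP s' s'AB.
  have [Ei Eb] : chg s = chg s' /\
      (if t \in S s then ~~ n s else n s) = (if t \in S s' then ~~ n s' else n s').
    move: Ec; rewrite /code.
    by case: (if _ then _ else _); case: (if _ then _ else _); clear; lia.
  rewrite -Ei in a2 b2 l2; have xa := xadj _ l1.
  have xa' : tri_adj F (x (chg s).+1) (x (chg s)) by rewrite adj_sym.
  have uS w : w \in A :|: B -> t \notin S w -> u \in S w by rewrite !inE => /orP[->|].
  move: a1 b1 a2 b2 Eb; case: (boolP (t \in S s)) => ts; case: (boolP (t \in S s')) => ts' /= a1 b1 a2 b2 Eb.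
  - case: (Slam s s' ne) => -[sub H].
    + by have := H _ _ a1 (negbT b2) xa; move: Eb; case: (n s); case: (n s').
    + by have := H _ _ a2 (negbT b1) xa; move: Eb; case: (n s); case: (n s').
    + by have := subsetP sub _ ts; rewrite inE ts'.
  - have us' := uS s' s'AB ts'.
    case: (Slam s s' ne) => -[sub H].
    + by rewrite (subsetP sub _ ts) in ts'.
    + by have := two s ts (subsetP sub _ us').
    + have := H _ _ a1 _ xa; rewrite inE b2 => /(_ isT); move: Eb; case: (n s); case: (n s') => //.
  - have us := uS s sAB ts.
    case: (Slam s s' ne) => -[sub H].
    + by have := two s' ts' (subsetP sub _ us).
    + by rewrite (subsetP sub _ ts') in ts.
    + by have := H _ _ b1 _ xa'; rewrite inE a2 => /(_ isT); move: Eb; case: (n s); case: (n s').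
  - have us := uS s sAB ts; have us' := uS s' s'AB ts'.
    case: (Slam s s' ne) => -[sub H].
    + by have := H _ _ b1 (negbT a2) xa'; move: Eb; case: (n s); case: (n s').
    + by have := H _ _ b2 (negbT a1) xa'; move: Eb; case: (n s); case: (n s').
    + by have := subsetP sub _ us; rewrite inE us'.
have cAB : #|A :|: B| = 2 * k + 2 * k.
  rewrite cardsU !cnt // (_ : A :&: B = set0) ?cards0 ?subn0 //.
  by apply/setP=> s; rewrite !inE; apply/negP=> /andP[ts us]; apply: two ts us.
have : #|A :|: B| <= 2 * L.
  have [L0|L0] := posnP (2 * L).
    rewrite L0 leqn0 cards_eq0; apply/eqP/setP=> s; rewrite [RHS]inE; apply/negP=> /codeL.
    by rewrite L0.
  rewrite -[2 * L]card_ord -(prednK L0).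
  pose g s : 'I_((2 * L).-1.+1) := inord (code s).
  rewrite -(card_in_imset (f := g)) ?max_card // => s s' sAB s'AB /(congr1 val).
  by rewrite /= !inordK ?prednK ?codeL // => /(inj _ _ sAB s'AB).
by rewrite cAB; move: sp; rewrite /L; clear; lia.
Qed.

(** * Cuts and packings by balls *)

Section Far.
Variable k : nat.
Hypothesis farK : far k.

Lemma ball_pent t r : t \in pent F -> r < 2 * k -> ball t r :&: pent F = [set t].
Proof.
move=> tT rk; apply/setP=> u; rewrite !inE; apply/andP/eqP => [[uB uT]|->].
  apply/eqP; apply/negPn/negP=> ne; have := @farK t u r tT; rewrite inE uT eq_sym ne uB => /(_ isT isT isT).
  by rewrite leqNgt rk.
by move: tT; rewrite inE ball_self.
Qed.

(** A ball of radius below [k] contains one vertex of [pent F], so any join crosses it. Balls about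
    different centres are too far apart to share a cut edge, and concentric ones have disjoint
    cuts. *)
Lemma far_tau : 12 * k <= tau F (pent F).
Proof.
have ev : ~~ odd #|pent F| by rewrite (card_pent PT D56).
have [J [sJ bJ <-]] := tau_ex PT ev.
pose Q := [set p : V * 'I_k | p.1 \in pent F].
have cQ : #|Q| = 12 * k.
  have -> : Q = setX (pent F) setT by apply/setP=> p; rewrite !inE andbT.
  by rewrite cardsX cardsT card_ord (card_pent PT D56).
have exE p : p \in Q -> exists e, e \in crs (ball p.1 p.2) J.
  rewrite inE => tT; apply/card_gt0P; case: (posnP #|crs (ball p.1 p.2) J|) => // c0.
  have := odd_crs (edge2 PT) (ball p.1 p.2) sJ; rewrite c0 bJ setIC ball_pent ?cards1 //.
  by have := ltn_ord p.2; clear; lia.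
pose f (p : V * 'I_k) := odflt set0 [pick e in crs (ball p.1 p.2) J].
have fP p : p \in Q -> f p \in crs (ball p.1 p.2) J.
  by move=> /exE[e ec]; rewrite /f; case: pickP => [//|/(_ e)]; rewrite ec.
rewrite -cQ -(card_in_imset (f := f)); last first.
  move=> [t r] [u r'] /= pQ qQ Ef.
  have [x [y [Ee xB yB nxy eJ]]] := crsE (edge2 PT) sJ (fP _ pQ).
  have [x' [y' [Ee' xB' yB' nxy' _]]] := crsE (edge2 PT) sJ (fP _ qQ).
  rewrite /= in xB yB xB' yB'.
  have xy : tri_adj F x y by have := subsetP sJ _ eJ; rewrite Ee.
  have xy' : tri_adj F x' y' by have := subsetP sJ _ eJ; rewrite Ef Ee'.
  have xin : x' = x \/ x' = y.
    by have := set21 x' y'; rewrite -Ee' -Ef Ee => /set2P.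
  have yin : y' = x \/ y' = y.
    by have := set22 x' y'; rewrite -Ee' -Ef Ee => /set2P.
  have pT : t \in pent F by move: pQ; rewrite inE.
  have qT : u \in pent F by move: qQ; rewrite inE.
  have [Etu|ntu] := eqVneq t u.
    subst u; congr (_, _); apply/eqP; rewrite -val_eqE; apply/negPn/negP=> /= ne.
    have key (a b : nat) w z : a < b -> w \in ball t a -> tri_adj F w z -> z \in ball t b.
      by move=> ab wB wz; apply: (subsetP (ball_sub t ab)); apply: ballS wB wz.
    move: ne; rewrite neq_ltn => /orP[lt|lt].
      have yb := key r r' x y lt xB xy; have xb := subsetP (ball_sub t (ltnW lt)) _ xB.
      by case: yin => E; rewrite E ?yb ?xb in yB'.
    have yb := key r' r x' y' lt xB' xy'; have xb := subsetP (ball_sub t (ltnW lt)) _ xB'.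
    have : y = x' \/ y = y' by have := set22 x y; rewrite -Ee Ef Ee' => /set2P.
    by case=> E; rewrite E ?yb ?xb in yB.
  have x'B : x' \in ball t r.+1.
    by case: xin => ->; [apply: (subsetP (ball_sub t (leqnSn r)))|apply: ballS xB xy].
  have := farK pT qT ntu (ball_trans x'B (ball_sym xB')).
  by have := ltn_ord r; have := ltn_ord r'; clear; lia.
apply: subset_leq_card; apply/subsetP=> e /imsetP[p pQ ->].
by have := fP p pQ; rewrite inE => /andP[].
Qed.

(** With both flags the balls form [24 * k] sets, and [5 * (24 * k) ^ 2 = 48 * (60 * k ^ 2)]: the
    packing inequality is tight for them too. *)
Definition ball_index := ({u : V | u \in pent F} * 'I_k * bool)%type.
Definition ball_set (s : ball_index) := ball (val s.1.1) s.1.2.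

Lemma card_ball_index : #|{: ball_index}| = 24 * k.
Proof.
rewrite !card_prod card_bool card_ord card_sig.
rewrite (_ : #|[pred u | u \in pent F]| = 12); first by clear; lia.
by rewrite -(card_pent PT D56); apply: eq_card.
Qed.

Lemma ball_set_odd s : odd (pcnt F (ball_set s)).
Proof.
rewrite /pcnt ball_pent ?cards1 //; first exact: (valP s.1.1).
by have := ltn_ord s.1.2; clear; lia.
Qed.

Lemma ball_set_lam (s s' : ball_index) : s != s' ->
  [\/ insd F (ball_set s) s.2 (ball_set s') s'.2, insd F (ball_set s') s'.2 (ball_set s) s.2
    | insd F (ball_set s) s.2 (~: ball_set s') (~~ s'.2)].
Proof.
move: s s' => [[u r] b] [[u' r'] b'] ne; rewrite /ball_set /=.
have [Eu|nu] := eqVneq u u'.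
  subst u'.
  have key (a c : nat) d d' : a < c -> insd F (ball (val u) a) d (ball (val u) c) d'.
    move=> ac; split; first exact: ball_sub (ltnW ac).
    move=> x y xB yB xy; case/negP: yB; apply: (subsetP (ball_sub _ ac)); exact: ballS xB xy.
  have [Er|nr'] := eqVneq r r'.
    subst r'; have nb : b != b' by apply: contraNneq ne => ->.
    by case: b b' nb {ne} => [] [] // _; [constructor 1|constructor 2]; split.
  move: nr'; rewrite -val_eqE neq_ltn => /orP[h|h]; [constructor 1|constructor 2]; exact: key.
have nuv : val u != val u' by rewrite val_eqE.
have fr := farK (valP u) (valP u') nuv.
constructor 3; split.
  apply/subsetP=> x xB; rewrite inE; apply/negP=> xB'.
  have := fr (r + r'); rewrite (ball_trans xB (ball_sym xB')) => /(_ isT).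
  by have := ltn_ord r; have := ltn_ord r'; clear; lia.
move=> x y xB; rewrite inE negbK => yB xy.
have := fr (r.+1 + r'); rewrite (ball_trans (ballS xB xy) (ball_sym yB)) => /(_ isT).
by have := ltn_ord r; have := ltn_ord r'; clear; lia.
Qed.

Lemma ball_comp t a : #|F| = 60 * k ^ 2 -> t \in pent F -> a < k ->
  exists2 K, K \in comps F (~: ball t a) & pcnt F K = 1 \/ pcnt F (~: K) = 1.
Proof.
move=> Ef tT ak; pose s : ball_index := (Sub t tT, Ordinal ak, true).
apply: (packing_comp PT D56 _ ball_set_odd ball_set_lam s) => [s'|]; first exact: ball_conn.
by rewrite card_ball_index Ef expnMn; clear; lia.
Qed.

(** Since the packing by balls is tight, every face is touched by some ball. *)
Lemma far_cover : #|F| = 60 * k ^ 2 -> forall t, t \in F ->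
  exists2 u, u \in pent F & ~~ [disjoint t & ball u k.-1].
Proof.
move=> Ef t tF; pose D := ball_set.
have H : 5 * #|{: ball_index}| ^ 2 <= 48 * #|touched F D|.
  by apply: (packing_ineq PT D56 _ ball_set_odd ball_set_lam) => s; apply: ball_conn.
rewrite card_ball_index in H.
have sub : touched F D \subset F by apply/subsetP=> s; rewrite inE => /andP[].
have : touched F D == F.
  by rewrite eqEcard sub; move: H Ef; rewrite expnMn; clear; lia.
move/eqP/setP/(_ t); rewrite tF inE tF /= => /existsP[s]; rewrite /D => /pred0Pn[x /andP[xt xB]].
exists (val s.1.1); first exact: (valP s.1.1).
apply/pred0Pn; exists x; rewrite /= [x \in t]xt; apply: (subsetP (ball_sub _ _)) xB.
by rewrite -ltnS (ltn_predK (ltn_ord s.1.2)).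
Qed.

End Far.
End Balls.

(** * Flags *)

Lemma iter_cancel (T : Type) (f g : T -> T) n : cancel f g -> cancel (iter n f) (iter n g).
Proof. by move=> fK; elim: n => // n IH d; rewrite iterSr iterS fK IH. Qed.

Section Flags.
Variables (V : finType) (F : {set {set V}}).
Hypothesis PT : plane_triangulation F.
Hypothesis D56 : forall v : V, tri_deg F v = 5 \/ tri_deg F v = 6.

Definition flag := {p : V * V * V | face F p.1.1 p.1.2 p.2}.
Definition mkflag x y z (f : face F x y z) : flag := Sub (x, y, z) f.
Definition fx (d : flag) := (val d).1.1.
Definition fy (d : flag) := (val d).1.2.
Definition fz (d : flag) := (val d).2.

Lemma flagF (d : flag) : face F (fx d) (fy d) (fz d).
Proof. exact: valP d. Qed.

Lemma flag_eq (d e : flag) : fx d = fx e -> fy d = fy e -> fz d = fz e -> d = e.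
Proof.
by move=> h1 h2 h3; apply: val_inj; case: d h1 h2 h3 => -[[a b] c] i; case: e => -[[a' b'] c'] j /= *;
  congr (_, _, _).
Qed.

Fact s0_proof (d : flag) : face F (fy d) (fx d) (fz d).
Proof. by rewrite face_swap12 flagF. Qed.
Fact s1_proof (d : flag) : face F (fx d) (fz d) (fy d).
Proof. by rewrite face_swap23 flagF. Qed.
Fact s2_proof (d : flag) : face F (fx d) (fy d) (opp F (fx d) (fy d) (fz d)).
Proof. exact: (opp_face PT (flagF d)). Qed.

Definition s0 (d : flag) : flag := mkflag (s0_proof d).
Definition s1 (d : flag) : flag := mkflag (s1_proof d).
Definition s2 (d : flag) : flag := mkflag (s2_proof d).

Lemma s0K : involutive s0. Proof. by move=> d; apply: flag_eq. Qed.
Lemma s1K : involutive s1. Proof. by move=> d; apply: flag_eq. Qed.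
Lemma s2K : involutive s2.
Proof. by move=> d; apply: flag_eq => //=; rewrite /fz /= -/(fz d) (oppK PT (flagF d)). Qed.
Lemma s02 d : s0 (s2 d) = s2 (s0 d).
Proof. by apply: flag_eq => //=; rewrite /fz /= (opp_sym PT (flagF d)). Qed.

Definition xx d := s1 (s0 d).
Definition rr d := s2 (s1 d).
Definition ri d := s1 (s2 d).

Lemma rrK : cancel rr ri. Proof. by move=> d; rewrite /rr /ri s2K s1K. Qed.
Lemma riK : cancel ri rr. Proof. by move=> d; rewrite /rr /ri s1K s2K. Qed.
Lemma rr_inj : injective rr. Proof. exact: can_inj rrK. Qed.
Lemma fx_iter n d : fx (iter n rr d) = fx d.
Proof. by elim: n => //= n ->. Qed.
Lemma fy_rr d : fy (rr d) = fz d. Proof. by []. Qed.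

Lemma s2_rr d : s2 (rr d) = ri (s2 d).
Proof. by rewrite /rr /ri !s2K. Qed.

Lemma s2_iter n d : s2 (iter n rr d) = iter n ri (s2 d).
Proof. by elim: n => //= n IH; rewrite s2_rr IH. Qed.

Lemma fz_neq d : fy d != fz d.
Proof. by have /and3P[] := face_neq PT (flagF d). Qed.
Lemma s2_neq d : fz (s2 d) != fz d.
Proof. exact: (opp_neq PT (flagF d)). Qed.

Lemma same_edge d e : fx d = fx e -> fy d = fy e -> e = d \/ e = s2 d.
Proof.
move=> h1 h2; have fe := flagF e; rewrite -h1 -h2 in fe.
have [_ _ /(_ _ fe)[h|h]] := opp_spec PT (flagF d); [left|right]; exact: flag_eq.
Qed.

(** [s2] turns the rotation into its inverse. Halving [n] would therefore yield a flag on which [s2]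
    agrees with the identity or with [rr], which is impossible. *)
Lemma rr_not_s2 n d : iter n rr d <> s2 d.
Proof.
have iter_add a b e : iter a rr (iter b rr e) = iter (a + b) rr e by rewrite iterD.
have mv m e f : iter m rr e = f -> e = iter m ri f.
  by move=> <-; rewrite (iter_cancel m rrK).
move=> E; have [j En] : exists j, n = j + j \/ n = (j + j).+1.
  by exists n./2; have := odd_double_half n; rewrite -addnn; case: (odd n); lia.
case: En => En; rewrite En in E.
  have : iter j rr d = s2 (iter j rr d) by rewrite s2_iter -E iterD; apply: mv.
  by move/(congr1 fz)/esym/eqP; rewrite (negPf (s2_neq _)).
have : rr (iter j rr d) = s2 (iter j rr d).
  by rewrite s2_iter -E -iterS -[(j + j).+1]addnS iterD; apply: mv.
move/(congr1 fy); rewrite fy_rr => E2.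
by have /eqP[] := fz_neq (iter j rr d); rewrite E2.
Qed.

Lemma targets d w : tri_adj F (fx d) w -> exists m, fy (iter m rr d) = w.
Proof.
pose A := [set w | [exists m : 'I_(fingraph.order rr d), fy (iter m rr d) == w]].
have inA m : fy (iter m rr d) \in A.
  rewrite inE; have mo : m %% fingraph.order rr d < fingraph.order rr d by rewrite ltn_mod.
  apply/existsP; exists (Ordinal mo); apply/eqP; congr fy => /=.
  rewrite [in RHS](divn_eq m (fingraph.order rr d)) addnC iterD; congr (iter _ _ _).
  elim: (m %/ _) => // q IH; rewrite mulSn addnC iterD (iter_order rr_inj) //.
move=> aw; suff : w \in A by rewrite inE => /existsP[m /eqP]; exists m.
apply: (closed_link PT (face_adj12 PT (flagF d)) (inA 0) _ aw) => b c.
rewrite inE => /existsP[m /eqP<-]; rewrite -(fx_iter m d) => f.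
have [_ _ /(_ _ f)[->|->]] := opp_spec PT (flagF (iter m rr d)).
  exact: (inA m.+1).
have -> : opp F (fx (iter m rr d)) (fy (iter m rr d)) (fz (iter m rr d)) = fy (ri (iter m rr d)) by [].
case: (nat_of_ord m) => [|m'] /=; last by rewrite rrK.
have -> : ri d = iter (fingraph.order rr d).-1 rr d.
  by apply: rr_inj; rewrite riK -iterS prednK ?order_gt0 // (iter_order rr_inj).
exact: inA.
Qed.

(** The second vertices along the orbit are all the neighbours, by [targets], without repetition, by
    [rr_not_s2]. *)
Lemma order_deg d : fingraph.order rr d = tri_deg F (fx d).
Proof.
rewrite /tri_deg -size_orbit -(size_map fy).
have u : uniq (map fy (fingraph.orbit rr d)).
  rewrite map_inj_in_uniq ?orbit_uniq // => e f; rewrite -!fconnect_orbit => /iter_findex<- /iter_findex<-.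
  set a := findex _ _ _; set b := findex _ _ _; clearbody a b => E.
  have Ex : fx (iter a rr d) = fx (iter b rr d) by rewrite !fx_iter.
  have [->|Eab] := same_edge Ex E; first by [].
  exfalso; have [le|/ltnW le] := leqP a b.
    by apply: (@rr_not_s2 (b - a) (iter a rr d)); rewrite -iterD subnK.
  by apply: (@rr_not_s2 (a - b) (iter b rr d)); rewrite -iterD subnK // Eab s2K.
rewrite -(card_uniqP u); apply: eq_card => w; rewrite inE; apply/mapP/idP => [[e]|/targets[m <-]].
  rewrite -fconnect_orbit => /iter_findex<- ->.
  by rewrite -(fx_iter (findex rr d e) d); apply: (face_adj12 PT (flagF _)).
by exists (iter m rr d); rewrite // -fconnect_orbit fconnect_iter.
Qed.

Lemma rr_deg d : iter (tri_deg F (fx d)) rr d = d.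
Proof. by rewrite -order_deg (iter_order rr_inj). Qed.

Lemma same_vertex d e : fx d = fx e -> exists m, e = iter m rr d \/ e = iter m rr (s2 d).
Proof.
move=> E; have ae : tri_adj F (fx d) (fy e) by rewrite E; apply: (face_adj12 PT (flagF e)).
have [m Em] := targets ae.
case: (@same_edge (iter m rr d) e); rewrite ?fx_iter // => ->; first by exists m; left.
exists ((m * (tri_deg F (fx d)).-1)); right; rewrite s2_iter.
have dpos : 0 < tri_deg F (fx d) by case: (D56 (fx d)) => ->.
have Ek q f : iter (q * tri_deg F (fx f)) rr f = f.
  by elim: q => //= q IH; rewrite mulSn addnC iterD rr_deg.
have -> : iter m ri (s2 d) = iter m ri (iter (m * tri_deg F (fx d)) rr (s2 d)).
  by rewrite -[fx d]/(fx (s2 d)) Ek.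
have -> : m * tri_deg F (fx d) = m + m * (tri_deg F (fx d)).-1.
  by rewrite -mulnS prednK.
by rewrite iterD (iter_cancel m rrK).
Qed.

Lemma flag_ind (P : flag -> Prop) d : P d -> (forall e, P e -> P (s0 e)) ->
  (forall e, P e -> P (s1 e)) -> (forall e, P e -> P (s2 e)) -> forall e, P e.
Proof.
move=> Pd P0 P1 P2.
have Pr m e : P e -> P (iter m rr e) by elim: m => //= m IH /IH; move/P1/P2.
have Pv e f : fx e = fx f -> P e -> P f.
  by case/same_vertex=> m [->|->] Pe; apply: Pr => //; apply: P2.
suff H v : exists2 e, fx e = v & P e by move=> e; have [f E Pf] := H (fx e); apply: Pv E Pf.
have /connectP[p] := graph_connect PT (fx d) v; elim: p d Pd => [|w p IH] e Pe /=.
  by move=> _ ->; exists e.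
case/andP=> ew pp Ev; have [z f] := adjP PT _ _ ew.
have Pf : P (mkflag f) by apply: Pv Pe.
by apply: (IH (s0 (mkflag f))) => //; apply: P0.
Qed.

Lemma vertex_flag v : exists d : flag, fx d = v.
Proof. by have [a [b f]] := vertex_face PT v; exists (mkflag f). Qed.

Lemma card_flags : #|{: flag}| = 6 * #|F|.
Proof.
rewrite card_sig.
transitivity (\sum_(x : V) \sum_(y : V | tri_adj F x y) #|[set z | face F x y z]|).
  rewrite pair_big_dep /=; under eq_bigr => p _ do rewrite -sum1_card.
  rewrite pair_big_dep /= -[LHS]sum1_card; apply: eq_bigl => -[[x y] z] /=; rewrite inE.
  by rewrite andb_idl // => /(face_adj12 PT).
transitivity (\sum_(x : V) 2 * tri_deg F x).
  apply: eq_bigr => x _; rewrite (eq_bigr (fun=> 2)) => [|y xy]; last exact: card_link.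
  by rewrite sum_nat_const mulnC; congr (2 * _); apply: eq_card => y; rewrite inE.
rewrite -big_distrr /=.
have := sum_deg PT [set: V]; rewrite (eq_bigl predT) => [|v]; last by rewrite inE.
move=> ->; rewrite (card_faces PT [set: V]).
have Z j : j != 3 -> nfc F setT j = 0.
  move=> nj; apply: eq_card0 => t; rewrite !inE setIT.
  by apply/negP=> /andP[/(card_face PT) -> /eqP E]; move: nj; rewrite -E.
by rewrite (Z 0) // (Z 1) // (Z 2) //; lia.
Qed.

Lemma card_star v : #|[set d : flag | fx d == v]| = 2 * tri_deg F v.
Proof.
have [d Ed] := vertex_flag v.
have -> : [set e : flag | fx e == v] = [set e in fingraph.orbit rr d ++ fingraph.orbit rr (s2 d)].
  apply/setP=> e; rewrite !inE mem_cat -!fconnect_orbit; apply/eqP/orP => [Ee|[]/iter_findex<-].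
  - have [m [->|->]] : exists m, e = iter m rr d \/ e = iter m rr (s2 d).
      by apply: same_vertex; rewrite Ed.
    by left; apply: fconnect_iter.
    by right; apply: fconnect_iter.
  - by rewrite fx_iter.
  - by rewrite fx_iter.
rewrite cardsE (card_uniqP _); first by rewrite size_cat !size_orbit !order_deg -[fx (s2 d)]/(fx d) Ed mul2n -addnn.
rewrite cat_uniq !orbit_uniq andbT; apply/hasPn=> e; rewrite -!fconnect_orbit => /iter_findex<-.
apply/negP=> /iter_findex; set a := findex _ _ _; set b := findex _ _ _; clearbody a b => E.
have Ek q f : iter (q * tri_deg F (fx f)) rr f = f.
  by elim: q => //= q IH; rewrite mulSn addnC iterD rr_deg.
apply: (@rr_not_s2 (b * (tri_deg F (fx d)).-1 + a) d).
rewrite iterD E -iterD -[fx d]/(fx (s2 d)) addnC -mulnS prednK ?Ek //.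
by case: (D56 (fx (s2 d))) => ->.
Qed.

Definition pflag := [set d : flag | fx d \in pent F].

Lemma card_pflag : #|pflag| = 120.
Proof.
transitivity (\sum_(v in pent F) #|[set d : flag | fx d == v]|).
  rewrite -sum1_card (partition_big fx (mem (pent F))) /=; last by move=> d; rewrite inE.
  apply: eq_bigr => v vT; rewrite sum1_card; apply: eq_card => d.
  by rewrite [LHS]unfold_in [RHS]inE andb_idl // => /eqP E; rewrite inE E.
rewrite (eq_bigr (fun=> 10)) => [|v]; first by rewrite sum_nat_const (card_pent PT D56).
by rewrite card_star inE => /eqP->.
Qed.

Definition fset (d : flag) := [set fx d; fy d; fz d].

Lemma card_fset (t : {set V}) : t \in F -> 6 <= #|[set d : flag | fset d == t]|.
Proof.
move=> tF; have [x [y [z Et]]] := faceP PT tF; rewrite Et in tF *.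
pose d : flag := mkflag tF.
pose l := [:: d; xx d; xx (xx d); s1 d; xx (s1 d); xx (xx (s1 d))].
have u : uniq l.
  apply: (@map_uniq _ _ (fun e => (fx e, fy e))).
  have /and3P[n1 n2 n3] := face_neq PT tF.
  rewrite /= !inE !xpair_eqE /fx /fy /=.
  by rewrite !(negPf n1, negPf n2, negPf n3, eq_sym y x, eq_sym z x, eq_sym z y, andbF, eqxx).
have <- : size l = 6 by []; rewrite -(card_uniqP u); apply: subset_leq_card; apply/subsetP=> e.
have perm6 (w : flag) : (fset (xx w) = fset w) * (fset (s1 w) = fset w).
  by split; [exact/esym/set3_rot|exact/esym/set3_swap23].
rewrite !inE => el; apply/eqP; have -> : [set x; y; z] = fset d by [].
by move: el; do 5?[case/orP]; move/eqP->; rewrite ?perm6.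
Qed.

End Flags.

(** * Separating triangles and the size of balls *)

Section Cliques.
Variables (V : finType) (F : {set {set V}}).
Hypothesis PT : plane_triangulation F.
Hypothesis D56 : forall v : V, tri_deg F v = 5 \/ tri_deg F v = 6.

Lemma nfc2_ge2 (X : {set V}) x y v : conn F X -> x \in X -> y \in X -> x != y -> v \notin X ->
  2 <= nfc F X 2.
Proof.
move=> cX xX yX nxy vX; have [b bB] := bdry_ex PT xX vX.
have bX : b \in X by case/bdryP: bB.
have [c cX' nbc] : exists2 c, c \in X & c != b.
  by have [E|ne] := eqVneq x b; [exists y; rewrite // -E eq_sym|exists x].
have [u [w [_ /set1P-> wX _ bw]]] : exists u w, [/\ u \in X, u \in [set b], w \in X, w \notin [set b] & tri_adj F u w].
  by apply: (conn_exit cX bX (set11 b) cX'); rewrite inE.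
apply: leq_trans (link_crossing PT bB (ex_intro2 _ _ w wX bw)) _.
by apply: subset_leq_card; apply/subsetP=> t; rewrite !inE => /and3P[-> _ ->].
Qed.

(** Each of the other components has outer length at least 2, which cancels its share of the term
    [2 * m] in [peel]. *)
Lemma peel_comp (X K : {set V}) x y v : x \in X -> y \in X -> x != y -> v \notin X ->
  conn F X -> conn F (~: X) -> K \in comps F (interior F X) -> nfc F K 1 <= nfc F X 2.
Proof.
move=> xX yX nxy vX cX cCX KI; have := peel PT xX yX nxy vX cX cCX.
have H2 (K' : {set V}) : K' \in comps F (interior F X) -> 2 <= nfc F K' 1.
  move=> K'I; have [c1 c2 sK _ [z [zK vK]]] := interior_comps PT xX vX cX cCX K'I.
  have [b bB] := bdry_ex PT xX vX; have bX : b \in X by case/bdryP: bB.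
  have bK : b \notin K'.
    by apply: contraTN bB => /(subsetP (comps_sub K'I)) h; rewrite /bdry inE h.
  rewrite -[nfc F K' 1]/(nfc F K' (3 - 2)) -(nfcC PT) //.
  apply: (@nfc2_ge2 _ b v z); rewrite ?inE ?negbK ?bK ?vK //.
  by apply: contraNneq vX => <-.
rewrite (nfc_comps PT (interior F X)) // (big_setD1 K KI) (cardsD1 K) KI /=.
set S := \sum_(i in _ :\ _) _; set m := #|_ :\ _|.
have : m * 2 <= S.
  by rewrite /m /S -sum_nat_const; apply: leq_sum => K'; rewrite in_setD1 => /andP[_ /H2].
by clear; lia.
Qed.

Lemma interior_nfc3 (X : {set V}) z : z \in interior F X -> 5 <= nfc F X 3.
Proof.
move=> zI; have zX := subsetP (interior_sub F X) z zI.
apply: (@leq_trans (tri_deg F z)); first by case: (D56 z) => ->.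
rewrite -(card_faces_at PT) (nfc3E PT); apply: subset_leq_card; apply/subsetP=> t; rewrite !inE => /andP[tF zt].
rewrite tF; apply/subsetP=> w wt; have [->//|nw] := eqVneq w z.
by apply: (interior_adj zI); apply: (face_in_adj PT tF zt wt); rewrite eq_sym.
Qed.

Lemma pcnt_le_card (X : {set V}) : pcnt F X <= #|X|.
Proof. by apply: subset_leq_card; apply: subsetIl. Qed.

Lemma two_elems (X : {set V}) x : x \in X -> 1 < #|X| -> exists2 y, y \in X & x != y.
Proof.
move=> xX c; have /card_gt0P[y] : 0 < #|X :\ x| by move: c; rewrite (cardsD1 x X) xX; lia.
by rewrite !inE => /andP[nyx yX]; exists y => //; rewrite eq_sym.
Qed.

(** With outer length at most 3, [conn_gb] bounds the inner length by 2 and leaves too few boundary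
    vertices to exhaust [X]. An interior vertex has five inner faces, but isoperimetry allows at
    most four. *)
Lemma nfc1_ge4_small (X : {set V}) x v : x \in X -> v \notin X -> conn F X -> conn F (~: X) ->
  pcnt F X <= 5 -> 4 <= nfc F X 1.
Proof.
move=> xX vX cX cCX p5; rewrite leqNgt; apply/negP=> n4.
have G := conn_gb PT D56 xX vX cX cCX; have pX := pcnt_le_card X.
have [|y yX nxy] := two_elems xX; first lia.
have bl := card_bdry_le PT cX xX yX nxy; have cb := card_bdry F X.
have /card_gt0P[z zI] : 0 < #|interior F X| by lia.
have n5 := interior_nfc3 zI.
have := isoperimetry PT D56 (leqnn _) xX vX cX cCX p5.
have [a Ea] : exists a, 6 - pcnt F X = a.+1 by exists (5 - pcnt F X); lia.
rewrite Ea; have : nfc F X 2 + a <= 2 by lia.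
move: n5; move: (nfc F X 3) (nfc F X 2) (nat_of_bool _); clear => n l b; nia.
Qed.

(** For six vertices of degree 5 isoperimetry says nothing. Then inner and outer length agree, and
    components of outer length at least 4 contradict [peel]; with empty interior there are at most 3
    vertices. *)
Lemma nfc1_ge4 n (X : {set V}) x v : #|X| <= n -> x \in X -> v \notin X -> conn F X -> conn F (~: X) ->
  pcnt F X <= 6 -> 4 <= nfc F X 1.
Proof.
elim: n X x => [|n IH] X x cn xX vX cX cCX p6.
  by move: cn; rewrite leqn0 cards_eq0 => /eqP E; rewrite E inE in xX.
have [p5|p5] := leqP (pcnt F X) 5; first exact: nfc1_ge4_small xX vX cX cCX p5.
have G := conn_gb PT D56 xX vX cX cCX; have pX := pcnt_le_card X.
have [|y yX nxy] := two_elems xX; first lia.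
have bl := card_bdry_le PT cX xX yX nxy; have cb := card_bdry F X.
have := peel PT xX yX nxy vX cX cCX; rewrite (nfc_comps PT (interior F X)) //.
have : \sum_(K in comps F (interior F X)) 4 <= \sum_(K in comps F (interior F X)) nfc F K 1.
  apply: leq_sum => K KI; have [c1 c2 sK cK [z [zK vK]]] := interior_comps PT xX vX cX cCX KI.
  apply: (IH K z) => //; first by rewrite -ltnS (leq_trans cK cn).
  exact: leq_trans (pcntS F sK) p6.
rewrite sum_nat_const; have [m0|m0] := posnP #|comps F (interior F X)|; last first.
  by move: m0 G p6 p5; move: (\sum_(K in _) _) #|comps _ _|; clear; lia.
suff : #|interior F X| = 0 by move: cb bl G p6 p5 pX; clear; lia.
by rewrite (card_comps F); move/eqP: m0; rewrite cards_eq0 => /eqP->; rewrite big_set0.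
Qed.

(** If [K1] had outer length below 4, it would hold at least 7 vertices of degree 5. Then [K2] has
    outer length at least 4, which leaves at most 2 for [K1], and the complement of [K1] is a disc
    that violates isoperimetry. *)
Lemma clique_comps (C Z K1 K2 : {set V}) c : Z = ~: C -> c \in C -> conn F C ->
  K1 \in comps F Z -> K2 \in comps F Z -> K1 != K2 -> nfc F C 2 = 6 ->
  (forall K, K \in comps F Z -> conn F (~: K)) -> 4 <= nfc F K1 1.
Proof.
move=> EZ cC conC K1Z K2Z nK n6 coK; rewrite leqNgt; apply/negP=> n4.
have cK K : K \in comps F Z -> c \notin K.
  by move=> KZ; apply/negP=> /(subsetP (comps_sub KZ)); rewrite EZ inE cC.
have [z1 z1K] := comps_ex K1Z; have [z2 z2K] := comps_ex K2Z.
have dis z : z \in K1 -> z \notin K2.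
  move=> h1; apply: contraNN nK => h2.
  by rewrite (comps_uniq K1Z h1) (comps_uniq K2Z h2).
have p7 : 6 < pcnt F K1.
  rewrite ltnNge; apply/negP=> p6.
  by have := nfc1_ge4 (leqnn _) z1K (cK _ K1Z) (comps_conn K1Z) (coK _ K1Z) p6; lia.
have pC := pcntC PT D56 K1.
have sK2 : K2 \subset ~: K1.
  by apply/subsetP=> z h2; rewrite inE; apply/negP=> /dis; rewrite h2.
have p5 : pcnt F K2 <= 5 by have := pcntS F sK2; lia.
have k4 := nfc1_ge4_small z2K (cK _ K2Z) (comps_conn K2Z) (coK _ K2Z) p5.
have nC : nfc F Z 1 = 6 by rewrite EZ (nfcC PT) // n6.
have s6 : nfc F K1 1 + nfc F K2 1 <= 6.
  rewrite -nC (nfc_comps PT Z) // (big_setD1 K1 K1Z) /= (big_setD1 K2) /=; last first.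
    by rewrite in_setD1 eq_sym nK.
  by rewrite addnA leq_addr.
have z2C : z2 \in ~: K1 := subsetP sK2 z2 z2K.
have z2I : z2 \in interior F (~: K1).
  rewrite inE z2C /=; apply/forallP=> w; apply/implyP=> aw; rewrite inE; apply/negP=> wK1.
  have wZ := subsetP (comps_sub K1Z) w wK1.
  by have := dis _ wK1; rewrite (comps_closed K2Z z2K wZ aw).
have n5 := interior_nfc3 z2I.
have cKK : conn F (~: ~: K1) by rewrite setCK; apply: comps_conn K1Z.
have z1C : z1 \notin ~: K1 by rewrite inE negbK.
have := isoperimetry PT D56 (leqnn _) z2C z1C (coK _ K1Z) cKK; rewrite (nfcC PT K1 (isT : 2 < 4)).
have l2 : nfc F K1 1 <= 2 by lia.
have [a Ea] : exists a, 6 - pcnt F (~: K1) = a.+1 by exists (5 - pcnt F (~: K1)); lia.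
have p5C : pcnt F (~: K1) <= 5 by lia.
move=> /(_ p5C).
rewrite Ea; move: n5 l2; rewrite /=; move: (nfc F (~: K1) 3) (nfc F K1 1) (nat_of_bool _); clear => n l b; nia.
Qed.

(** A triangle that is not a face would separate: six faces have two vertices on it, so the outer
    lengths of the components of its complement add up to 6, although each is at least 4. This makes
    faces visible to the automorphisms of the graph. *)
Lemma clique_face x y z : tri_adj F x y -> tri_adj F y z -> tri_adj F x z -> face F x y z.
Proof.
move=> xy yz xz; apply/negPn/negP=> nf.
have nxy := adj_neq PT xy; have nyz := adj_neq PT yz; have nxz := adj_neq PT xz.
pose C := [set x; y; z].
have cC : #|C| = 3 by apply/eqP; rewrite card_set3 nxy nxz nyz.
have C3 : nfc F C 3 = 0.
  rewrite (nfc3E PT); apply/eqP; rewrite cards_eq0; apply/eqP/setP=> t; rewrite !inE.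
  apply/negP=> /andP[tF tC]; case/negP: nf; rewrite /face -/C.
  suff <- : t = C by [].
  by apply/eqP; rewrite eqEcard tC cC (card_face PT tF).
have adjC a b : a \in C -> b \in C -> a != b -> tri_adj F a b.
  by rewrite !inE => /orP[/orP[]|] /eqP-> /orP[/orP[]|] /eqP->; rewrite ?eqxx // => _;
    rewrite // adj_sym.
have nC : nei F C = 3.
  rewrite /nei -[RHS]/('C(3, 2)) -cC -cards_draws; apply: eq_card => e; rewrite !inE andbC.
  case eC : (e \subset C) => //=; case c2 : (#|e| == 2) => //=; have /cards2P[a [b [nab Ee]]] := c2.
  suff : tri_adj F a b by rewrite /tri_adj -Ee inE c2.
  by apply: adjC => //; apply: (subsetP eC); rewrite Ee !inE eqxx ?orbT.
have C2 : nfc F C 2 = 6 by have := nei_double PT C; rewrite nC C3; lia.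
have conC : conn F C.
  have c12 : conn F [set x; y].
    by apply: (conn_setU _ _ (set11 x) (set11 y) xy); apply: conn_set1.
  apply: (conn_setU c12 _ _ (set11 z) yz); [exact: conn_set1|by rewrite !inE eqxx orbT].
pose Z := ~: C; have xC : x \in C by rewrite !inE eqxx.
have coK K : K \in comps F Z -> conn F (~: K).
  move=> KZ.
  have CK : C \subset ~: K.
    by apply/subsetP=> c cC'; rewrite inE; apply/negP=> /(subsetP (comps_sub KZ)); rewrite inE cC'.
  apply: (conn_star (w := x)) => [|u uK]; first exact: (subsetP CK).
  have [uC|uC] := boolP (u \in C); first by exists C.
  have uZ : u \in Z by rewrite inE.
  pose K' := comp F Z u; have K'Z : K' \in comps F Z := comp_in F uZ.
  have uK' : u \in K' := comp_self F uZ.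
  have xK' : x \notin K' by apply/negP=> /(subsetP (comps_sub K'Z)); rewrite inE xC.
  have [a [b [_ aK' _ bK' ab]]] := conn_exit (conn_setT PT) (in_setT u) uK' (in_setT x) xK'.
  have bC : b \in C.
    by apply/negPn/negP=> bC; case/negP: bK'; apply: (comps_closed K'Z aK' _ ab); rewrite inE.
  exists (K' :|: C); split.
  - exact: (conn_setU (comps_conn K'Z) conC aK' bC ab).
  - rewrite subUset CK andbT; apply/subsetP=> w wK'; rewrite inE; apply/negP=> wK.
    by move: uK; rewrite inE (comps_uniq KZ wK) -(comps_uniq K'Z wK') uK'.
  - by rewrite inE uK'.
  - by rewrite inE xC orbT.
have /card_gt1P[K1 [K2 [K1Z K2Z nK]]] : 1 < #|comps F Z|.
  have := euler_split PT C; rewrite C3 nC cC -/Z -[nfc F C 0]/(nfc F C (3 - 3)) -(nfcC PT) // -/Z.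
  rewrite (card_comps F) (nfc_comps PT) // (nei_comps PT) -!big_split /=.
  have : \sum_(K in comps F Z) (#|K| + nfc F K 3) <= \sum_(K in comps F Z) (nei F K + 1).
    apply: leq_sum => K KZ; have [u uK] := comps_ex KZ; rewrite addn1.
    apply: (conn_chi_le1 PT uK _ (comps_conn KZ) (v := x)).
    by apply/negP=> /(subsetP (comps_sub KZ)); rewrite inE xC.
  have E1 : \sum_(K in comps F Z) 1 = #|comps F Z| by rewrite sum1_card.
  rewrite !big_split /= E1; move: #|comps F Z| (\sum_(K in _) #|_|) (\sum_(K in _) nfc _ _ _) (\sum_(K in _) nei _ _).
  clear; lia.
have h1 := clique_comps (erefl Z) xC conC K1Z K2Z nK C2 coK.
have h2 : 4 <= nfc F K2 1.
  by apply: (clique_comps (erefl Z) xC conC K2Z K1Z _ C2 coK); rewrite eq_sym.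
have : nfc F K1 1 + nfc F K2 1 <= 6.
  have <- : nfc F Z 1 = 6 by rewrite (nfcC PT) // C2.
  rewrite (nfc_comps PT Z) // (big_setD1 K1 K1Z) /= (big_setD1 K2) /=; last first.
    by rewrite in_setD1 eq_sym nK.
  by rewrite addnA leq_addr.
by move: h1 h2; clear; lia.
Qed.

(** With one vertex of degree 5, the outer length of a disc exceeds the inner one by 5, so each of
    the [a] layers contributes 5. *)
Lemma ball_length a (S : {set V}) u v : conn F S -> conn F (~: S) -> pcnt F S = 1 -> u \in pent F ->
  v \notin S -> ball F u a \subset S -> 5 * a <= nfc F S 2.
Proof.
elim: a S => [|a IH] S cS cCS p1 uT vS bS; first by rewrite muln0.
have uS : u \in S := subsetP bS u (ball_self F u a.+1).
have [y uy] : exists y, tri_adj F u y.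
  by have [b [c f]] := vertex_face PT u; exists b; apply: (face_adj12 PT f).
have yS : y \in S.
  by apply: (subsetP bS); apply: (subsetP (ball_sub F u (isT : 1 <= a.+1))); apply: ballS uy; apply: ball_self.
have bI : ball F u a \subset interior F S.
  apply/subsetP=> x xB; rewrite inE (subsetP bS) ?(subsetP (ball_sub F u (leqnSn a))) //=.
  by apply/forallP=> w; apply/implyP=> xw; apply: (subsetP bS); apply: ballS xB xw.
have uI : u \in interior F S := subsetP bI u (ball_self F u a).
pose K := comp F (interior F S) u; have KI : K \in comps F (interior F S) := comp_in F uI.
have [c1 c2 sK _ [z [zK vK]]] := interior_comps PT uS vS cS cCS KI.
have pK : pcnt F K = 1.
  apply/eqP; rewrite eqn_leq -{1}p1 (pcntS F sK); apply/card_gt0P; exists u.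
  by rewrite inE comp_self // uT.
have := IH K c1 c2 pK uT vK (conn_comp (@ball_conn _ F u a) bI (ball_self F u a)).
have := conn_gb PT D56 zK vK c1 c2; have := peel_comp uS yS (adj_neq PT uy) vS cS cCS KI.
by rewrite pK; clear; lia.
Qed.

(** For [a = r + 1], the faces cut by a suitable component outside [ball F t a] are new, and by
    [ball_length] there are at least [10 * a + 5] of them, the difference of [5 * (a + 1) ^ 2] and
    [5 * a ^ 2]. *)
Lemma touched_ball k t r : far F k -> #|F| = 60 * k ^ 2 -> t \in pent F -> r < k ->
  5 * r.+1 ^ 2 <= #|[set f in F | ~~ [disjoint f & ball F t r]]|.
Proof.
move=> farK Ef tT; elim: r => [|r IH] rk.
  rewrite (_ : 5 * 1 ^ 2 = 5) //; apply: (@leq_trans (tri_deg F t)); first by case: (D56 t) => ->.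
  rewrite -(card_faces_at PT); apply: subset_leq_card; apply/subsetP=> f; rewrite !inE => /andP[-> tf].
  by apply/pred0Pn; exists t; rewrite /= tf inE eqxx.
have {}IH := IH (ltnW rk).
have [K KZ pK] := ball_comp PT D56 farK Ef tT rk.
set a := r.+1 in rk KZ *.
have [z zK] := comps_ex KZ.
have tK : t \notin K by apply/negP=> /(subsetP (comps_sub KZ)); rewrite inE ball_self.
have bK : ball F t a \subset ~: K.
  by apply/subsetP=> x xB; rewrite inE; apply/negP=> /(subsetP (comps_sub KZ)); rewrite inE xB.
have cK := comps_conn KZ.
have cCK : conn F (~: K).
  apply: (conn_star (w := t)) => [|u uK]; first by rewrite inE.
  have [uC|uC] := boolP (u \in ball F t a); first by exists (ball F t a); split=> //; [exact: (@ball_conn _ F t a)|exact: ball_self].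
  have uZ : u \in ~: ball F t a by rewrite inE.
  pose K' := comp F (~: ball F t a) u; have K'Z : K' \in comps F _ := comp_in F uZ.
  have uK' : u \in K' := comp_self F uZ.
  have xK' : t \notin K' by apply/negP=> /(subsetP (comps_sub K'Z)); rewrite inE ball_self.
  have [b [c [_ bK' _ cK' bc]]] := conn_exit (conn_setT PT) (in_setT u) uK' (in_setT t) xK'.
  have cB : c \in ball F t a.
    by apply/negPn/negP=> cB; case/negP: cK'; apply: (comps_closed K'Z bK' _ bc); rewrite inE.
  exists (K' :|: ball F t a); split.
  - exact: (conn_setU (comps_conn K'Z) (@ball_conn _ F t a) bK' cB bc).
  - rewrite subUset bK andbT; apply/subsetP=> w wK'; rewrite inE; apply/negP=> wK.
    by move: uK; rewrite inE (comps_uniq KZ wK) -(comps_uniq K'Z wK') uK'.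
  - by rewrite inE uK'.
  - by rewrite inE ball_self orbT.
(* The side of the cut with a single vertex of degree 5 may also be the far one; by [farK] it then
   contains the ball of radius [a] about its own vertex. *)
have cut : 10 * a + 5 <= nfc F K 1 + nfc F K 2.
  case: pK => pK; last first.
    have tC : t \in ~: K by rewrite inE.
    have zC : z \notin ~: K by rewrite inE negbK.
    have cKK : conn F (~: ~: K) by rewrite setCK.
    have := ball_length cCK cKK pK tT zC bK; have := conn_gb PT D56 tC zC cCK cKK.
    by rewrite pK !(nfcC PT K) // (_ : 3 - 1 = 2) // (_ : 3 - 2 = 1) //; clear; lia.
  have /card_gt0P[u] : 0 < #|K :&: pent F| by rewrite -/(pcnt F K) pK.
  rewrite inE => /andP[uK uT].
  have ntu : t != u by apply: contraNneq tK => ->.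
  have bu : ball F u a \subset K.
    apply: (conn_comps (@ball_conn _ F u a) _ KZ (ball_self F u a) uK).
    apply/subsetP=> x xB; rewrite inE; apply/negP=> xt.
    have := farK _ _ (a + a) tT uT ntu (ball_trans xt (ball_sym xB)).
    by move: rk; clear; lia.
  have := ball_length cK cCK pK uT tK bu; have := conn_gb PT D56 zK tK cK cCK.
  by rewrite pK; clear; lia.
pose T1 := [set f in F | ~~ [disjoint f & ball F t r]].
pose T2 := [set f in F | (#|f :&: K| == 1) || (#|f :&: K| == 2)].
have cT2 : #|T2| = nfc F K 1 + nfc F K 2.
  rewrite /nfc -cardsUI (_ : _ :&: _ = set0) ?cards0 ?addn0; last first.
    apply/setP=> f; rewrite !inE; case: (f \in F) => //=; by case: eqP => // ->.
  by apply: eq_card => f; rewrite !inE andb_orr.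
have d12 : [disjoint T1 & T2].
  apply/pred0Pn=> -[f /andP[]] /=; rewrite !inE => /andP[fF /pred0Pn[x /andP[/= xf xB]]] /andP[_ fK].
  have /card_gt0P[w] : 0 < #|f :&: K| by case/orP: fK => /eqP->.
  rewrite inE => /andP[wf wK].
  have : w \in ball F t a.
    have [->|nwx] := eqVneq w x; first exact: (subsetP (ball_sub F t (leqnSn r))).
    by apply: ballS xB _; apply: (face_in_adj PT fF xf wf); rewrite eq_sym.
  by move=> /(subsetP bK); rewrite inE wK.
have sub : T1 :|: T2 \subset [set f in F | ~~ [disjoint f & ball F t a]].
  apply/subsetP=> f /setUP[]; rewrite !inE => /andP[fF].
    case/pred0Pn=> x /andP[/= xf xB]; rewrite fF; apply/pred0Pn; exists x.
    by rewrite /= xf (subsetP (ball_sub F t (leqnSn r))).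
  move=> fK; rewrite fF /=.
  have /card_gt0P[w] : 0 < #|f :&: K| by case/orP: fK => /eqP->.
  rewrite inE => /andP[wf wK].
  have [y yf yK] : exists2 y, y \in f & y \notin K.
    apply/subsetPn; rewrite -(card3_sub PT K fF); case/orP: fK => /eqP->; by [].
  have nyw : w != y by apply: contraNneq yK => <-.
  have wy := face_in_adj PT fF wf yf nyw.
  apply/pred0Pn; exists y; rewrite /= yf /=; apply/negPn/negP=> yB; case/negP: yK.
  by apply: (comps_closed KZ wK _ wy); rewrite inE.
apply: leq_trans (subset_leq_card sub).
rewrite cardsU (_ : T1 :&: T2 = set0) ?cards0 ?subn0; last by apply/eqP; rewrite setI_eq0.
rewrite cT2; move: IH cut; rewrite -/T1 /a -!mulnn; clear; nia.
Qed.

End Cliques.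

(** * The triangular lattice *)

Lemma iter_commute (T : Type) (f g : T -> T) n : (forall d, f (g d) = g (f d)) ->
  forall d, iter n f (g d) = g (iter n f d).
Proof. by move=> fg d; elim: n => //= n ->. Qed.

Lemma iter_commute2 (T : Type) (f g : T -> T) n m : (forall d, f (g d) = g (f d)) ->
  forall d, iter n f (iter m g d) = iter m g (iter n f d).
Proof. by move=> fg d; elim: m => //= m <-; apply: iter_commute. Qed.

(* The local geometry of the triangular lattice, for three involutions acting
   on flags: [gx] turns a flag inside its triangle, [gh] crosses the first
   edge, [gr] and [gi] turn around the first vertex, and [gA], [gB] are the two
   unit translations; the last two commute only where the vertex between them has
   degree six. *)
Section Coxeter.
Variables (T : Type) (a b c : T -> T).
Hypothesis aK : involutive a.
Hypothesis bK : involutive b.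
Hypothesis cK : involutive c.
Hypothesis ac : forall d, a (c d) = c (a d).
Hypothesis aba : forall d, a (b (a d)) = b (a (b d)).

Definition gh d := a (c d).
Definition gx d := b (a d).
Definition gr d := c (b d).
Definition gi d := b (c d).
Definition gA d := gi (gi (gi (gh d))).
Definition gB d := gr (gh (gx d)).

Lemma grK : cancel gr gi. Proof. by move=> d; rewrite /gr /gi cK bK. Qed.
Lemma giK : cancel gi gr. Proof. by move=> d; rewrite /gr /gi bK cK. Qed.
Lemma ghK : involutive gh. Proof. by move=> d; rewrite /gh -ac aK cK. Qed.
Lemma gxK d : gx (gx (gx d)) = d.
Proof. by rewrite /gx aba !bK aK. Qed.
Lemma gi_gh d : gi (gh d) = gx d.
Proof. by rewrite /gi /gh /gx -ac cK. Qed.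
Lemma gi_gx d : gi d = gx (gh d).
Proof. by rewrite -gi_gh ghK. Qed.
Lemma gr_gx d : gr d = gh (gx (gx d)).
Proof. by apply: (can_inj giK); rewrite grK gi_gh gxK. Qed.
Lemma gh_gr d : gh (gr d) = gx (gx d).
Proof. by rewrite gr_gx ghK. Qed.

Lemma gA_inj : injective gA.
Proof. by move=> d e /(can_inj giK)/(can_inj giK)/(can_inj giK)/(can_inj ghK). Qed.

Lemma gA_E d : gA d = gi (gi (gx d)). Proof. by rewrite /gA gi_gh. Qed.

Lemma gAB d : gA (gB d) = gi (gi (gi (gx (gx (gh (gx d)))))).
Proof. by rewrite {1}/gA /gB gh_gr. Qed.

Lemma gBA d : gB (gA d) = gr (gr (gr (gx (gx (gh (gx d)))))).
Proof.
rewrite /gB gA_E !gi_gx; congr gr.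
by rewrite [in RHS]gr_gx [in RHS]gr_gx !gxK -gr_gx.
Qed.

(** Both products arise from one flag by three turns about the same vertex, in opposite
    directions. *)
Lemma gcomm d : iter 6 gr (gA (gB d)) = gA (gB d) -> gA (gB d) = gB (gA d).
Proof. by move=> E; rewrite -[LHS]E gAB gBA /= !giK. Qed.

Lemma gturn d : iter 6 gr (gA d) = gA d -> gi (gA d) = gB (gi d).
Proof.
move=> E; rewrite -{1}E /= grK /gB gi_gx.
by rewrite -[gh (gx (gx (gh d)))]gr_gx /gA !giK.
Qed.

Lemma gturn2 d : iter 6 gr (gB (gi d)) = gB (gi d) -> gA (gi (gB d)) = gB (gi d).
Proof.
have EB : gB (gi d) = gr (gr (gh d)) by rewrite /gB gi_gx -gr_gx.
move=> E; have -> : gA (gi (gB d)) = gi (gi (gi (gi (gi (gi (gB (gi d))))))).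
  by rewrite EB !grK /gA ghK gi_gh.
by rewrite -{1}E /= !grK.
Qed.

Lemma gflip d : b (gB d) = gA (b d).
Proof. by rewrite gA_E /gB /gr /gh /gx /gi -aba ac. Qed.

Lemma gflipA d : b (gA d) = gB (b d).
Proof. by apply: (can_inj bK); rewrite gflip !bK. Qed.

End Coxeter.

(** * Finite quotients of the triangular lattice by symmetric sublattices *)

Section Lattice.
Variables (T : finType) (a b c : T -> T).
Hypothesis aK : involutive a.
Hypothesis bK : involutive b.
Hypothesis cK : involutive c.
Hypothesis ac : forall d, a (c d) = c (a d).
Hypothesis aba : forall d, a (b (a d)) = b (a (b d)).
Hypothesis r6 : forall d, iter 6 (gr b c) d = d.
Variable p : T.
Hypothesis bp : b p = p.
Hypothesis cp : c p = p.
Hypothesis trans : forall P : T -> Prop, P p -> (forall d, P d -> P (a d)) ->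
  (forall d, P d -> P (b d)) -> (forall d, P d -> P (c d)) -> forall d, P d.

Let A := gA a b c.
Let B := gB a b c.
Let i1 := gi b c.
Notation "f ^^ n" := (iter n f) (at level 30).

Let AB d : A (B d) = B (A d). Proof. exact: gcomm. Qed.
Let ABn i j d : (A ^^ i) ((B ^^ j) d) = (B ^^ j) ((A ^^ i) d).
Proof. exact: iter_commute2. Qed.
Let A_inj : injective A. Proof. exact: gA_inj. Qed.
Let bA i d : b ((A ^^ i) d) = (B ^^ i) (b d).
Proof. by elim: i => //= i <-; apply: gflipA. Qed.
Let bB i d : b ((B ^^ i) d) = (A ^^ i) (b d).
Proof. by elim: i => //= i <-; apply: gflip. Qed.
Let iA i d : i1 ((A ^^ i) d) = (B ^^ i) (i1 d).
Proof. by elim: i => //= i <-; apply: gturn. Qed.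
Let iB i d : (A ^^ i) (i1 ((B ^^ i) d)) = (B ^^ i) (i1 d).
Proof.
elim: i d => // i IH d; rewrite [LHS]iterSr [in LHS]iterS [A _]gturn2 //.
by rewrite -/B -/i1 (iter_commute _ AB) IH.
Qed.
Let ip : i1 p = p. Proof. by rewrite /i1 /gi cp bp. Qed.

Let Aper : exists2 M, 0 < M & forall d, (A ^^ M) d = d.
Proof.
exists #[perm A_inj]%g; first exact: order_gt0.
move=> d; rewrite -[RHS](perm1 d) -(expg_order (perm A_inj)) permX.
by apply: eq_iter => e; rewrite permE.
Qed.

(** The translates of [p] are closed under the generators, because [p] is fixed by [b] and [c]. *)
Lemma lattice_cover d : exists i j, d = (A ^^ i) ((B ^^ j) p).
Proof.
have [M M0 AM] := Aper.
have AMj j e : (A ^^ (M * j)) e = e.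
  by elim: j => [|j IH]; rewrite ?muln0 // mulnS iterD IH AM.
have cb e : (exists i j, e = (A ^^ i) ((B ^^ j) p)) -> exists i j, b e = (A ^^ i) ((B ^^ j) p).
  by case=> i [j ->]; exists j, i; rewrite bA bB bp ABn.
have ci e : (exists i j, e = (A ^^ i) ((B ^^ j) p)) -> exists i j, i1 e = (A ^^ i) ((B ^^ j) p).
  (* The power [M.-1 * j] of [A] is the inverse of the power [j]. *)
  case=> i [j ->]; exists (M.-1 * j), (i + j); rewrite iA.
  have -> : i1 ((B ^^ j) p) = (A ^^ (M.-1 * j)) ((B ^^ j) p).
    rewrite -[LHS](AMj j) -{1}(prednK M0) mulSn addnC iterD iB ip //.
  by rewrite -ABn -iterD.
have cA e : (exists i j, e = (A ^^ i) ((B ^^ j) p)) -> exists i j, A e = (A ^^ i) ((B ^^ j) p).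
  by case=> i [j ->]; exists i.+1, j.
have cc e : (exists i j, e = (A ^^ i) ((B ^^ j) p)) -> exists i j, c e = (A ^^ i) ((B ^^ j) p).
  by move=> /ci/cb; rewrite /i1 /gi bK.
move: d; apply: (@trans (fun d => exists i j, d = (A ^^ i) ((B ^^ j) p))) => [|d Pd|d /cb//|d /cc//].
  by exists 0, 0.
have -> : a d = i1 (i1 (i1 (A (c d)))); last by apply/ci/ci/ci/cA/cc.
have E := r6 (i1 (i1 (i1 (A (c d))))); rewrite -E /= /i1 !giK //.
by rewrite /gh cK.
Qed.

Let n := fingraph.order A p.
Let n0 : 0 < n. Proof. exact: fingraph.order_gt0. Qed.
Let An : (A ^^ n) p = p. Proof. exact: iter_order. Qed.
Let Anm m : (A ^^ (n * m)) p = p.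
Proof. by elim: m => [|m IH]; rewrite ?muln0 // mulnS iterD IH An. Qed.
Let Amod i : (A ^^ i) p = (A ^^ (i %% n)) p.
Proof. by rewrite {1}(divn_eq i n) addnC iterD mulnC Anm. Qed.
Let A_eq i j : (A ^^ i) p = (A ^^ j) p -> i = j %[mod n].
Proof.
rewrite Amod [RHS]Amod => E.
by rewrite -(findex_iter (ltn_pmod i n0)) E findex_iter // ltn_pmod.
Qed.
Let Bp i : (B ^^ i) p = i1 ((A ^^ i) p). Proof. by rewrite iA ip. Qed.

(** The vectors that fix [p] form a lattice invariant under turns and reflections; the turned and
    reflected copies of the given relation yield both congruences. *)
Lemma lattice_dvd i j : (A ^^ i) ((B ^^ j) p) = p -> i = j %[mod n] /\ n %| 3 * i.
Proof.
move=> E; have E' : (A ^^ j) ((B ^^ i) p) = p by rewrite ABn; have := congr1 b E; rewrite bA bB bp.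
have key x y : (A ^^ x) ((B ^^ y) p) = p -> (A ^^ y) p = (B ^^ (x + y)) p.
  by move=> /(congr1 (fun d => (A ^^ y) (i1 d))); rewrite iA ip => <-; rewrite ABn iB ip -iterD.
have Ej := key _ _ E; have Ei := key _ _ E'.
have ij : i = j %[mod n] by apply: A_eq; rewrite Ei Ej addnC.
split=> //.
have E2 : (A ^^ (i + i)) p = (B ^^ i) p.
  have -> : (A ^^ (i + i)) p = (A ^^ (i + j)) p by rewrite Amod [RHS]Amod -modnDmr ij modnDmr.
  by rewrite iterD Ej iterD ABn E.
have E3 : (B ^^ (i + i)) p = (A ^^ i) p by have := congr1 b E2; rewrite bA bB bp.
have : (A ^^ (i + i + (i + i))) p = (A ^^ i) p.
  by rewrite iterD E2 ABn E2 -iterD E3.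
move/A_eq/eqP; rewrite eqn_mod_dvd; last by clear; lia.
by rewrite (_ : i + i + (i + i) - i = 3 * i) //; clear; lia.
Qed.

(** With [q] the least positive exponent that brings [B] into the [A]-orbit of [p], a fundamental
    domain gives [n * q = 3 * k ^ 2], and [n] divides [3 * q]. This leaves [n = 3 * k], so [i] and
    [j] are multiples of [k] that agree modulo [3 * k]; the shortest choice is [(k, k)]. *)
Lemma lattice_gap k i j : #|T| = 3 * k ^ 2 -> (A ^^ i) ((B ^^ j) p) = p -> 0 < i + j ->
  2 * k <= i + j.
Proof.
move=> cT Eij ij0.
have k0 : 0 < k.
  rewrite lt0n; apply/eqP=> k0; have : 0 < #|T| by apply/card_gt0P; exists p.
  by rewrite cT k0.
pose P q := (0 < q) && [exists x : 'I_n, (B ^^ q) p == (A ^^ x) p].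
have exP : exists q, P q.
  by exists n; rewrite /P n0; apply/existsP; exists (Ordinal n0); rewrite /= Bp An ip.
case: (ex_minnP exP) => q /andP[q0 /existsP[x /eqP Ex]] qmin.
have qn : q <= n.
  by apply: qmin; rewrite /P n0; apply/existsP; exists (Ordinal n0); rewrite /= Bp An ip.
pose g (u : 'I_n * 'I_q) := (A ^^ u.1) ((B ^^ u.2) p).
have g_inj : injective g.
  suff H (u v : 'I_n * 'I_q) : v.2 <= u.2 -> g u = g v -> u = v.
    by move=> u v E; case: (leqP v.2 u.2) => [h|/ltnW h]; [|symmetry]; apply: H.
  move=> le E; have {}E : (A ^^ u.1) ((B ^^ (u.2 - v.2)) p) = (A ^^ v.1) p.
    have := congr1 (B ^^ ((n * v.2) - v.2)) E; rewrite /g -!ABn -!iterD.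
    have sv : v.2 <= n * v.2 by rewrite leq_pmull.
    have -> : n * v.2 - v.2 + u.2 = u.2 - v.2 + n * v.2 by move: sv le; clear; lia.
    by rewrite subnK // iterD Bp Anm ip => ->.
  have {}E : (B ^^ (u.2 - v.2)) p = (A ^^ (v.1 + (n * u.1 - u.1))) p.
    have su : u.1 <= n * u.1 by rewrite leq_pmull.
    rewrite addnC iterD -E -iterD subnK // ABn Anm //.
  have e2 : u.2 = v.2 :> nat.
    apply/eqP; rewrite eqn_leq le andbT -subn_eq0; apply/negPn; rewrite -lt0n; apply/negP=> d0.
    have : q <= u.2 - v.2.
      apply: qmin; rewrite /P d0; apply/existsP.
      by exists (Ordinal (ltn_pmod (v.1 + (n * u.1 - u.1)) n0)); rewrite E /= -Amod.
    by have := ltn_ord u.2; move: d0; clear; lia.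
  have e1 : u.1 = v.1 :> nat.
    move: E; rewrite e2 subnn => /= /esym E.
    have su : u.1 <= n * u.1 by rewrite leq_pmull.
    have : (A ^^ u.1) p = (A ^^ v.1) p.
      rewrite -[in LHS]E -iterD (_ : u.1 + _ = v.1 + n * u.1) ?iterD ?Anm //.
      by move: su; clear; lia.
    by move/A_eq; rewrite !modn_small.
  by case: u v e1 e2 {le E} => [u1 u2] [v1 v2] /= /val_inj-> /val_inj->.
have g_surj d : d \in codom g.
  have [i' [j' ->]] := lattice_cover d.
  have [s Es] : exists s, (B ^^ j') p = (A ^^ s) ((B ^^ (j' %% q)) p).
    exists (x * (j' %/ q)); rewrite {1}(divn_eq j' q) addnC iterD ABn; congr ((B ^^ _) _).
    by elim: (j' %/ q) => [|m IH]; rewrite ?muln0 // mulSn iterD IH -ABn Ex -iterD mulnS addnC.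
  apply/codomP; exists (Ordinal (ltn_pmod (i' + s) n0), Ordinal (ltn_pmod j' q0)).
  by rewrite /g /= Es -iterD !ABn -Amod.
have nq : n * q = 3 * k ^ 2.
  rewrite -cT; apply/eqP; rewrite eqn_leq; have := leq_card g g_inj; rewrite card_prod !card_ord => ->.
  apply: (@leq_trans #|codom g|); first by apply: subset_leq_card; apply/subsetP=> d _.
  by apply: leq_trans (leq_image_card _ _) _; rewrite card_prod !card_ord.
have d3q : n %| 3 * q.
  have E : (A ^^ q) ((B ^^ (n - x)) p) = p.
    have : (A ^^ (n - x)) ((B ^^ q) p) = p by rewrite Ex -iterD subnK // ltnW.
    by move/(congr1 b); rewrite bA bB bp ABn.
  by have [] := lattice_dvd E.
have n3k : n = 3 * k.
  case/dvdnP: d3q => w Ew.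
  have w3 : 0 < w <= 3.
    by apply/andP; split; [case: (w) Ew q0 => //; lia | rewrite -(leq_pmul2r n0) -Ew leq_mul2l qn orbT].
  have sq : w * n ^ 2 = 9 * k ^ 2 by rewrite expnS expn1 mulnA -Ew; move: nq; clear; lia.
  (* The exponents of [r] on the two sides differ in parity. With [w * n ^ 2 = 9 * k ^ 2] this
     excludes [w = 2] and [w = 3]. *)
  have odd_log m l r s : prime r -> 0 < m -> 0 < l -> coprime r s -> r * m ^ 2 = s * l ^ 2 -> False.
    move=> pr m0 l0 co /(congr1 (logn r)); have s0 : 0 < s.
      by rewrite lt0n; apply/eqP=> s0; move: co; rewrite s0 /coprime gcdn0; case: (r) pr => [|[]].
    have -> : logn r (r * m ^ 2) = 1 + 2 * logn r m.
      have m2 : 0 < m ^ 2 by rewrite expn_gt0 m0.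
      by rewrite (lognM r (prime_gt0 pr) m2) lognX logn_prime // eqxx.
    have -> : logn r (s * l ^ 2) = logn r s + 2 * logn r l.
      have l2 : 0 < l ^ 2 by rewrite expn_gt0 l0.
      by rewrite (lognM r s0 l2) lognX.
    have -> : logn r s = 0 by apply/eqP; rewrite -leqn0 leqNgt logn_gt0 mem_primes pr s0 /= -prime_coprime // co.
    by clear; lia.
  case: w w3 sq {Ew} => [|[|[|[|]]]] // _ sq.
  - have : (3 * k) ^ 2 = n ^ 2 by rewrite expnMn; move: sq; clear; lia.
    by move/eqP; rewrite eqn_sqr => /eqP->.
  - by case: (odd_log n k 2 9).
  - case: (odd_log k n 3 1) => //; move: sq; clear; lia.
have [e1 e2] := lattice_dvd Eij.
have e3 : n %| 3 * j.
  have E : (A ^^ j) ((B ^^ i) p) = p by have := congr1 b Eij; rewrite bA bB bp ABn.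
  by have [] := lattice_dvd E.
rewrite n3k !dvdn_pmul2l // in e2 e3; case/dvdnP: e2 => u Eu; case/dvdnP: e3 => v Ev.
move: e1 ij0; rewrite n3k Eu Ev -!muln_modl // => /eqP.
rewrite eqn_pmul2r // -mulnDl muln_gt0 k0 andbT leq_pmul2r //.
by case: u {Eu} => [|[|u]]; case: v {Ev} => [|[|v]] //=; clear; lia.
Qed.

End Lattice.

(** * Flat cones *)

Section Cone.
Variables (V : finType) (F : {set {set V}}).
Hypothesis PT : plane_triangulation F.
Hypothesis D56 : forall v : V, tri_deg F v = 5 \/ tri_deg F v = 6.

Local Notation a := (@s0 V F).
Local Notation b := (@s1 V F).
Local Notation c := (@s2 V F PT).
Local Notation A := (gA a b c).
Local Notation B := (gB a b c).
Local Notation h := (gh a c).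
Local Notation x := (gx a b).
Local Notation r := (gr b c).
Local Notation i1 := (gi b c).

Let aK : involutive a := @s0K V F.
Let bK : involutive b := @s1K V F.
Let cK : involutive c := @s2K V F PT.
Let ac d : a (c d) = c (a d). Proof. exact: s02. Qed.
Lemma flag_braid d : a (b (a d)) = b (a (b d)). Proof. exact: flag_eq. Qed.
Let aba := flag_braid.

Lemma flag_r6 d : tri_deg F (fx d) = 6 -> iter 6 r d = d.
Proof. by move=> d6; have := rr_deg PT d; rewrite d6. Qed.

(** The flag at position [(i, j)] of the sector of 60 degrees that starts at [phi]. *)
Definition U i j phi := iter i A (iter j B phi).
Arguments U : simpl never.

Definition flat t n := forall phi, fx phi = t -> forall i j, 0 < i + j <= n ->
  tri_deg F (fx (U i j phi)) = 6.

Lemma U_ball i j phi : fx (U i j phi) \in ball F (fx phi) (i + j).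
Proof.
elim: i => [|i IH]; rewrite /U; last first.
  by rewrite addSn; apply: ballS IH _; apply: (face_adj12 PT (flagF (U i j phi))).
elim: j => [|j IH]; first exact: ball_self.
by rewrite addnS; apply: ballS IH _; apply: (face_adj13 PT (flagF (iter j B phi))).
Qed.

Lemma b_gx d : b (x d) = x (x (b d)). Proof. exact: flag_eq. Qed.
Lemma b_dn d : b (h (x d)) = x (h (x (b d))).
Proof. by rewrite /gx /gh -aba ac -!ac aK ac. Qed.

(** [(u, i, j, k)] names a flag of the sector: position [(i, j)], upward or downward triangle
    according to [u], and [k] turns inside the triangle. *)
Definition code := (bool * nat * nat * nat)%type.
Definition cd (q : code) phi : flag F :=
  let: (u, i, j, k) := q in iter k x (if u then h (x (U i j phi)) else U i j phi).
(** The lattice distance of the first vertex of the flag from the apex. [sz] is the least level of a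
    vertex of its triangle. *)
Definition code_level (q : code) := let: (u, i, j, k) := q in
  if u then i + j + (if k < 2 then 1 else 2) else i + j + (0 < k).
Definition sz (q : code) := let: (u, i, j, k) := q in i + j + u.
Definition xstep (q : code) : code := let: (u, i, j, k) := q in
  (u, i, j, if k is k'.+2 then 0 else k.+1).
Definition bstep (q : code) : code := let: (u, i, j, k) := q in
  (u, j, i, if u then (if k is k'.+2 then 2 else 1 - k) else (if k is k'.+1 then 3 - k else 0)).
(** Crossing the first edge. The second component is the change of sector, [i1] or [r], when this
    edge lies on a side of the sector. *)
Definition hstep (q : code) : code * (flag F -> flag F) := let: (u, i, j, k) := q in
  if u then match k with
    | 0 => ((false, i, j, 1), id)
    | 1 => ((false, i.+1, j, 2), id)
    | _ => ((false, i, j.+1, 0), id)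
  end else match k with
    | 0 => if j is j'.+1 then ((true, i, j', 2), id) else ((false, 0, i, 2), i1)
    | 1 => ((true, i, j, 0), id)
    | _ => if i is i'.+1 then ((true, i', j, 1), id) else ((false, j, 0, 0), r)
  end.

Lemma cd_x q phi : q.2 < 3 -> x (cd q phi) = cd (xstep q) phi.
Proof. by case: q => -[[u i] j] [|[|[|k]]] //= _; rewrite (gxK aK bK aba). Qed.

Strategy 1000 [gA gB gh gx gr gi s0 s1 s2].

Section Flat.
Variables (t : V) (n : nat).
Hypothesis FL : flat t n.

Lemma U_B i j phi : fx phi = t -> i + j < n -> B (U i j phi) = U i j.+1 phi.
Proof.
move=> ft; elim: i => // i IH ijn; rewrite /U iterS -/(U i j phi) -(gcomm aK bK cK ac aba).
  by rewrite (IH (ltnW ijn)); reflexivity.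
apply: flag_r6; rewrite (IH (ltnW ijn)); apply: (FL ft (i := i.+1) (j := j.+1)).
by rewrite addnS /=.
Qed.

Lemma U_turn i phi : fx phi = t -> i <= n -> i1 (U i 0 phi) = U 0 i (i1 phi).
Proof.
move=> ft; elim: i => // i IH ijn; rewrite /U iterS -/(U i 0 phi) (gturn aK bK cK ac aba).
  by rewrite (IH (ltnW ijn)); reflexivity.
by apply: flag_r6; apply: (FL ft (i := i.+1) (j := 0)); rewrite addn0.
Qed.

Lemma U_flip i j phi : fx phi = t -> i + j <= n -> b (U i j phi) = U j i (b phi).
Proof.
move=> ft; elim: i => [|i IH] ijn.
  by rewrite /U /=; elim: j {ijn} => //= j <-; rewrite gflip.
rewrite /U iterS -/(U i j phi) (gflipA bK cK ac aba) (IH (ltnW ijn)).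
by apply: U_B => //; rewrite addnC.
Qed.

Lemma cd_b q phi : fx phi = t -> q.2 < 3 -> sz q <= n -> b (cd q phi) = cd (bstep q) (b phi).
Proof.
case: q => -[[u i] j] k ft k3 s; have s' : i + j <= n by move: s; rewrite /=; case: (u); lia.
have E := U_flip ft s'.
rewrite /= in k3; case: u {s}; case: k k3 => [|[|[|k]]] //= _.
- by rewrite b_dn E.
- by rewrite b_gx b_dn E (gxK aK bK aba).
- by rewrite !b_gx b_dn E (gxK aK bK aba).
- by rewrite b_gx E.
- by rewrite !b_gx E (gxK aK bK aba).
Qed.

Lemma cd_h q phi : fx phi = t -> q.2 < 3 -> sz q <= n -> h (cd q phi) = cd (hstep q).1 ((hstep q).2 phi).
Proof.
case: q => -[[u i] j] k ft k3 s; rewrite /= in k3.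
have AE d : h (x (h (x d))) = x (x (A d)) by rewrite (gA_E b cK ac) !(gi_gx b aK cK ac) !(gxK aK bK aba).
case: u s; case: k k3 => [|[|[|k]]] //= _; rewrite ?addn0 ?addn1 => s.
- by rewrite (ghK aK cK ac).
- by rewrite -(gr_gx aK bK cK ac aba) -[r (h _)]/(B (U i j phi)) U_B.
- case: j s => [|j] s /=.
    rewrite addn0 in s; rewrite -(U_turn ft s) (gi_gx b aK cK ac) !(gxK aK bK aba); reflexivity.
  rewrite -U_B -?addnS // /gB (gr_gx aK bK cK ac aba) (ghK aK cK ac); reflexivity.
- case: i s => [|i] s /=.
    rewrite -(gr_gx aK bK cK ac aba).
    have := @U_turn j (r phi) ft s; rewrite (grK bK cK) => <-.
    by rewrite (giK bK cK).
  by rewrite /U iterS -/(U i j phi) -AE (ghK aK cK ac); reflexivity.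
Qed.

Definition Z m d := exists phi q, [/\ fx phi = t, q.2 < 3, code_level q <= m & d = cd q phi].

Lemma lev_sz q : q.2 < 3 -> sz q <= code_level q.
Proof. by case: q => -[[[] i] j] [|[|[|k]]] //= _; lia. Qed.

Lemma Z_x m d : Z m d -> Z m.+1 (x d).
Proof.
case=> phi [q [ft k3 lm ->]]; exists phi, (xstep q); split=> //; last by rewrite cd_x.
  by case: q k3 {lm} => -[[u i] j] [|[|[|k]]].
by case: q k3 lm => -[[[] i] j] [|[|[|k]]] //= _; lia.
Qed.

Lemma Z_r m d : m <= n -> Z m d -> Z m (r d).
Proof.
move=> mn [phi [q [ft k3 lm ->]]]; rewrite (gr_gx aK bK cK ac aba).
have k3' : (xstep q).2 < 3 by case: q k3 {lm} => -[[u i] j] [|[|[|k]]].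
have k3'' : (xstep (xstep q)).2 < 3 by case: q k3 {lm k3'} => -[[u i] j] [|[|[|k]]].
have sq : sz (xstep (xstep q)) <= n.
  apply: leq_trans mn; apply: leq_trans lm; apply: leq_trans (lev_sz k3).
  by case: q {k3 k3' k3''} => -[[u i] j] [|[|[|k]]].
rewrite !cd_x // cd_h //; move: k3 lm {k3' k3'' sq}; case: q => -[[u i] j] k k3 lm.
exists ((hstep (xstep (xstep (u, i, j, k)))).2 phi), (hstep (xstep (xstep (u, i, j, k)))).1.
by rewrite /= in k3; split=> //; case: u lm; case: k k3 => [|[|[|k]]] //= _; case: i => [|i] //=; case: j => [|j] //=; lia.
Qed.

Lemma Z_b m d : m <= n -> Z m d -> Z m (b d).
Proof.
move=> mn [phi [q [ft k3 lm ->]]].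
rewrite cd_b //; last by apply: leq_trans (leq_trans (lev_sz k3) lm) mn.
exists (b phi), (bstep q); move: k3 lm; case: q => -[[u i] j] k k3 lm.
by rewrite /= in k3; split=> //; case: u lm; case: k k3 => [|[|[|k]]] //= _; lia.
Qed.

Lemma Z_star m d e : m <= n -> fx d = fx e -> Z m d -> Z m e.
Proof.
move=> mn /(same_vertex PT D56)[k E] Zd.
have Zr l f : Z m f -> Z m (iter l r f) by elim: l => //= l IH /IH; apply: Z_r.
case: E => ->; apply: Zr => //.
have -> : s2 PT d = r (b d) by rewrite /gr bK.
by apply: Z_r => //; apply: Z_b.
Qed.

Lemma Z_ball m d : m <= n -> fx d \in ball F t m -> Z m d.
Proof.
elim: m d => [|m IH] d mn.
  by rewrite inE => /eqP ft; exists d, (false, 0, 0, 0).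
rewrite /= inE => /orP[dm|].
  have [phi [q [ft k3 lm E]]] := IH d (ltnW mn) dm.
  by exists phi, q; split=> //; apply: leqW.
rewrite inE => /existsP[v /andP[vm /(adjP PT)[w f]]].
have Zf : Z m (mkflag f) by apply: IH => //; apply: ltnW.
by apply: (Z_star mn _ (Z_x Zf)).
Qed.

Lemma ball_code m v : m <= n -> v \in ball F t m ->
  exists phi i j, [/\ fx phi = t, i + j <= m & v = fx (U i j phi)].
Proof.
move=> mn vm; have [d Ed] := vertex_flag PT v.
have [|phi [q [ft k3 lm E]]] := @Z_ball m d mn; first by rewrite Ed.
have fB i j : i + j < m -> fz (U i j phi) = fx (U i j.+1 phi).
  by move=> h1; rewrite -U_B //; apply: leq_trans mn.
rewrite -Ed E; case: q k3 lm {E} => -[[u i] j] k.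
case: u; case: k => [|[|[|k]]] //= _; rewrite ?addn0 ?addn1 ?addn2 => lm.
- by exists phi, i, j.+1; rewrite addnS; split=> //; apply: fB.
- by exists phi, i.+1, j; rewrite addSn; split.
- exists phi, i.+1, j.+1; rewrite addSn addnS; split=> //; rewrite -fB ?addSn //.
  have sq : sz (true, i, j, 1) <= n by rewrite /=; move: lm mn; clear; lia.
  exact: (congr1 (@fx V F) (cd_h (q := (true, i, j, 1)) ft isT sq)).
- by exists phi, i, j.
- by exists phi, i.+1, j; rewrite addSn; split.
- by exists phi, i, j.+1; rewrite addnS; split=> //; apply: fB.
Qed.

End Flat.

(** A rhombus of positions enumerates the codes of size below [k]: one half gives the upward
    triangles, the other half, reflected in the centre, the downward ones. So there are [3 * k ^ 2]
    of them. *)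
Definition dec k (s : 'I_k * 'I_k * 'I_3) : code :=
  if s.1.1 + s.1.2 < k then (false, val s.1.1, val s.1.2, val s.2)
  else (true, k - s.1.1.+1, k - s.1.2.+1, val s.2).

Lemma dec_ex k q : q.2 < 3 -> sz q < k -> exists s : 'I_k * 'I_k * 'I_3, dec s = q.
Proof.
case: q => -[[u i] j] l /= l3 s.
have [i1' i2'] : (if u then k - i.+1 else i) < k /\ (if u then k - j.+1 else j) < k.
  by case: u s => /=; lia.
exists (Ordinal i1', Ordinal i2', Ordinal l3); rewrite /dec /=; case: u s i1' i2' => /= s i1' i2'.
  rewrite ifF; last by apply/negP; lia.
  by congr (_, _, _, _); lia.
by rewrite ifT //; lia.
Qed.

Lemma dec3 k (s : 'I_k * 'I_k * 'I_3) : (dec s).2 < 3.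
Proof. by rewrite /dec; case: ifP => _ /=. Qed.

Lemma dec_sz k (s : 'I_k * 'I_k * 'I_3) : sz (dec s) < k.
Proof.
by rewrite /dec; case: s => -[i j] l /=; case: ifP => /=; have := ltn_ord i; have := ltn_ord j; lia.
Qed.

(** * The cones about the vertices of degree five are flat *)

Section FarCone.
Variable k : nat.
Hypothesis farK : far F k.
Hypothesis Ef : #|F| = 60 * k ^ 2.

Lemma touched_code t n d : flat t n -> ~~ [disjoint fset d & ball F t n] ->
  exists phi (s : 'I_n.+1 * 'I_n.+1 * 'I_3), fx phi = t /\ d = cd (dec s) phi.
Proof.
move=> FL /pred0Pn[v /andP[/= vd vB]].
have key e : fx e = v -> exists phi q, [/\ fx phi = t, q.2 < 3, sz q <= n & e = cd q phi].
  move=> Ee; have [|phi [q [ft k3 lm E]]] := @Z_ball t n FL n e (leqnn n); first by rewrite Ee.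
  by exists phi, q; split=> //; apply: leq_trans (lev_sz k3) lm.
have kx e : (exists phi q, [/\ fx phi = t, q.2 < 3, sz q <= n & e = cd q phi]) ->
    exists phi q, [/\ fx phi = t, q.2 < 3, sz q <= n & x e = cd q phi].
  case=> phi [q [ft k3 lm ->]]; exists phi, (xstep q); split=> //; last by rewrite cd_x.
    by case: q k3 {lm} => -[[u i] j] [|[|[|l]]].
  by case: q lm {k3} => -[[u i] j] [|[|[|l]]].
have [phi [q [ft k3 lm ->]]] : exists phi q, [/\ fx phi = t, q.2 < 3, sz q <= n & d = cd q phi].
  move: vd; rewrite !inE => /orP[/orP[]|] /eqP E; first exact: key.
    by rewrite -[d](gxK aK bK aba); apply/kx/kx/key.
  by rewrite -[d](gxK aK bK aba); apply/kx/key.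
have [s <-] := dec_ex k3 (lm : sz q < n.+1).
by exists phi, s.
Qed.

(** Another vertex of degree 5 is too far away, but a sector might wrap round to [t] itself. By
    [touched_ball] at least [5 * n.+1 ^ 2] faces, with six flags each, are reached by the
    [10 * (3 * n.+1 ^ 2)] codes, so no flag has two codes. *)
Lemma far_flat t n : t \in pent F -> n <= k -> flat t n.
Proof.
move=> tT; elim: n => [|n IH] nk; first by move=> phi ft i j; lia.
have {}IH := IH (ltnW nk).
pose Psi (w : flag F * ('I_n.+1 * 'I_n.+1 * 'I_3)) := cd (dec w.2) w.1.
pose D := setX [set d : flag F | fx d == t] [set: 'I_n.+1 * 'I_n.+1 * 'I_3].
have cD : #|D| = 30 * n.+1 ^ 2.
  rewrite cardsX cardsT !card_prod !card_ord (card_star PT D56).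
  by move: tT; rewrite inE => /eqP->; rewrite -mulnn; clear; lia.
have inj : {in D &, injective Psi}.
  apply/imset_injP; rewrite eqn_leq leq_imset_card cD.
  pose Tch := [set f in F | ~~ [disjoint f & ball F t n]].
  have : 6 * (5 * n.+1 ^ 2) <= 6 * #|Tch| by rewrite leq_mul2l; apply: (touched_ball PT D56 farK Ef tT nk).
  rewrite mulnA => /leq_trans; apply.
  apply: (@leq_trans #|[set d : flag F | fset d \in Tch]|); last first.
    apply: subset_leq_card; apply/subsetP=> d; rewrite [d \in _]inE inE => /andP[_].
    case/(touched_code IH)=> phi [s [ft ->]]; apply/imsetP; exists (phi, s) => //.
    by rewrite inE /= inE ft eqxx inE.
  rewrite -[X in _ <= X]sum1_card (partition_big (@fset V F) (mem Tch)) /=; last by move=> d; rewrite inE.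
  rewrite mulnC -sum_nat_const; apply: leq_sum => f fT.
  have fF : f \in F by move: fT; rewrite inE => /andP[].
  rewrite sum1_card; apply: leq_trans (card_fset PT fF) _.
  apply: subset_leq_card; apply/subsetP=> d; rewrite inE => /eqP E.
  by rewrite unfold_in inE E fT eqxx.
(* A flag at [t] already has the code [(false, 0, 0, 0)] in its own sector. *)
have notT phi i j l : fx phi = t -> i + j <= n -> 0 < l < 3 -> fx (cd (false, i, j, l) phi) = t -> False.
  move=> ft ijn /andP[l0 l3] E.
  have sij : sz (false, i, j, l) < n.+1 by rewrite /= addn0.
  have [s Es] := @dec_ex n.+1 (false, i, j, l) l3 sij.
  have [s' Es'] := @dec_ex n.+1 (false, 0, 0, 0) isT isT.
  pose psi := cd (false, i, j, l) phi.
  have : (phi, s) = (psi, s').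
    by apply: inj; rewrite ?inE /= ?ft ?E ?eqxx // /Psi /= Es Es'.
  by case=> _ Ess; move: l0; rewrite -[l]/((false, i, j, l).2) -Es Ess Es'.
move=> phi ft i j /andP[ij0]; rewrite leq_eqVlt => /orP[/eqP Eij|ijn]; last first.
  by apply: IH => //; rewrite ij0.
case: (D56 (fx (U i j phi))) => // d5.
have uT : fx (U i j phi) \in pent F by rewrite inE d5.
have [Et|nt] := eqVneq t (fx (U i j phi)); last first.
  have := farK tT uT nt (n := n.+1); rewrite -{1}Eij -{1}ft U_ball => /(_ isT); lia.
exfalso; case: i Eij Et {ij0 d5 uT} => [|i] Eij Et.
  case: j Eij Et => [|j] // [Eij] Et.
  by apply: (@notT phi 0 j 2) => //; rewrite ?Eij.
by apply: (@notT phi i j 1) => //; move: Eij; clear; lia.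
Qed.

End FarCone.
End Cone.

(** * Automorphisms *)

Section Automorphisms.
Variables (V : finType) (F : {set {set V}}).
Hypothesis PT : plane_triangulation F.
Hypothesis D56 : forall v : V, tri_deg F v = 5 \/ tri_deg F v = 6.

Local Notation a := (@s0 V F).
Local Notation b := (@s1 V F).
Local Notation c := (@s2 V F PT).

Lemma autP (s : {perm V}) : reflect (forall x y, tri_adj F (s x) (s y) = tri_adj F x y) (s \in graph_aut F).
Proof.
rewrite inE; apply: (iffP forallP) => [H x y|H x].
  by apply/eqP; move/forallP: (H x); apply.
by apply/forallP=> y; rewrite H.
Qed.

Lemma aut_group_set : group_set (graph_aut F).
Proof.
apply/group_setP; split; first by apply/autP=> x y; rewrite !perm1.
by move=> s t /autP Hs /autP Ht; apply/autP=> x y; rewrite !permM Ht Hs.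
Qed.
Canonical aut_group := Group aut_group_set.

Lemma aut_face s x y z : s \in graph_aut F -> face F x y z -> face F (s x) (s y) (s z).
Proof.
move=> /autP H f; apply: (clique_face PT D56); rewrite H.
- exact: (face_adj12 PT f).
- exact: (face_adj23 PT f).
- exact: (face_adj13 PT f).
Qed.

(** The fallback of [insubd] never occurs for an automorphism, which maps faces to faces by
    [aut_face]. *)
Definition act (s : {perm V}) (d : flag F) : flag F :=
  insubd d (s (fx d), s (fy d), s (fz d)).

Lemma actE s d : s \in graph_aut F ->
  [/\ fx (act s d) = s (fx d), fy (act s d) = s (fy d) & fz (act s d) = s (fz d)].
Proof.
by move=> sA; rewrite /fx /fy /fz /act insubdK //; apply: (aut_face sA (flagF d)).
Qed.

Lemma act_a s d : s \in graph_aut F -> act s (a d) = a (act s d).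
Proof. by move=> sA; have [x1 y1 z1] := actE d sA; have [x2 y2 z2] := actE (a d) sA; apply: flag_eq; rewrite ?x2 ?y2 ?z2. Qed.

Lemma act_b s d : s \in graph_aut F -> act s (b d) = b (act s d).
Proof. by move=> sA; have [x1 y1 z1] := actE d sA; have [x2 y2 z2] := actE (b d) sA; apply: flag_eq; rewrite ?x2 ?y2 ?z2. Qed.

Lemma act_c s d : s \in graph_aut F -> act s (c d) = c (act s d).
Proof.
move=> sA; have [x1 y1 z1] := actE d sA; have [x2 y2 z2] := actE (c d) sA.
apply: flag_eq; rewrite ?x2 ?y2 ?z2 //.
have f := aut_face sA (flagF d); have f' := aut_face sA (flagF (c d)).
rewrite -[fz (c (act s d))]/(opp F (fx (act s d)) (fy (act s d)) (fz (act s d))) x1 y1 z1.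
apply: (opp_only PT f) => //; rewrite (inj_eq perm_inj); exact: (s2_neq PT d).
Qed.

Lemma act_inj s t d : s \in graph_aut F -> t \in graph_aut F -> act s d = act t d -> s = t.
Proof.
move=> sA tA E.
have H : forall e, act s e = act t e.
  refine (@flag_ind V F PT D56 (fun e => act s e = act t e) d E _ _ _) => e Ee; rewrite ?act_a ?act_b ?act_c //; by rewrite Ee.
apply/permP=> v; have [e <-] := vertex_flag PT v.
by have [<- _ _] := actE e sA; have [<- _ _] := actE e tA; rewrite H.
Qed.

Lemma actM s t d : s \in graph_aut F -> t \in graph_aut F -> act t (act s d) = act (s * t)%g d.
Proof.
move=> sA tA; have stA : (s * t)%g \in graph_aut F by apply: (groupM (G := aut_group)).
have [x1 y1 z1] := actE d sA; have [x2 y2 z2] := actE (act s d) tA; have [x3 y3 z3] := actE d stA.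
by apply: flag_eq; rewrite ?x2 ?y2 ?z2 ?x3 ?y3 ?z3 permM ?x1 ?y1 ?z1.
Qed.

Lemma act1 d : act 1%g d = d.
Proof.
have A1 : 1%g \in graph_aut F by apply: (group1 aut_group).
by have [x1 y1 z1] := actE d A1; apply: flag_eq; rewrite ?x1 ?y1 ?z1 perm1.
Qed.

Lemma aut_deg s v : s \in graph_aut F -> tri_deg F (s v) = tri_deg F v.
Proof.
move=> /autP H; rewrite /tri_deg -[RHS](card_imset _ (@perm_inj _ s)); apply: eq_card => w.
apply/idP/imsetP => [|[u]]; rewrite inE; last by move=> ? ->; rewrite inE H.
by move=> h1; exists (s^-1 w)%g; rewrite ?permKV // inE -H permKV.
Qed.

Lemma act_pflag s d : s \in graph_aut F -> (act s d \in pflag F) = (d \in pflag F).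
Proof. by move=> sA; have [x1 _ _] := actE d sA; rewrite [LHS]inE [RHS]inE x1 !inE aut_deg. Qed.

(** A vertex is a class of flags under [b] and [c], so [G] descends to the vertices; adjacency is
    read off from the first two vertices of a flag. *)
Lemma aut_of_flags (G : flag F -> flag F) : injective G -> (forall d, G (a d) = a (G d)) ->
  (forall d, G (b d) = b (G d)) -> (forall d, G (c d) = c (G d)) ->
  exists2 s, s \in graph_aut F & forall d, act s d = G d.
Proof.
move=> Ginj Ga Gb Gc.
have Gr m d : G (iter m (rr PT) d) = iter m (rr PT) (G d).
  by elim: m => // m IH; rewrite !iterS -IH [in LHS]/rr Gc Gb.
have Gx d e : fx d = fx e -> fx (G d) = fx (G e).
  by case/(same_vertex PT D56) => m [->|->]; rewrite Gr fx_iter // Gc.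
have Gx' d e : fx (G d) = fx (G e) -> fx d = fx e.
  by case/(same_vertex PT D56) => m [E|E]; rewrite -?Gc -Gr in E; rewrite (Ginj _ _ E) fx_iter.
have [d0 _ | v0] := pickP (@predT (flag F)); last first.
  by exists 1%g; [exact: (group1 aut_group)|move=> d; have := v0 d].
pose pk v := odflt d0 [pick d : flag F | fx d == v].
have pkE v : fx (pk v) = v.
  by rewrite /pk; case: pickP => [d /eqP//|h]; have [d Ed] := vertex_flag PT v; have := h d; rewrite Ed eqxx.
pose sg v := fx (G (pk v)).
have sgE d : sg (fx d) = fx (G d) by apply: Gx; rewrite pkE.
have sg_inj : injective sg by move=> u v /Gx'; rewrite !pkE.
have [Gi _ GK] := injF_bij Ginj.
have sgy d : sg (fy d) = fy (G d) by rewrite -[fy d]/(fx (a d)) sgE Ga.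
have sgz d : sg (fz d) = fz (G d) by rewrite -[fz d]/(fy (b d)) sgy Gb.
have sA : perm sg_inj \in graph_aut F.
  apply/autP=> u v; rewrite !permE; apply/idP/idP => /(adjP PT)[w f].
    pose e : flag F := mkflag f.
    have eG : G (Gi e) = e by apply: GK.
    have E1 : fx (Gi e) = u by apply: sg_inj; rewrite sgE eG.
    have E2 : fy (Gi e) = v by apply: sg_inj; rewrite sgy eG.
    by rewrite -E1 -E2; apply: (face_adj12 PT (flagF (Gi e))).
  pose e : flag F := mkflag f; have -> : sg u = fx (G e) := sgE e.
  have -> : sg v = fy (G e) := sgy e.
  exact: (face_adj12 PT (flagF (G e))).
exists (perm sg_inj) => // d; have [x1 y1 z1] := actE d sA.
by apply: flag_eq; rewrite ?x1 ?y1 ?z1 permE ?sgE ?sgy ?sgz.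
Qed.

Lemma aut_regular phi psi : #|graph_aut F| = 120 -> phi \in pflag F -> psi \in pflag F ->
  exists2 s, s \in graph_aut F & act s phi = psi.
Proof.
move=> c120 fP pP.
have : [set act s phi | s in graph_aut F] == pflag F.
  rewrite eqEcard (card_pflag PT D56) card_in_imset; last by move=> s t sA tA; apply: act_inj.
  by rewrite c120 leqnn andbT; apply/subsetP=> d /imsetP[s sA ->]; rewrite act_pflag.
by move/eqP/setP/(_ psi); rewrite pP => /imsetP[s sA ->]; exists s.
Qed.

(** * From 120 automorphisms to large distances *)

Section Backward.
Variable k : nat.
Hypothesis Ef : #|F| = 60 * k ^ 2.
Hypothesis c120 : #|graph_aut F| = 120.

Let cls (d : flag F) : {set flag F} := [set act s d | s in graph_aut F].
Let P : {set {set flag F}} := cls @: [set: flag F].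
Let T := {X : {set flag F} | X \in P}.
Let cl d : T := exist _ (cls d) (imset_f cls (in_setT d)).

Let cls_self d : d \in cls d.
Proof. by apply/imsetP; exists 1%g; rewrite ?act1 //; apply: (group1 aut_group). Qed.

Let cls_eq d e : e \in cls d -> cls e = cls d.
Proof.
case/imsetP=> s sA ->; have sV : (s^-1)%g \in graph_aut F by apply: (groupVr (G := aut_group)).
apply/setP=> f; apply/imsetP/imsetP=> -[t tA ->].
  by exists (s * t)%g; rewrite ?actM //; apply: (groupM (G := aut_group)).
exists (s^-1 * t)%g; first exact: (groupM (G := aut_group)).
by rewrite actM ?mulKVg //; apply: (groupM (G := aut_group)).
Qed.

Let cl_eq d e : cl d = cl e <-> e \in cls d.
Proof.
split=> [/(congr1 val)/= E|/cls_eq E]; last exact/esym/val_inj.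
by rewrite [cls d]E.
Qed.

Let card_cls d : #|cls d| = 120.
Proof. by rewrite card_in_imset // => s t sA tA; apply: act_inj. Qed.

Let cardT : #|{: T}| = 3 * k ^ 2.
Proof.
have : #|{: flag F}| = #|P| * 120.
  rewrite -cardsT -sum1_card (partition_big cls (mem P)) /=; last first.
    by move=> d _; apply: imset_f; rewrite inE.
  rewrite -sum_nat_const; apply: eq_bigr => X /imsetP[d _ ->]; rewrite sum1_card -(card_cls d).
  apply: eq_card => e; rewrite unfold_in in_setT /=; apply/eqP/idP => [<-|/cls_eq//]; exact: cls_self.
rewrite (card_flags PT) Ef card_sig (_ : #|[pred X | X \in P]| = #|P|); last exact: eq_card.
by clear; lia.
Qed.

(** The lattice relations hold on the quotient even at vertices of degree 5: their flags form one
    class, fixed by [b] and [c], on which six turns act trivially. *)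
Lemma reg_far : far F k.
Proof.
have [->|k0] := posnP k; first by move=> *.
have [t0 t0T] : exists t, t \in pent F.
  by apply/set0Pn; rewrite -card_gt0 (card_pent PT D56).
have [phi0 E0] := vertex_flag PT t0.
have p0 : phi0 \in pflag F by rewrite inE E0.
pose rp (X : T) := odflt phi0 [pick d | cl d == X].
have rpK X : cl (rp X) = X.
  rewrite /rp; case: pickP => [d /eqP//|h]; have /imsetP[d _ E] := valP X.
  by have /eqP[] := h d; apply: val_inj.
pose lift f (X : T) := cl (f (rp X)).
have liftE f d : (forall s e, s \in graph_aut F -> act s (f e) = f (act s e)) -> lift f (cl d) = cl (f d).
  move=> fA; apply/esym/cl_eq; have /cl_eq/imsetP[s sA ->] := esym (rpK (cl d)).
  by rewrite -fA //; apply: imset_f.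
have la d : lift a (cl d) = cl (a d) by apply: liftE => s e; apply: act_a.
have lb d : lift b (cl d) = cl (b d) by apply: liftE => s e; apply: act_b.
have lc d : lift c (cl d) = cl (c d) by apply: liftE => s e; apply: act_c.
have clP phi psi : phi \in pflag F -> psi \in pflag F -> cl phi = cl psi.
  by move=> h1 h2; apply/cl_eq; have [s sA <-] := aut_regular c120 h1 h2; apply: imset_f.
pose p := cl phi0.
have gap i j : iter i (gA (lift a) (lift b) (lift c)) (iter j (gB (lift a) (lift b) (lift c)) p) = p ->
    0 < i + j -> 2 * k <= i + j.
  apply: (lattice_gap (a := lift a) (b := lift b) (c := lift c)) cardT.
  - by move=> X; rewrite -(rpK X) !la s0K.
  - by move=> X; rewrite -(rpK X) !lb s1K.
  - by move=> X; rewrite -(rpK X) !lc s2K.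
  - by move=> X; rewrite -(rpK X) !(la, lc) s02.
  - by move=> X; rewrite -(rpK X) !(la, lb) flag_braid.
  - move=> X; rewrite -(rpK X); set d := rp X.
    have -> : iter 6 (gr (lift b) (lift c)) (cl d) = cl (iter 6 (gr b c) d).
      by elim: 6 => //= m ->; rewrite /gr lb lc.
    case: (D56 (fx d)) => dd; last by rewrite flag_r6.
    apply: clP; rewrite [_ \in _]inE; last by rewrite inE dd.
    rewrite (_ : fx _ = fx d) ?inE ?dd //; exact: (fx_iter PT 6 d).
  - by rewrite /p lb; apply: clP => //; rewrite inE -[fx (b phi0)]/(fx phi0) E0.
  - by rewrite /p lc; apply: clP => //; rewrite inE -[fx (c phi0)]/(fx phi0) E0.
  - move=> Q Qp Qa Qb Qc X; rewrite -(rpK X); move: (rp X).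
    refine (@flag_ind V F PT D56 (fun d => Q (cl d)) phi0 Qp _ _ _) => e Qe; rewrite -?la -?lb -?lc; auto.
have lU i j d : iter i (gA (lift a) (lift b) (lift c)) (iter j (gB (lift a) (lift b) (lift c)) (cl d))
    = cl (U PT i j d).
  rewrite /U; elim: i => [|i IH]; last by rewrite !iterS IH /gA /gi /gh !(la, lb, lc).
  by elim: j => //= j ->; rewrite /gB /gr /gh /gx !(la, lb, lc).
have fl t : t \in pent F -> flat PT t (2 * k).-1.
  move=> tT phi ft i j /andP[ij0 ijk]; case: (D56 (fx (U PT i j phi))) => // d5.
  have fP : phi \in pflag F by rewrite inE ft.
  have uP : U PT i j phi \in pflag F by rewrite [_ \in _]inE inE d5.
  have := gap i j; rewrite /p (clP _ _ p0 fP) lU (clP _ _ uP fP) => /(_ erefl ij0).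
  by move: ijk k0; clear; lia.
move=> t u n tT uT ntu un; rewrite leqNgt; apply/negP=> nk.
have nk' : n <= (2 * k).-1 by move: nk; clear; lia.
have [phi [i [j [ft ijn Eu]]]] := ball_code D56 (fl t tT) nk' un.
have [ij0|ij0] := posnP (i + j).
  move: Eu ij0; case: (i) => // Eu; case: (j) Eu => // Eu _.
  by case/eqP: ntu; rewrite Eu -ft.
have := fl t tT phi ft i j; rewrite ij0 (leq_trans ijn nk') => /(_ isT) d6.
by move: uT; rewrite inE Eu d6.
Qed.

End Backward.
End Automorphisms.

(** * The group H3 *)

Section Words.
Variables (T : Type) (gs : seq (T -> T)).

Definition ev (w : seq nat) (t : T) := foldr (fun g => nth id gs g) t w.

Lemma ev_cat u v t : ev (u ++ v) t = ev u (ev v t).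
Proof. by rewrite /ev foldr_cat. Qed.

Fixpoint rewrite1 (l r w : seq nat) : seq nat :=
  if prefix l w then r ++ drop (size l) w else if w is x :: w' then x :: rewrite1 l r w' else [::].

Definition pass (rules : seq (seq nat * seq nat)) (w : seq nat) :=
  foldl (fun w p => rewrite1 p.1 p.2 w) w rules.
Definition reduce (rules : seq (seq nat * seq nat)) (n : nat) (w : seq nat) := iter n (pass rules) w.

Variable S : T -> Prop.
Hypothesis Sgs : forall g t, S t -> S (nth id gs g t).

Lemma ev_in w t : S t -> S (ev w t).
Proof. by elim: w => //= g w IH St; apply: Sgs; apply: IH. Qed.

Definition valid (p : seq nat * seq nat) := forall t, S t -> ev p.1 t = ev p.2 t.

Lemma rewrite1_ev l r w t : valid (l, r) -> S t -> ev (rewrite1 l r w) t = ev w t.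
Proof.
move=> lr St; have base u : prefix l u -> ev (r ++ drop (size l) u) t = ev u t.
  move=> /prefixP[v ->]; rewrite drop_size_cat // !ev_cat; exact/esym/lr/ev_in.
have E u : rewrite1 l r u = if prefix l u then r ++ drop (size l) u
    else if u is x :: u' then x :: rewrite1 l r u' else [::] by case: u.
elim: w => [|x w IH]; rewrite E; case: ifP => [h|_]; [exact: base|by []|exact: base|].
by rewrite [LHS]/= IH.
Qed.

Lemma pass_ev rules w t : (forall p, p \in rules -> valid p) -> S t -> ev (pass rules w) t = ev w t.
Proof.
rewrite /pass; elim: rules w => //= p rs IH w H St; rewrite IH // => [|q qrs].
  by apply: rewrite1_ev => //; case: p H => l r H; apply: H; rewrite inE eqxx.
by apply: H; rewrite inE qrs orbT.
Qed.

Lemma reduce_ev rules n w t : (forall p, p \in rules -> valid p) -> S t ->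
  ev (reduce rules n w) t = ev w t.
Proof. by move=> H St; rewrite /reduce; elim: n => //= n IH; rewrite pass_ev. Qed.

End Words.

(* The relations of the Coxeter group of the icosahedron, followed by the three
   rules that the Knuth-Bendix procedure adds to make them confluent. *)
Definition H3_rules : seq (seq nat * seq nat) :=
  [:: ([:: 0; 0], [::]); ([:: 1; 1], [::]); ([:: 2; 2], [::]); ([:: 2; 0], [:: 0; 2]);
      ([:: 2; 1; 2], [:: 1; 2; 1]); ([:: 1; 0; 1; 0; 1], [:: 0; 1; 0; 1; 0])].
Definition H3_extra : seq (seq nat * seq nat) :=
  [:: ([:: 2; 1; 0; 2], [:: 1; 2; 1; 0]);
      ([:: 2; 1; 0; 1; 2; 1], [:: 1; 2; 1; 0; 1; 2]);
      ([:: 2; 1; 0; 1; 0; 2; 1; 0; 1; 0], [:: 1; 2; 1; 0; 1; 0; 2; 1; 0; 1])].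

Definition H3_step (ws : seq (seq nat)) :=
  undup (ws ++ [seq reduce (H3_rules ++ H3_extra) 20 (g :: w) | g <- [:: 0; 1; 2], w <- ws]).
(** Fifteen rounds suffice, as the longest element of the icosahedral Coxeter group has length 15;
    closure of the list is confirmed by [H3_words_check]. *)
Definition H3_words := Eval vm_compute in iter 15 H3_step [:: [::]].

Lemma size_H3_words : size H3_words = 120. Proof. by vm_compute. Qed.

Lemma H3_words_check : all (fun g => all (fun w =>
  reduce (H3_rules ++ H3_extra) 20 (g :: w) \in H3_words) H3_words) [:: 0; 1; 2].
Proof. by vm_compute. Qed.

Lemma H3_words_closed g w : g < 3 -> w \in H3_words ->
  reduce (H3_rules ++ H3_extra) 20 (g :: w) \in H3_words.
Proof.
move=> g3 wN; have gm : g \in [:: 0; 1; 2] by case: g g3 => [|[|[|]]].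
exact: (allP (allP H3_words_check g gm) w wN).
Qed.

Section H3Action.
Variables (T : Type) (gs : seq (T -> T)) (S : T -> Prop).
Hypothesis Sgs : forall g t, S t -> S (nth id gs g t).
Hypothesis H3 : forall p, p \in H3_rules -> valid gs S p.

(** Each extra rule resolves a critical pair: a word in which two left-hand sides overlap is reduced
    in both ways. *)
Lemma H3_all p : p \in H3_rules ++ H3_extra -> valid gs S p.
Proof.
have step rs l r u w1 w2 v : (forall p, p \in rs -> valid gs S p) -> valid gs S (l, r) ->
  valid gs S (w1, w2) -> forall x y, reduce rs 20 (r ++ v) = x -> reduce rs 20 (u ++ w2) = y ->
  l ++ v = u ++ w1 -> valid gs S (x, y) /\ valid gs S (y, x).
  move=> Hrs lr ww x y <- <- E.
  suff H : valid gs S (reduce rs 20 (r ++ v), reduce rs 20 (u ++ w2)) by split=> // t St; apply/esym/H.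
  move=> t St; change (ev gs (reduce rs 20 (r ++ v)) t = ev gs (reduce rs 20 (u ++ w2)) t).
  rewrite !(reduce_ev Sgs) // !ev_cat; have lr' := lr _ (ev_in Sgs v St); have ww' := ww _ St.
  by rewrite /= in lr' ww'; rewrite -lr' -ww' -!ev_cat E.
have ext rs q : (forall p, p \in rs -> valid gs S p) -> valid gs S q ->
  forall p, p \in rcons rs q -> valid gs S p.
  by move=> h1 h2 p'; rewrite mem_rcons inE => /orP[/eqP->//|]; apply: h1.
have v1 : valid gs S ([:: 2; 1; 0; 2], [:: 1; 2; 1; 0]).
  refine (proj2 (@step H3_rules [:: 2; 1; 2] [:: 1; 2; 1] [:: 2; 1] [:: 2; 0] [:: 0; 2] [:: 0]
    H3 (@H3 ([:: 2; 1; 2], [:: 1; 2; 1]) isT) (@H3 ([:: 2; 0], [:: 0; 2]) isT) _ _ _ _ _)); by vm_compute.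
have H1 := ext _ _ H3 v1.
have v2 : valid gs S ([:: 2; 1; 0; 1; 2; 1], [:: 1; 2; 1; 0; 1; 2]).
  refine (proj2 (@step _ [:: 2; 1; 0; 2] [:: 1; 2; 1; 0] [:: 2; 1; 0] [:: 2; 1; 2] [:: 1; 2; 1] [:: 1; 2]
    H1 v1 (@H3 ([:: 2; 1; 2], [:: 1; 2; 1]) isT) _ _ _ _ _)); by vm_compute.
have H2 := ext _ _ H1 v2.
have v3 : valid gs S ([:: 2; 1; 0; 1; 0; 2; 1; 0; 1; 0], [:: 1; 2; 1; 0; 1; 0; 2; 1; 0; 1]).
  refine (proj2 (@step _ [:: 2; 1; 0; 1; 2; 1] [:: 1; 2; 1; 0; 1; 2] [:: 2; 1; 0; 1; 2]
    [:: 1; 0; 1; 0; 1] [:: 0; 1; 0; 1; 0] [:: 0; 1; 0; 1]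
    H2 v2 (@H3 ([:: 1; 0; 1; 0; 1], [:: 0; 1; 0; 1; 0]) isT) _ _ _ _ _)); by vm_compute.
by rewrite mem_cat => /orP[/H3//|]; rewrite !inE => /or3P[] /eqP->.
Qed.

End H3Action.

(** * Transitive actions of H3 on 120 points *)

Section Regular.
Variables (T : finType) (gs : seq (T -> T)) (S : {set T}).
Hypothesis Sgs : forall g t, t \in S -> nth id gs g t \in S.
Hypothesis gs3 : size gs = 3.
Hypothesis H3 : forall p, p \in H3_rules -> valid gs (fun t => t \in S) p.
Hypothesis cS : #|S| = 120.
Hypothesis trans : forall X : {set T}, X \subset S -> X != set0 ->
  (forall g t, t \in X -> nth id gs g t \in X) -> X = S.

Lemma H3_orbit t : t \in S -> [set s in [seq ev gs w t | w <- H3_words]] = S.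
Proof.
move=> tS; apply: trans.
- by apply/subsetP=> s; rewrite inE => /mapP[w _ ->]; apply: (ev_in (S := fun t => t \in S)).
- by apply/set0Pn; exists t; rewrite inE; apply/mapP; exists [::].
move=> g s; rewrite inE => /mapP[w wN ->].
have [g3|g3] := ltnP g 3; last by rewrite nth_default ?gs3 // inE; apply/mapP; exists w.
rewrite inE; apply/mapP; exists (reduce (H3_rules ++ H3_extra) 20 (g :: w)); first exact: H3_words_closed.
by rewrite (reduce_ev (S := fun t => t \in S)) //; apply: H3_all.
Qed.

(** The 120 normal forms reach all 120 points, so no two of them agree at [t]. *)
Lemma H3_free t : t \in S -> {in H3_words &, injective (fun w => ev gs w t)}.
Proof.
move=> tS; have : uniq [seq ev gs w t | w <- H3_words].
  apply/card_uniqP; rewrite size_map size_H3_words -[RHS]cS -(H3_orbit tS).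
  by apply: eq_card => s; rewrite inE.
move=> u w w' wN w'N E; apply/eqP; rewrite -(nth_index [::] wN) -(nth_index [::] w'N).
have iw : index w H3_words < size H3_words by rewrite index_mem.
have iw' : index w' H3_words < size H3_words by rewrite index_mem.
suff -> : index w H3_words = index w' H3_words by [].
apply/eqP; rewrite -(nth_uniq t _ _ u) ?size_map // !(nth_map [::]) //.
by rewrite !nth_index // E.
Qed.

(** By freeness, sending the image of [phi] under a word to the image of [psi] under the same word
    is well defined. *)
Lemma H3_extend phi psi : phi \in S -> psi \in S -> exists g : T -> T,
  [/\ g phi = psi, {in S, forall t, g t \in S}, {in S &, injective g} &
      forall i t, t \in S -> g (nth id gs i t) = nth id gs i (g t)].
Proof.
move=> pS qS.
pose wd t := nth [::] H3_words (index t [seq ev gs w phi | w <- H3_words]).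
have wdP t : t \in S -> wd t \in H3_words /\ ev gs (wd t) phi = t.
  rewrite -{1}(H3_orbit pS) inE => tm; have := tm; rewrite -index_mem size_map => lt.
  by split; [exact: mem_nth | rewrite /wd -(nth_map [::] t (fun w => ev gs w phi)) // nth_index].
pose g t := ev gs (wd t) psi.
have gE w : w \in H3_words -> g (ev gs w phi) = ev gs w psi.
  move=> wN; have eS : ev gs w phi \in S by apply: (ev_in (S := fun t => t \in S)).
  by have [wN' E] := wdP _ eS; rewrite /g (H3_free pS wN' wN E).
exists g; split.
- by rewrite -[phi]/(ev gs [::] phi) gE.
- by move=> t tS; apply: (ev_in (S := fun t => t \in S)).
- move=> t s /wdP[tN Et] /wdP[sN Es] E; rewrite -Et -Es.
  by rewrite (H3_free qS tN sN E).
move=> i t tS; have [tN Et] := wdP t tS.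
have [i3|i3] := ltnP i 3; last by rewrite nth_default ?gs3.
have cl := H3_words_closed i3 tN.
have all_ : forall p, p \in H3_rules ++ H3_extra -> valid gs (fun t => t \in S) p.
  by apply: H3_all.
rewrite -{1}Et -[nth id gs i (ev gs (wd t) phi)]/(ev gs (i :: wd t) phi).
rewrite -(reduce_ev (S := fun t => t \in S) Sgs 20 _ all_ pS) gE //.
by rewrite (reduce_ev (S := fun t => t \in S) Sgs 20 _ all_ qS).
Qed.

End Regular.

(** * Groups generated by three elements that satisfy the H3 relations *)

Section H3Group.
Variables (gT : finGroupType) (gs : seq gT).
Hypothesis gs3 : size gs = 3.

(** Left multiplications turn the group into an action, so the rewriting lemmas apply to it. *)
Definition lmul : seq (gT -> gT) := [seq (fun g t : gT => (g * t)%g) x | x <- gs].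
Definition gev (w : seq nat) : gT := ev lmul w 1%g.

Lemma nth_lmul i t : nth id lmul i t = (nth 1 gs i * t)%g.
Proof.
have [h|h] := ltnP i (size gs); first by rewrite (nth_map 1%g).
by rewrite !nth_default ?size_map // mul1g.
Qed.

Lemma gevE w t : ev lmul w t = (gev w * t)%g.
Proof. by elim: w => [|i w IH] /=; rewrite /gev /= ?mul1g // nth_lmul IH nth_lmul mulgA. Qed.

Lemma gev_cons i w : gev (i :: w) = (nth 1 gs i * gev w)%g.
Proof. by rewrite /gev /= nth_lmul. Qed.

Hypothesis H3g : forall p, p \in H3_rules -> gev p.1 = gev p.2.

Let G := <<[set x in gs]>>%g.

Lemma gev_in w : gev w \in G.
Proof.
elim: w => [|i w IH]; first exact: group1.
rewrite /gev /= nth_lmul groupM //; have [h|h] := ltnP i (size gs); last by rewrite nth_default.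
by apply: mem_gen; rewrite inE mem_nth.
Qed.

Lemma H3_gen x : x \in G -> x \in [seq gev w | w <- H3_words].
Proof.
case/gen_prodgP=> n [c cA ->]; elim: n c cA => [|n IH] c cA.
  by rewrite big_ord0; apply/mapP; exists [::].
rewrite big_ord_recl; have /mapP[w wN ->] := IH (fun i => c (lift ord0 i)) (fun i => cA _).
have := cA ord0; rewrite inE => /(nthP 1%g)[i i3 <-]; rewrite gs3 in i3.
apply/mapP; exists (reduce (H3_rules ++ H3_extra) 20 (i :: w)); first exact: H3_words_closed.
rewrite -gev_cons [RHS]/gev (reduce_ev (S := fun=> True)) // => p.
by apply: H3_all => // q /H3g E t _; rewrite !gevE E.
Qed.

Lemma H3_card : #|G| <= 120.
Proof.
rewrite -size_H3_words -(size_map gev); apply: leq_trans (card_size _).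
by apply: subset_leq_card; apply/subsetP=> x /H3_gen.
Qed.

Lemma H3_card_ge : uniq [seq gev w | w <- H3_words] -> 120 <= #|G|.
Proof.
move=> u; rewrite -size_H3_words -(size_map gev) -(card_uniqP u).
by apply: subset_leq_card; apply/subsetP=> g; case/mapP=> w _ ->; apply: gev_in.
Qed.

End H3Group.

(** The pairs of generators span a subgroup [L] of the product. It satisfies the relations, so it
    has at most 120 elements, and it maps onto both groups; hence both projections are injective on
    it. *)
Lemma H3_isog (gT hT : finGroupType) (gs : seq gT) (hs : seq hT) : size gs = 3 -> size hs = 3 ->
  (forall p, p \in H3_rules -> gev gs p.1 = gev gs p.2) ->
  (forall p, p \in H3_rules -> gev hs p.1 = gev hs p.2) ->
  120 <= #|<<[set x in gs]>>%g| -> 120 <= #|<<[set x in hs]>>%g| ->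
  (<<[set x in gs]>> \isog <<[set x in hs]>>)%g.
Proof.
move=> g3 h3 Hg Hh cg ch; pose ps := zip gs hs.
have p3 : size ps = 3 by rewrite size_zip g3 h3.
have pev w : gev ps w = (gev gs w, gev hs w).
  elim: w => [|i w IH] //; rewrite !gev_cons IH.
  by rewrite (_ : nth 1%g ps i = (nth 1%g gs i, nth 1%g hs i)) // /ps -nth_zip ?g3.
have Hp p : p \in H3_rules -> gev ps p.1 = gev ps p.2 by move=> pR; rewrite !pev Hg ?Hh.
have cp := H3_card p3 Hp; set L := <<[set x in ps]>>%G; rewrite -/L in cp.
have iso (kT : finGroupType) (f : {morphism [set: gT * hT] >-> kT}) (ks : seq kT) :
    map f ps = ks -> 120 <= #|<<[set x in ks]>>%g| -> (L \isog <<[set x in ks]>>)%g.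
  move=> E ck; have EL : (f @* L)%g = <<[set x in ks]>>%g.
    rewrite morphim_gen ?subsetT //; congr (<<_>>)%g; rewrite morphimEsub ?subsetT // -E.
    apply/setP=> y; rewrite [RHS]inE; apply/imsetP/mapP=> -[z zp ->]; exists z; rewrite ?inE // in zp *.
  have inj : ('injm (restrm (subsetT L) f))%g.
    apply/injmP; apply/imset_injP; rewrite eqn_leq leq_imset_card /=.
    by apply: leq_trans cp (leq_trans ck _); rewrite -EL morphimEsub ?subsetT.
  by rewrite -EL; have := sub_isog (subxx L) inj; rewrite morphim_restrm setIid.
apply: (@isog_trans _ _ _ _ L); first by apply: isog_symr; apply: (iso _ [morphism of @fst gT hT]) => //; rewrite /= -/unzip1 /ps unzip1_zip ?g3 ?h3.
by apply: (iso _ [morphism of @snd gT hT]) => //; rewrite /= -/unzip2 /ps unzip2_zip ?g3 ?h3.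
Qed.

(** A reflection of the icosahedron is a half turn times the central inversion: an even involution
    of five points, paired with the swap in the second factor. *)
Definition ico_gens : seq ({perm 'I_5} * {perm bool}) :=
  [:: (tperm (inord 0) (inord 1) * tperm (inord 2) (inord 3), tperm true false);
      (tperm (inord 0) (inord 2) * tperm (inord 3) (inord 4), tperm true false);
      (tperm (inord 0) (inord 2) * tperm (inord 1) (inord 3), tperm true false)]%g.

(** The generators as lists of images, so that relations and distinctness are decided by
    evaluation. *)
Definition ico_table : seq (seq nat) := [:: [:: 1; 0; 3; 2; 4]; [:: 2; 1; 0; 4; 3]; [:: 2; 3; 0; 1; 4]].
Definition ico_eval (w : seq nat) (x : nat) := foldl (fun y g => nth 0 (nth [::] ico_table g) y) x w.

Lemma ico_gen i x z : i < 3 -> val ((nth 1%g ico_gens i).1 x) = nth 0 (nth [::] ico_table i) x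
  /\ (nth 1%g ico_gens i).2 z = ~~ z.
Proof.
move=> i3; split; last by case: i i3 => [|[|[|]]] //= _; case: z; rewrite ?tpermL ?tpermR.
have -> : x = inord x by rewrite inord_val.
case: i i3 => [|[|[|]]] //= _; case: x => -[|[|[|[|[|]]]]] // xx; rewrite permM !permE /= -!val_eqE /= ?inordK //= -?val_eqE /= ?inordK //.
Qed.

Lemma ico_gevE w x z : all (gtn 3) w ->
  val ((gev ico_gens w).1 x) = ico_eval w x /\ (gev ico_gens w).2 z = z (+) odd (size w).
Proof.
elim: w x z => [|i w IH] x z; first by rewrite /gev /= !perm1 addbF.
rewrite [all _ _]/= => /andP[i3 w3]; rewrite gev_cons.
have [E1 E2] := ico_gen x z i3; move: E1 E2; set g := nth _ _ i; set h := gev _ w => E1 E2.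
rewrite -[(g * h)%g.1]/(g.1 * h.1)%g -[(g * h)%g.2]/(g.2 * h.2)%g !permM /g /h.
 have [-> ->] := IH ((nth 1%g ico_gens i).1 x) ((nth 1%g ico_gens i).2 z) w3.
by rewrite E1 E2; split=> //=; case: z {E2}; case: odd.
Qed.

Lemma ico_rules p : p \in H3_rules -> gev ico_gens p.1 = gev ico_gens p.2.
Proof.
have H : all (fun p => [&& all (gtn 3) p.1, all (gtn 3) p.2, odd (size p.1) == odd (size p.2) &
  all (fun x => ico_eval p.1 x == ico_eval p.2 x) (iota 0 5)]) H3_rules by vm_compute.
move/(allP H)=> /and4P[h1 h2 /eqP h3 /allP h4].
suff [e1 e2] : (gev ico_gens p.1).1 = (gev ico_gens p.2).1 /\ (gev ico_gens p.1).2 = (gev ico_gens p.2).2.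
  by move: e1 e2; case: (gev _ p.1) => u1 u2; case: (gev _ p.2) => v1 v2 /= -> ->.
split; apply/permP=> x.
  apply: val_inj; have [-> _] := ico_gevE x true h1; have [-> _] := ico_gevE x true h2.
  by apply/eqP/h4; rewrite mem_iota /=.
by have [_ ->] := ico_gevE ord0 x h1; have [_ ->] := ico_gevE ord0 x h2; rewrite h3.
Qed.

Lemma ico_card : 120 <= #|<<[set x in ico_gens]>>%g|.
Proof.
have u : uniq [seq gev ico_gens w | w <- H3_words].
  pose h (g : {perm 'I_5} * {perm bool}) := ([seq val (g.1 (inord i)) | i <- iota 0 5], g.2 false).
  apply: (@map_uniq _ _ h); have w3 : all (all (gtn 3)) H3_words by vm_compute.
  have -> : map h [seq gev ico_gens w | w <- H3_words]
    = [seq ([seq ico_eval w i | i <- iota 0 5], odd (size w)) | w <- H3_words].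
    rewrite -map_comp; apply/eq_in_map => w /(allP w3) w3'.
    rewrite [LHS]/h; have [_ ->] := ico_gevE ord0 false w3'; congr (_, _).
    apply/eq_in_map => i; rewrite mem_iota /= => i5.
    by have [-> _] := ico_gevE (inord i) true w3'; rewrite inordK.
  by vm_compute.
exact: H3_card_ge u.
Qed.

Lemma ico_group : <<[set x in ico_gens]>>%g = Ih.
Proof.
apply/eqP; rewrite eqEcard; apply/andP; split; last first.
  apply: leq_trans ico_card; rewrite /Ih cardsX.
  have c2 : #|[set: {perm bool}]| = 2 by exact: (etrans (card_Sym bool) (congr1 factorial card_bool)).
  have c60 := @card_Alt 'I_5; rewrite card_ord in c60; have {}c60 := c60 isT.
  by rewrite c2 mulnC c60.
rewrite gen_subG; apply/subsetP=> -[g1 g2]; rewrite inE => gI; rewrite /Ih in_setX in_setT andbT Alt_even.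
move: gI; rewrite !inE => /or3P[] /eqP[-> _]; rewrite odd_permM !odd_tperm;
  by rewrite -!val_eqE /= !inordK.
Qed.

(** * Gluing the cones *)

Arguments cd : simpl never.

Section Forward.
Variables (V : finType) (F : {set {set V}}).
Hypothesis PT : plane_triangulation F.
Hypothesis D56 : forall v : V, tri_deg F v = 5 \/ tri_deg F v = 6.
Variable k' : nat.
Let k := k'.+1.
Hypothesis farK : far F k.
Hypothesis Ef : #|F| = 60 * k ^ 2.

Local Notation a := (@s0 V F).
Local Notation b := (@s1 V F).
Local Notation c := (@s2 V F PT).
Local Notation h := (gh a c).
Local Notation x := (gx a b).
Local Notation r := (gr b c).
Local Notation i1 := (gi b c).
Local Notation kd := (@cd V F PT).
Local Notation hst := (@hstep V F PT).

Let aK : involutive a := @s0K V F.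
Let bK : involutive b := @s1K V F.
Let cK : involutive c := @s2K V F PT.
Let ac d : a (c d) = c (a d). Proof. exact: s02. Qed.
Let aba := @flag_braid V F.

Let FL phi : phi \in pflag F -> flat PT (fx phi) k.
Proof.
move=> pP; have tT : fx phi \in pent F by move: pP; rewrite inE.
exact: (@far_flat V F PT D56 k farK Ef _ k tT (leqnn k)).
Qed.

Definition okc (q : code) := (q.2 < 3) && (sz q < k).

Let cdh phi q : phi \in pflag F -> okc q -> h (kd q phi) = kd (hst q).1 ((hst q).2 phi).
Proof. by move=> pP /andP[q3 qs]; apply: (cd_h (FL pP)) => //; apply: ltnW. Qed.

Let cdb phi q : phi \in pflag F -> okc q -> b (kd q phi) = kd (bstep q) (b phi).
Proof. by move=> pP /andP[q3 qs]; apply: (cd_b (FL pP)) => //; apply: ltnW. Qed.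

Let fxP phi psi : fx phi = fx psi -> phi \in pflag F -> psi \in pflag F.
Proof. by rewrite !inE => ->. Qed.
Let bP phi : phi \in pflag F -> b phi \in pflag F. Proof. exact: fxP. Qed.
Let cP phi : phi \in pflag F -> c phi \in pflag F. Proof. exact: fxP. Qed.
Let rP phi : phi \in pflag F -> r phi \in pflag F. Proof. exact: fxP. Qed.
Let iP phi : phi \in pflag F -> i1 phi \in pflag F. Proof. exact: fxP. Qed.

Let hstepP q phi : phi \in pflag F -> (hst q).2 phi \in pflag F.
Proof.
move=> pP; case: q => -[[[] i] j] l; first by case: l => [|[|l]].
case: l => [|[|l]] //=; last by case: i => //=; apply: rP.
by case: j => //=; apply: iP.
Qed.

Let xstep_ok q : okc q -> okc (xstep q).
Proof. by case: q => -[[u i] j] [|[|[|l]]] //=; rewrite /okc /= => /andP[]. Qed.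
Let bstep_ok q : okc q -> okc (bstep q).
Proof. by case: q => -[[[] i] j] [|[|[|l]]] //=; rewrite /okc /= addnC (addnC j) // addnC (addnC i). Qed.

(** The [i]-th triangle along the outer side of a sector, turned so that crossing its first edge
    leaves the cone. *)
Definition rim_code i : code := (false, i, k' - i, 1).

Let hstep_ok q : okc q -> (forall i, i <= k' -> q <> rim_code i) -> okc (hst q).1.
Proof.
case: q => -[[[] i] j] l; rewrite /okc /= => /andP[l3 s] nb; move: l3 s nb; rewrite /k.
  by case: l => [|[|[|l]]] //= _ s _; lia.
case: l => [|[|[|l]]] //= _ s nb; last by case: i s {nb} => [|i] /=; lia.
  by case: j s {nb} => [|j] /=; lia.
rewrite ltnS addn1 ltn_neqAle; have ik : i <= k' by move: s; lia.
rewrite -ltnS -[_ < _.+1]/(i + j < k'.+1) -{2}(addn0 (i + j)) s andbT; apply/eqP=> E.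
by apply: (nb i ik); rewrite /rim_code; congr (_, _, _, _); move: E; clear; lia.
Qed.

Lemma cd_surj d : exists phi q, [/\ phi \in pflag F, okc q & d = kd q phi].
Proof.
have dF : fset d \in F := flagF d.
have [u uT nd] := far_cover PT D56 farK Ef dF.
have fl : flat PT u k' by have := @far_flat V F PT D56 k farK Ef u k' uT (leqnSn k').
have [phi [s [ft ->]]] := touched_code D56 fl nd.
exists phi, (dec s); split=> //; first by rewrite inE ft.
by rewrite /okc dec3 dec_sz.
Qed.

(** The 120 sectors with [3 * k ^ 2] codes each match the [6 * (60 * k ^ 2)] flags in number, and by
    [cd_surj] every flag is coded. *)
Lemma cd_inj phi psi q q' : phi \in pflag F -> psi \in pflag F -> okc q -> okc q' ->
  kd q phi = kd q' psi -> phi = psi /\ q = q'.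
Proof.
pose Psi (w : flag F * ('I_k * 'I_k * 'I_3)) := kd (dec w.2) w.1.
pose D := setX (pflag F) [set: 'I_k * 'I_k * 'I_3].
have inj : {in D &, injective Psi}.
  apply/imset_injP; rewrite eqn_leq leq_imset_card.
  rewrite cardsX cardsT !card_prod !card_ord (card_pflag PT D56).
  apply: (@leq_trans #|{: flag F}|); first by rewrite (card_flags PT) Ef -!mulnn; clear; nia.
  apply: subset_leq_card; apply/subsetP=> d _; have [phi' [q1 [pP /andP[q3 qs] ->]]] := cd_surj d.
  by have [s <-] := dec_ex q3 qs; apply/imsetP; exists (phi', s); rewrite // in_setX pP in_setT.
move=> pP qP /andP[q3 qs] /andP[q3' qs'] E.
have [s Es] := dec_ex q3 qs; have [s' Es'] := dec_ex q3' qs'.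
have : (phi, s) = (psi, s').
  by apply: inj; rewrite ?in_setX ?pP ?qP ?in_setT // /Psi /= Es Es'.
by case=> -> Ess; rewrite -Es -Es' Ess.
Qed.

Definition rim i phi := kd (rim_code i) phi.

Let bdc_ok i : i <= k' -> okc (rim_code i).
Proof. by move=> ik; rewrite /okc /= addn0 subnKC. Qed.

Let bd_inj i j phi psi : i <= k' -> j <= k' -> phi \in pflag F -> psi \in pflag F ->
  rim i phi = rim j psi -> phi = psi /\ i = j.
Proof.
move=> ik jk pP qP E; have [-> E'] := cd_inj pP qP (bdc_ok ik) (bdc_ok jk) E.
by split=> //; case: E'.
Qed.

Let bd_r6 i phi : i <= k' -> phi \in pflag F -> iter 6 r (rim i phi) = rim i phi.
Proof.
move=> ik pP; apply: flag_r6.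
apply: (FL pP (erefl _) (i := i.+1) (j := k' - i)); rewrite addSn subnKC //; exact: leqnn.
Qed.

Let rE d : r d = h (x (x d)). Proof. exact: gr_gx. Qed.

Let rcd q psi : okc q -> r (kd q psi) = h (kd (xstep (xstep q)) psi).
Proof. by move=> qo; rewrite rE !cd_x //; [have /andP[] := xstep_ok qo|case/andP: qo]. Qed.

(** At a vertex of degree 6 in the middle of the rim the cone fills three of the six triangles; at a
    corner each sector fills two. *)
Let bd_step i phi : i < k' -> phi \in pflag F -> r (r (r (rim i phi))) = h (rim i.+1 phi).
Proof.
move=> ik pP; have [j Ej] : exists j, k' - i = j.+1 by exists (k' - i).-1; lia.
have o1 l : l < 3 -> okc (false, i, j.+1, l) by move=> l3; rewrite /okc /= l3 /k; lia.
have o2 l : l < 3 -> okc (true, i, j, l) by move=> l3; rewrite /okc /= l3 /k; lia.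
have o3 l : l < 3 -> okc (false, i.+1, j, l) by move=> l3; rewrite /okc /= l3 /k; lia.
rewrite /rim /rim_code Ej (_ : k' - i.+1 = j); last by move: Ej; clear; lia.
have e1 : r (kd (false, i, j.+1, 1) phi) = kd (true, i, j, 2) phi.
  by rewrite rcd ?o1 //; apply: (cdh pP (o1 0 isT)).
have e2 : r (kd (true, i, j, 2) phi) = kd (false, i.+1, j, 2) phi.
  by rewrite rcd ?o2 //; apply: (cdh pP (o2 1 isT)).
by rewrite e1 e2 rcd ?o3.
Qed.

Let bd_corner phi : phi \in pflag F -> r (r (rim k' phi)) = h (rim 0 (i1 phi)).
Proof.
move=> pP; have o1 l : l < 3 -> okc (false, k', 0, l) by move=> l3; rewrite /okc /= l3 /k; lia.
have o2 l : l < 3 -> okc (false, 0, k', l) by move=> l3; rewrite /okc /= l3 /k; lia.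
have e1 : r (kd (false, k', 0, 1) phi) = kd (false, 0, k', 2) (i1 phi).
  by rewrite rcd ?o1 //; apply: (cdh pP (o1 0 isT)).
by rewrite /rim /rim_code subnn subn0 e1 rcd ?o2.
Qed.

(** If the flag across the rim were not on a rim, crossing back would stay inside its cone and give
    the rim flag a second code. *)
Let bd_out i phi : i <= k' -> phi \in pflag F ->
  exists j psi, [/\ j <= k', psi \in pflag F & h (rim i phi) = rim j psi].
Proof.
move=> ik pP; have [psi [q [qP qo E]]] := cd_surj (h (rim i phi)).
have [/existsP[j /eqP Ej]|nb] := boolP [exists j : 'I_k, q == rim_code j].
  by exists j, psi; split=> //; [rewrite -ltnS|rewrite E Ej].
have qo' : okc (hst q).1.
  apply: hstep_ok => // j jk Eq; case/existsP: nb; rewrite -ltnS in jk.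
  by exists (Ordinal jk); rewrite Eq.
have := congr1 h E; rewrite (ghK aK cK ac) cdh // => E2.
have [_ Eb] := cd_inj pP (hstepP q qP) (bdc_ok ik) qo' E2.
exfalso; move: Eb qo; rewrite /rim_code; case: (q) => -[[[] i'] j'] l.
  case: l => [|[|l]] //= [<- <-]; rewrite /okc /= subnKC // /k addn1 ltnn //.
case: l => [|[|l]] //=; first by case: j'.
by case: i'.
Qed.

(** Starting from one matched pair, three turns at each vertex advance along both rims at once, in
    opposite directions. It remains to show that the match starts at the end of the other rim. *)
Lemma eta_ex phi : phi \in pflag F ->
  exists2 psi, psi \in pflag F & forall i, i <= k' -> h (rim i phi) = rim (k' - i) psi.
Proof.
move=> pP; have [j0 [psi [jk qP E0]]] := bd_out (leq0n k') pP.
have key i : i <= j0 -> h (rim i phi) = rim (j0 - i) psi.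
  elim: i => [|i IH] ij; first by rewrite subn0.
  have ik : i < k' by apply: leq_trans ij jk.
  have jk2 : j0 - i.+1 < k' by move: ij jk; clear; lia.
  have := IH (ltnW ij); rewrite (_ : j0 - i = (j0 - i.+1).+1); last by move: ij; clear; lia.
  move=> E; rewrite -bd_step // -[rim i phi](ghK aK cK ac) E -bd_step //.
  exact: (bd_r6 (ltnW jk2) qP).
suff E : j0 = k' by exists psi => // i ik; rewrite -E key ?E.
apply/eqP; rewrite eqn_leq jk leqNgt; apply/negP=> jlt; exfalso.
(* Otherwise the rim of [phi] would run on past a corner of the other sector; there two rim flags
   would differ by a turn [x] inside a triangle, against [cd_inj]. *)
have [j1 [ps1 [j1k p1P E1]]] := bd_out jlt pP.
have [j2 [ps2 [j2k p2P E2]]] := bd_out (leqnn k') (rP qP).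
have : x (rim j2 ps2) = rim j1 ps1.
  rewrite -E1 -E2 -bd_step // -[rim j0 phi](ghK aK cK ac) key // subnn.
  have := bd_corner (rP qP); rewrite (grK bK cK) => <-.
  rewrite -(gi_gx b aK cK ac) -{1}(bd_r6 (leqnn k') (rP qP)) /= (grK bK cK) //.
rewrite /rim cd_x // => E.
have [_] := cd_inj p2P p1P (xstep_ok (bdc_ok j2k)) (bdc_ok j1k) E.
by [].
Qed.

Definition eta phi := odflt phi [pick psi | (psi \in pflag F) && (h (rim 0 phi) == rim k' psi)].

Lemma etaP phi : phi \in pflag F ->
  eta phi \in pflag F /\ forall i, i <= k' -> h (rim i phi) = rim (k' - i) (eta phi).
Proof.
move=> pP; have [psi qP H] := eta_ex pP.
have E0 := H 0 (leq0n k'); rewrite subn0 in E0.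
rewrite /eta; case: pickP => [ps /andP[sP /eqP E]|/(_ psi)]; last by rewrite qP E0 eqxx.
by rewrite E in E0; have [-> _] := bd_inj (leqnn k') (leqnn k') sP qP E0.
Qed.

Let eta_uniq phi psi : phi \in pflag F -> psi \in pflag F -> h (rim 0 phi) = rim k' psi -> eta phi = psi.
Proof.
move=> pP qP E; have [eP /(_ 0 (leq0n k'))] := etaP pP; rewrite subn0 E => E'.
by have [-> _] := bd_inj (leqnn k') (leqnn k') qP eP E'.
Qed.

Let etaK phi : phi \in pflag F -> eta (eta phi) = phi.
Proof.
move=> pP; have [eP H] := etaP pP; apply: eta_uniq => //.
by have := H k' (leqnn k'); rewrite subnn => <-; rewrite (ghK aK cK ac).
Qed.

Let a_bd i phi : i <= k' -> phi \in pflag F -> a (rim i phi) = rim (k' - i) (b phi).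
Proof.
move=> ik pP; have -> : a (rim i phi) = b (x (rim i phi)) by rewrite /gx bK.
rewrite /rim cd_x // cdb ?xstep_ok ?bdc_ok //= /rim_code subKn //.
Qed.

Let ha d : h (a d) = a (h d). Proof. by rewrite /gh -ac. Qed.

Let eta_b phi : phi \in pflag F -> eta (b phi) = b (eta phi).
Proof.
move=> pP; have [eP H] := etaP pP; apply: eta_uniq; rewrite ?bP //.
have := a_bd (leqnn k') pP; rewrite subnn => <-; rewrite ha H // subnn a_bd // subn0 //.
Qed.

(** Three sectors meet at a corner of degree 6, each taking two of its triangles. *)
Let eta_i3 phi : phi \in pflag F -> eta (i1 (eta (i1 (eta (i1 phi))))) = phi.
Proof.
move=> pP; have key psi : psi \in pflag F -> r (r (rim k' psi)) = rim k' (eta (i1 psi)).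
  by move=> qP; rewrite bd_corner //; have [_ ->] := etaP (iP qP); rewrite ?subn0.
have eP psi : psi \in pflag F -> eta (i1 psi) \in pflag F by move=> qP; have [] := etaP (iP qP).
have := bd_r6 (leqnn k') pP; rewrite /= !key ?eP // => E.
by have [-> _] := bd_inj (leqnn k') (leqnn k') (eP _ (eP _ (eP _ pP))) pP E.
Qed.

(** On the icosahedron formed by the cones these act as [s2], [s1] and [s0] do on flags: the
    products have orders 5, 3 and 2, from the degree of the apex, from [eta_i3] and from [eta_b]. *)
Definition gens : seq (flag F -> flag F) := [:: b; c; fun phi => eta (b phi)].

Let gensP g t : t \in pflag F -> nth id gens g t \in pflag F.
Proof.
case: g => [|[|[|g]]] tP //=; [exact: bP|exact: cP| |by rewrite nth_nil].
by have [] := etaP (bP tP).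
Qed.

Let gens_rules p : p \in H3_rules -> valid gens (fun t => t \in pflag F) p.
Proof.
have eP psi : psi \in pflag F -> eta psi \in pflag F by move=> qP; have [] := etaP qP.
rewrite !inE => /orP[/eqP->|/orP[/eqP->|/orP[/eqP->|/orP[/eqP->|/orP[/eqP->|/eqP->]]]]] t tP /=.
- by rewrite bK.
- by rewrite cK.
- by rewrite -eta_b ?bP // bK etaK.
- by rewrite -eta_b ?bP.
- have H psi : psi \in pflag F -> eta (b (c (eta (b (c (eta (b (c psi)))))))) = psi := @eta_i3 psi.
  have G psi : psi \in pflag F -> eta (b (eta (b psi))) = psi.
    by move=> qP; rewrite -eta_b ?bP // bK etaK.
  have := H (c (eta (b (c t)))) (cP (eP _ (bP (cP tP)))).
  by rewrite cK G ?cP // cK.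
- have d5 : tri_deg F (fx t) = 5 by move: tP; rewrite !inE => /eqP.
  have R5 d : fx d = fx t -> iter 5 r d = d.
    by move=> Ed; have := rr_deg PT d; rewrite Ed d5.
  have := R5 (b (c (b (c (b t))))) erefl.
  by rewrite /= /gr !(bK, cK).
Qed.

(** The flags coded in the sectors of [X] are closed under [a], [b] and [c], hence they are all
    flags. *)
Let gens_trans (X : {set flag F}) : X \subset pflag F -> X != set0 ->
  (forall g t, t \in X -> nth id gens g t \in X) -> X = pflag F.
Proof.
move=> sX /set0Pn[t0 t0X] cl.
have Xb t : t \in X -> b t \in X by apply: (cl 0).
have Xc t : t \in X -> c t \in X by apply: (cl 1).
have Xe t : t \in X -> eta t \in X.
  by move=> tX; rewrite -[t]bK; apply: (cl 2); apply: Xb.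
have XP t : t \in X -> t \in pflag F := subsetP sX t.
pose Y d := exists phi q, [/\ phi \in X, okc q & d = kd q phi].
have Yx d : Y d -> Y (x d).
  case=> phi [q [pX qo ->]]; exists phi, (xstep q); rewrite xstep_ok ?cd_x //.
  by case/andP: qo.
have Yb d : Y d -> Y (b d).
  by case=> phi [q [pX qo ->]]; exists (b phi), (bstep q); rewrite bstep_ok ?cdb ?Xb ?XP.
have Yh d : Y d -> Y (h d).
  case=> phi [q [pX qo ->]].
  have [/existsP[j /eqP Ej]|nb] := boolP [exists j : 'I_k, q == rim_code j].
    have jk : j <= k' by rewrite -ltnS.
    exists (eta phi), (rim_code (k' - j)); rewrite Xe // bdc_ok ?leq_subr // Ej.
    by have [_ ->] := etaP (XP _ pX).
  exists ((hst q).2 phi), (hst q).1; rewrite cdh ?XP // hstep_ok //; last first.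
    by move=> j jk Eq; case/existsP: nb; rewrite -ltnS in jk; exists (Ordinal jk); rewrite Eq.
  split=> //; move: pX; clear -Xb Xc; case: q => -[[[] i] j] l pX; first by case: l => [|[|l]].
  case: l => [|[|l]] //=; last by case: i => //=; apply: Xc; apply: Xb.
  by case: j => //=; apply: Xb; apply: Xc.
have Ya d : Y d -> Y (a d) by move=> Yd; rewrite -[a d]bK; apply/Yb/Yx.
have Yc d : Y d -> Y (c d).
  by move=> Yd; have -> : c d = a (h d) by [rewrite /gh aK]; apply/Ya/Yh.
have Yt : Y t0 by exists t0, (false, 0, 0, 0).
have all_Y := @flag_ind V F PT D56 Y t0 Yt Ya Yb Yc.
apply/eqP; rewrite eqEsubset sX; apply/subsetP=> t tP.
have [phi [q [pX qo E]]] := all_Y t.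
by have [-> _] := @cd_inj t phi (false, 0, 0, 0) q tP (XP _ pX) isT qo E.
Qed.

(** [H3_extend] permutes the sectors compatibly with their gluing; keeping the codes extends this to
    all flags, and [aut_of_flags] turns it into an automorphism. *)
Lemma aut_trans phi psi : phi \in pflag F -> psi \in pflag F ->
  exists2 s, s \in graph_aut F & act s phi = psi.
Proof.
move=> pP qP.
have [g [gphi gP ginj gg]] := @H3_extend _ gens (pflag F) gensP erefl gens_rules
  (card_pflag PT D56) gens_trans phi psi pP qP.
have gb t : t \in pflag F -> g (b t) = b (g t) by apply: (gg 0).
have gc t : t \in pflag F -> g (c t) = c (g t) by apply: (gg 1).
have ge t : t \in pflag F -> g (eta t) = eta (g t).
  by move=> tP; have := gg 2 (b t) (bP tP); rewrite /= bK gb // bK.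
pose cod d : code * flag F := odflt ((false, 0, 0, 0), d)
  (omap (fun w : flag F * ('I_k * 'I_k * 'I_3) => (dec w.2, w.1))
    [pick w : flag F * ('I_k * 'I_k * 'I_3) | (w.1 \in pflag F) && (kd (dec w.2) w.1 == d)]).
pose G d := kd (cod d).1 (g (cod d).2).
have GE q t : okc q -> t \in pflag F -> G (kd q t) = kd q (g t).
  move=> qo tP; rewrite /G /cod; case: pickP => [w /andP[wP /eqP E]|H] /=.
    have wo : okc (dec w.2) by rewrite /okc dec3 dec_sz.
    by have [-> ->] := cd_inj wP tP wo qo E.
  have /andP[q3 qs] := qo; have [s Es] := dec_ex q3 qs.
  by have := H (t, s); rewrite /= tP Es eqxx.
have Gx d : G (x d) = x (G d).
  have [t [q [tP qo ->]]] := cd_surj d; have /andP[q3 _] := qo.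
  by rewrite cd_x // !GE ?xstep_ok // cd_x.
have Gb d : G (b d) = b (G d).
  by have [t [q [tP qo ->]]] := cd_surj d; rewrite cdb // !GE ?bstep_ok ?bP // cdb ?gP // gb.
have Gh d : G (h d) = h (G d).
  have [t [q [tP qo ->]]] := cd_surj d.
  have [/existsP[j /eqP Ej]|nb] := boolP [exists j : 'I_k, q == rim_code j].
    have jk : j <= k' by rewrite -ltnS.
    rewrite Ej; have [eP ->] := etaP tP => //; rewrite /rim !GE ?bdc_ok ?leq_subr //.
    by rewrite ge //; have [_ /(_ j jk) E] := etaP (gP _ tP); apply/esym/E.
  rewrite cdh // !GE ?hstepP //; last first.
    apply: hstep_ok => // j jk Eq; case/existsP: nb; rewrite -ltnS in jk.
    by exists (Ordinal jk); rewrite Eq.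
  rewrite cdh ?gP //; congr (kd _ _); move: tP; clear -gb gc bP cP.
  case: q => -[[[] i] j] l tP; first by case: l => [|[|l]].
  case: l => [|[|l]] //=; last by case: i => //=; rewrite /gr gc ?gb ?bP.
  by case: j => //=; rewrite /gi gb ?gc ?cP.
have Ga d : G (a d) = a (G d).
  by have -> : a d = b (x d) by [rewrite /gx bK]; rewrite Gb Gx /gx bK.
have Gc d : G (c d) = c (G d).
  by have -> : c d = a (h d) by [rewrite /gh aK]; rewrite Ga Gh /gh aK.
have Ginj : injective G.
  move=> d e; have [t [q [tP qo ->]]] := cd_surj d; have [t' [q' [tP' qo' ->]]] := cd_surj e.
  rewrite !GE // => /(cd_inj (gP _ tP) (gP _ tP') qo qo')[E ->].
  by rewrite (ginj _ _ tP tP' E).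
have [s sA sG] := aut_of_flags D56 Ginj Ga Gb Gc.
by exists s => //; rewrite sG; apply: etrans (GE (false, 0, 0, 0) phi isT pP) gphi.
Qed.

Lemma act_cd s q phi : s \in graph_aut F -> act s (kd q phi) = kd q (act s phi).
Proof.
move=> sA; have AA d : act s (gA a b c d) = gA a b c (act s d).
  by rewrite /gA /gi /gh !(act_a PT D56 _ sA, act_b PT D56 _ sA, act_c PT D56 _ sA).
have AB d : act s (gB a b c d) = gB a b c (act s d).
  by rewrite /gB /gr /gx /gh !(act_a PT D56 _ sA, act_b PT D56 _ sA, act_c PT D56 _ sA).
have Ax d : act s (x d) = x (act s d) by rewrite /gx act_b // act_a.
have Ah d : act s (h d) = h (act s d) by rewrite /gh act_a // act_c.
have AU i j d : act s (U PT i j d) = U PT i j (act s d).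
  rewrite /U; elim: i => [|i IH]; last by rewrite !iterS AA IH.
  by elim: j => // j IH; rewrite !iterS AB IH.
case: q => -[[u i] j] l; rewrite /cd; elim: l => [|l IH]; last by rewrite !iterS Ax IH.
by case: u; rewrite /= ?Ah ?Ax AU.
Qed.

(** For each generator take the automorphism with the same effect on [phi0]. Automorphisms commute
    with [gens], so words correspond: the relations carry over, and [H3_free] gives 120 different
    elements. *)
Lemma forward_isog : graph_aut F \isog Ih.
Proof.
have [t0 t0T] : exists t, t \in pent F by apply/set0Pn; rewrite -card_gt0 (card_pent PT D56).
have [phi0 E0] := vertex_flag PT t0.
have p0 : phi0 \in pflag F by rewrite inE E0.
have act_eta s phi : s \in graph_aut F -> phi \in pflag F -> act s (eta phi) = eta (act s phi).
  move=> sA pP; apply/esym/eta_uniq; rewrite ?(act_pflag PT D56) //; first by have [] := etaP pP.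
  rewrite /rim -!act_cd //; have [_ /(_ 0 (leq0n k'))] := etaP pP; rewrite subn0 /rim => <-.
  by rewrite /gh (act_a PT D56 _ sA) (act_c PT D56 _ sA).
have act_gens s g phi : s \in graph_aut F -> phi \in pflag F ->
    act s (nth id gens g phi) = nth id gens g (act s phi).
  move=> sA pP; case: g => [|[|[|g]]] /=; rewrite ?nth_nil //.
  - exact: (act_b PT D56).
  - exact: (act_c PT D56).
  - by rewrite act_eta ?bP // (act_b PT D56).
have ex_m g : exists s, (s \in graph_aut F) && (act s phi0 == nth id gens g phi0).
  have [s sA E] := aut_trans p0 (gensP g p0).
  by exists s; rewrite sA E eqxx.
pose m g := xchoose (ex_m g).
have mA g : m g \in graph_aut F by have /andP[] := xchooseP (ex_m g).
have mE g : act (m g) phi0 = nth id gens g phi0 by have /andP[_ /eqP] := xchooseP (ex_m g).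
pose gs := [:: m 0; m 1; m 2].
have gsA g : nth 1%g gs g \in graph_aut F.
  by case: g => [|[|[|g]]] //=; rewrite ?nth_nil //; apply: (group1 (aut_group F)).
have gsE g : act (nth 1%g gs g) phi0 = nth id gens g phi0.
  by case: g => [|[|[|g]]] /=; rewrite ?mE ?nth_nil ?(act1 PT D56).
have wA w : gev gs w \in graph_aut F.
  elim: w => [|g w IH]; first exact: (group1 (aut_group F)).
  by rewrite gev_cons; apply: (groupM (G := aut_group F)).
have evP w : ev gens w phi0 \in pflag F by apply: (ev_in (S := fun t => t \in pflag F) gensP).
have wE w : act (gev gs w) phi0 = ev gens w phi0.
  elim: w => [|g w IH]; first exact: (act1 PT D56).
  by rewrite gev_cons -(actM PT D56) // gsE act_gens // IH.
have Hg p : p \in H3_rules -> gev gs p.1 = gev gs p.2.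
  by move=> pR; apply: (act_inj PT D56 (d := phi0)); rewrite ?wA // !wE; apply: gens_rules.
have cA : #|graph_aut F| <= 120.
  rewrite -(card_pflag PT D56) -(card_in_imset (f := fun s => act s phi0)).
    by apply: subset_leq_card; apply/subsetP=> d /imsetP[s sA ->]; rewrite (act_pflag PT D56).
  by move=> s t sA tA; apply: (act_inj PT D56).
have sG : <<[set y in gs]>>%g \subset graph_aut F.
  rewrite (gen_subG _ (aut_group F)); apply/subsetP=> s; rewrite inE => /(nthP 1%g)[i _ <-]; exact: gsA.
have cG : 120 <= #|<<[set y in gs]>>%g|.
  apply: H3_card_ge; apply: (@map_uniq _ _ (fun s => act s phi0)); rewrite -map_comp.
  rewrite (eq_map (g := fun w => ev gens w phi0)) => [|w]; last by rewrite /= wE.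
  rewrite map_inj_in_uniq; first by vm_compute.
  exact: (@H3_free _ gens (pflag F) gensP erefl gens_rules (card_pflag PT D56) gens_trans phi0 p0).
have -> : graph_aut F = <<[set y in gs]>>%g.
  by apply/eqP; rewrite eq_sym eqEcard sG (leq_trans cA cG).
rewrite -ico_group; apply: H3_isog => //; [exact: ico_rules|exact: ico_card].
Qed.

End Forward.

(** * The theorem *)

Lemma even_faces (V : finType) (F : {set {set V}}) : plane_triangulation F -> 2 %| #|F|.
Proof.
move=> PT; have := nei_double PT setT; have := card_faces PT setT.
have Z j : j != 3 -> nfc F setT j = 0.
  move=> nj; apply: eq_card0 => t; rewrite !inE setIT.
  by apply/negP=> /andP[/(card_face PT) -> /eqP E]; move: nj; rewrite -E.
rewrite (Z 0) // (Z 1) // (Z 2) // !add0n => -> E.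
have : 2 %| 3 * nfc F setT 3 by rewrite -E dvdn_mulr.
by rewrite Gauss_dvdr.
Qed.

(** Both 2 and 3 divide [t], so [t = 6 * w] and [f = 15 * w ^ 2]; evenness of [f] passes to [w]. *)
Lemma tight_square (t f : nat) : 5 * t ^ 2 = 12 * f -> 2 %| f ->
  exists k, t = 12 * k /\ f = 60 * k ^ 2.
Proof.
move=> E f2.
have dt p : prime p -> p %| 12 -> coprime p 5 -> p %| t.
  move=> pp p12 p5; have : p %| 5 * t ^ 2 by rewrite E dvdn_mulr.
  by rewrite Gauss_dvdr // Euclid_dvdX // => /andP[].
have /dvdnP[w Ew] : 6 %| t by rewrite (@Gauss_dvd 2 3) // !dt.
have Ef : f = 15 * w ^ 2 by move: E; rewrite Ew expnMn; lia.
have /dvdnP[k Ek] : 2 %| w by move: f2; rewrite Ef Gauss_dvdr // Euclid_dvdX // => /andP[].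
by exists k; split; [lia|rewrite Ef Ek expnMn; lia].
Qed.

Lemma card_Ih : #|<<[set x in ico_gens]>>%g| = 120.
Proof. by apply/eqP; rewrite eqn_leq ico_card H3_card //; apply: ico_rules. Qed.

Lemma tau_eq_iff (V : finType) (F : {set {set V}}) : plane_triangulation F ->
  (forall v : V, tri_deg F v = 5 \/ tri_deg F v = 6) ->
  5 * tau F (pent F) ^ 2 = 12 * #|F| <->
  (exists2 k, 0 < k & #|F| = 60 * k ^ 2) /\ (graph_aut F \isog Ih).
Proof.
move=> PT D56.
have [x0 x0T] : exists t, t \in pent F by apply/set0Pn; rewrite -card_gt0 (card_pent PT D56).
split=> [E|[[k k0 Ef] iso]].
  have [[|k] [Et Ef]] := tight_square E (even_faces PT).
    have [a [b f]] := vertex_face PT x0.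
    have : 0 < #|F| by apply/card_gt0P; exists [set x0; a; b].
    by rewrite Ef.
  split; first by exists k.+1.
  exact: (forward_isog PT D56 (tight_far PT D56 Et Ef) Ef).
have c120 : #|graph_aut F| = 120.
  rewrite -card_Ih; rewrite -ico_group in iso.
  exact: (card_isog (G := aut_group F) (H := <<[set x in ico_gens]>>%G) iso).
have h1 := far_tau PT D56 (reg_far PT D56 Ef c120).
have h2 := tau_ineq PT D56 x0; rewrite Ef in h2 *.
suff -> : tau F (pent F) = 12 * k by rewrite expnMn; lia.
apply/eqP; rewrite eqn_leq h1 andbT -leq_sqr expnMn; lia.
Qed.

Import Order.TTheory GRing.Theory Num.Theory.
Local Open Scope ring_scope.

Theorem theorem5p1 (R : rcfType) (V : finType) (F : {set {set V}}) :
  plane_triangulation F ->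
  (forall v : V, tri_deg F v = 5%N \/ tri_deg F v = 6%N) ->
  let T := [set v | tri_deg F v == 5%N] in
  let f := #|F| in
  ((tau F T)%:R <= Num.sqrt (12 / 5 * f%:R) :> R) /\
  ((tau F T)%:R = Num.sqrt (12 / 5 * f%:R) :> R <->
     (exists2 k : nat, (0 < k)%N & f = (60 * k ^ 2)%N) /\
     (graph_aut F \isog Ih)).
Proof.
move=> PT D56 T f; rewrite -[T]/(pent F).
have [x0 x0T] : exists t, t \in pent F by apply/set0Pn; rewrite -card_gt0 (card_pent PT D56).
have c0 : 0 <= 12 / 5 * f%:R :> R by rewrite mulr_ge0 ?divr_ge0 ?ler0n.
have t0 : 0 <= (tau F (pent F))%:R :> R by rewrite ler0n.
have sq : Num.sqrt ((tau F (pent F))%:R ^+ 2) = (tau F (pent F))%:R :> R by rewrite sqrtr_sqr ger0_norm.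
(* Carries the squared comparison with cleared denominator over to natural numbers, for the order
   and for equality at once. *)
have eqv (rel : nat -> nat -> bool) (relR : R -> R -> bool) :
    (forall m n, relR m%:R n%:R = rel m n) ->
    relR ((tau F (pent F))%:R ^+ 2 * 5) (12 * f%:R) = rel (5 * tau F (pent F) ^ 2)%N (12 * f)%N.
  by move=> H; rewrite -natrX -natrM -[12]/(12%:R) -natrM H mulnC.
split.
  rewrite -sq ler_wsqrtr // mulrAC ler_pdivlMr ?ltr0n //.
  by rewrite (eqv leq) => [|m n]; [exact: tau_ineq|exact: ler_nat].
rewrite -(tau_eq_iff PT D56) -/f; split=> E.
  apply/eqP; rewrite -(eqv eq_op eq_op) => [|m n]; last exact: eqr_nat.
  by rewrite E sqr_sqrtr // mulrAC divfK // pnatr_eq0.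
rewrite -sq; congr Num.sqrt; apply/eqP; rewrite mulrAC eq_sym -subr_eq0.
have /eqP E' : (tau F (pent F))%:R ^+ 2 * 5 == 12 * f%:R :> R.
  by rewrite (eqv eq_op eq_op) => [|m n]; [apply/eqP|exact: eqr_nat].
by rewrite subr_eq0 -E' mulfK // pnatr_eq0.
Qed.
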